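(* Let $\Gamma=F(A_1,\dots,A_k)$, $k\ge2$, be the free group on $k$ generators, and let $B\subseteq\mathbb{Z}^k$ be a set that has asymptotic density $d(B)$ with respect to the Euclidean norm. Then $$\frac12\left(\frac{\Pi_B(m)}{\Pi(m)}+\frac{\Pi_B(m+1)}{\Pi(m+1)}\right)\to d(B)\qquad\text{as }m\to\infty.$$
   Context: For $j=1,\dots,k$ the discrete logarithm $\log_j:\Gamma\to\mathbb{Z}$ is the homomorphism with $\log_j(A_i)=\delta_{ij}$ (the exponent sum of $A_j$), and $\Phi(\gamma)=(\log_1(\gamma),\dots,\log_k(\gamma))\in\mathbb{Z}^k$; $\Phi$ is constant on conjugacy classes. The length $l(\{\gamma\})$ of a conjugacy class is the minimal word length (with respect to $A_1^{\pm1},\dots,A_k^{\pm1}$) of its elements, i.e. the length of a cyclically reduced representative. $\Pi_B(m)$ is the number of conjugacy classes $\{\gamma\}$ of $\Gamma$ with $l(\{\gamma\})\le m$ and $\Phi(\{\gamma\})\in B$, and $\Pi(m)=\Pi_{\mathbb{Z}^k}(m)$. $B$ has asymptotic density $d(B)$ if $\#\{\beta\in B:\|\beta\|\le r\}/\#\{\beta\in\mathbb{Z}^k:\|\beta\|\le r\}\to d(B)$ as $r\to\infty$, $\|\cdot\|$ the Euclidean norm. *)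

(* Defs.v *)
From HB Require Import structures.
From mathcomp Require Import all_boot all_order all_algebra finmap.
From mathcomp Require Import boolp classical_sets functions cardinality.
From mathcomp Require Import reals ereal topology normedtype sequences.

Set Implicit Arguments.
Unset Strict Implicit.
Unset Printing Implicit Defensive.

Import Order.TTheory GRing.Theory Num.Theory.
Import numFieldNormedType.Exports.
Local Open Scope classical_set_scope.
Local Open Scope ring_scope.

(* The pair (i, false) encodes the generator A_i, (i, true) its inverse. *)
Notation letter k := ('I_k * bool)%type.

Definition letter_inv k (a : letter k) : letter k := (a.1, ~~ a.2).

Definition reduced k (w : seq (letter k)) : bool :=
  sorted (fun a b => b != letter_inv a) w.

(* Left multiplication of a reduced word by one letter. *)
Definition cons_red k (a : letter k) (w : seq (letter k)) : seq (letter k) :=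
  if w is b :: w' then if b == letter_inv a then w' else a :: w else [:: a].

Definition mul_word k (u v : seq (letter k)) : seq (letter k) :=
  foldr (@cons_red k) v u.

Definition inv_word k (u : seq (letter k)) : seq (letter k) :=
  rev (map (@letter_inv k) u).

Record free_group k := FreeGroup {
  word :> seq (letter k);
  _ : reduced word
}.

HB.instance Definition _ k := [isSub for @word k].
HB.instance Definition _ k := [Countable of free_group k by <:].

Section Words.
Variable k : nat.
Implicit Types (a b : letter k) (u v w : seq (letter k)).

Lemma letter_invK : involutive (@letter_inv k).
Proof. by case=> i b; rewrite /letter_inv /= negbK. Qed.

Lemma reduced_behead a w : reduced (a :: w) -> reduced w.
Proof. exact: path_sorted. Qed.

Lemma cons_red_reduced a w : reduced w -> reduced (cons_red a w).
Proof.
case: w => [|b w] //= rw; case: ifPn => [_|ab]; first exact: path_sorted rw.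
by rewrite /= ab.
Qed.

Lemma cons_redE a w : reduced (a :: w) -> cons_red a w = a :: w.
Proof. by case: w => [|b w] //= /andP[/negbTE ->]. Qed.

Lemma cons_redK a w : reduced w -> cons_red (letter_inv a) (cons_red a w) = w.
Proof.
case: w => [|b w] rw; first by rewrite /= letter_invK eqxx.
rewrite [cons_red a _]/=; case: ifPn => [/eqP bE|_].
  by rewrite -bE cons_redE.
by rewrite /= letter_invK eqxx.
Qed.

Lemma mul_word_reduced u v : reduced v -> reduced (mul_word u v).
Proof. by move=> rv; elim: u => //= a u; apply: cons_red_reduced. Qed.

Lemma mul_wordw0 u : reduced u -> mul_word u [::] = u.
Proof.
by elim: u => //= a u IH ru; rewrite -/(mul_word _ _) IH ?cons_redE //;
  apply: reduced_behead ru.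
Qed.

Lemma mul_word_cons_red a u v : reduced v ->
  mul_word (cons_red a u) v = cons_red a (mul_word u v).
Proof.
move=> rv; case: u => [|b u] //=; case: ifPn => [/eqP -> |//].
rewrite -{1}[a]letter_invK cons_redK //.
exact: mul_word_reduced.
Qed.

Lemma mul_wordA u v w : reduced w ->
  mul_word u (mul_word v w) = mul_word (mul_word u v) w.
Proof.
by move=> rw; elim: u => //= a u ->; rewrite -/(mul_word _ _) mul_word_cons_red.
Qed.

Lemma inv_word_reduced u : reduced u -> reduced (inv_word u).
Proof.
rewrite /reduced /inv_word rev_sorted sorted_map; apply: sub_sorted => a b /=.
by rewrite letter_invK eq_sym (inv_eq letter_invK).
Qed.

Lemma mul_word_cat u v w : mul_word (u ++ v) w = mul_word u (mul_word v w).
Proof. exact: foldr_cat. Qed.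

Lemma mul_inv_word u v : reduced v ->
  mul_word (inv_word u) (mul_word u v) = v.
Proof.
move=> rv; elim: u => //= a u IH.
rewrite /inv_word /= rev_cons -cats1 mul_word_cat /=.
by rewrite cons_redK // mul_word_reduced.
Qed.

Lemma inv_wordK u : inv_word (inv_word u) = u.
Proof. by rewrite /inv_word map_rev revK mapK //; apply: letter_invK. Qed.

Lemma size_cons_red a w : (size (cons_red a w) <= (size w).+1)%N.
Proof. by case: w => [|b w] //=; case: ifP => //= _; rewrite ltnW. Qed.

End Words.

Section FreeGroup.
Variable k : nat.
Implicit Types x y z : free_group k.

Lemma reduced_word x : reduced x.
Proof. by case: x. Qed.

Definition free_one : free_group k := FreeGroup (isT : reduced [::]).

Definition free_mul x y : free_group k :=
  FreeGroup (mul_word_reduced x (reduced_word y)).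

Definition free_inv x : free_group k :=
  FreeGroup (inv_word_reduced (reduced_word x)).

Lemma free_mulA : associative free_mul.
Proof.
by move=> x y z; apply: val_inj; rewrite /= mul_wordA // reduced_word.
Qed.

Lemma free_mul1 : left_id free_one free_mul.
Proof. by move=> x; apply: val_inj. Qed.

Lemma free_mulr1 : right_id free_one free_mul.
Proof. by move=> x; apply: val_inj; rewrite /= mul_wordw0 // reduced_word. Qed.

Lemma free_mulV : left_inverse free_one free_inv free_mul.
Proof.
move=> x; apply: val_inj => /=.
by rewrite -{2}[word x]mul_wordw0 ?reduced_word // mul_inv_word.
Qed.

Lemma free_mulrV : right_inverse free_one free_inv free_mul.
Proof.
move=> x; rewrite -[X in free_mul X _](_ : free_inv (free_inv x) = x).
  exact: free_mulV.
by apply: val_inj; rewrite /= inv_wordK.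
Qed.

HB.instance Definition _ := isGroup.Build (free_group k)
  free_mulA free_mul1 free_mulr1 free_mulV free_mulrV.

End FreeGroup.

Definition free_gen k (i : 'I_k) : free_group k :=
  FreeGroup (isT : reduced [:: (i, false)]).

Definition letter_val k (a : letter k) : free_group k :=
  if a.2 then ((free_gen a.1)^-1)%g else free_gen a.1.

(* The size of the reduced word is the word length with respect to the
   generators and their inverses, by word_lengthP and word_length_min. *)
Definition word_length k (g : free_group k) : nat := size (word g).

(* dlogM and dlog_gen state that this is the homomorphism to the integers
   sending A_i to 1 if i = j and to 0 otherwise. *)
Definition dlog k (j : 'I_k) (g : free_group k) : int :=
  (count_mem (j, false) (word g))%:Z - (count_mem (j, true) (word g))%:Z.

Definition Phi k (g : free_group k) : 'rV[int]_k := \row_j dlog j g.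

Definition conj_class k (g : free_group k) : set (free_group k) :=
  [set (g ^ h)%g | h in [set: free_group k]].

(* A minimum, by class_lengthP. *)
Definition class_length k (C : set (free_group k)) : nat :=
  infimum 0%N [set word_length g | g in C].

(* Phi is a class function (Phi_conj), so the choice of g does not matter. *)
Definition classes_le k (B : set 'rV[int]_k) (m : nat) :
    set (set (free_group k)) :=
  [set conj_class g | g in
    [set g | (class_length (conj_class g) <= m)%N /\ B (Phi g)]].

(* fset_set A is empty when A is infinite; here and in lattice_count the sets
   are finite, by finite_classes_le and finite_lattice_ball. *)
Definition Pi k (B : set 'rV[int]_k) (m : nat) : nat :=
  #|` fset_set (classes_le B m)|%fset.

Definition enorm (R : realType) k (b : 'rV[int]_k) : R :=
  Num.sqrt (\sum_j (b 0 j)%:~R ^+ 2).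

Definition lattice_count (R : realType) k (B : set 'rV[int]_k) (r : R) : nat :=
  #|` fset_set [set b | B b /\ enorm R b <= r]|%fset.

Definition has_density (R : realType) k (B : set 'rV[int]_k) (d : R) : Prop :=
  ((lattice_count B r)%:R / (lattice_count [set: 'rV[int]_k] r)%:R : R)
    @[r --> (+oo : set_system R)] --> d.

Section Facts.
Variable k : nat.
Implicit Types (g h : free_group k) (s : seq (letter k)).

Lemma word_prod s :
  word (\prod_(a <- s) letter_val a)%g = mul_word s [::].
Proof.
elim: s => [|a s IH]; first by rewrite big_nil.
rewrite big_cons /= -IH.
case: a => i [] //=.
Qed.

Lemma word_lengthP g : g = (\prod_(a <- word g) letter_val a)%g.
Proof. by apply: val_inj; rewrite /= word_prod mul_wordw0 // reduced_word. Qed.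

Lemma word_length_min g s :
  g = (\prod_(a <- s) letter_val a)%g -> (word_length g <= size s)%N.
Proof.
move=> ->; rewrite /word_length word_prod.
elim: s => //= a s IH; apply: leq_trans (size_cons_red _ _) _.
by rewrite ltnS.
Qed.

Lemma dlogM j : {morph (@dlog k j) : g h / (g * h)%g >-> g + h}.
Proof.
pose wlog1 s : int :=
  (count_mem (j, false) s)%:Z - (count_mem (j, true) s)%:Z.
have cE a s : wlog1 (a :: s) = wlog1 [:: a] + wlog1 s.
  by rewrite /wlog1 /= !addn0 !PoszD opprD addrACA.
have cV a : wlog1 [:: letter_inv a] = - wlog1 [:: a].
  case: a => i b; rewrite /wlog1 /letter_inv /= !xpair_eqE !addn0.
  by case: b; case: (i == j).
have c0 : wlog1 [::] = 0 by [].
have cR a s : wlog1 (cons_red a s) = wlog1 [:: a] + wlog1 s.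
  case: s => [|b s] /=; first by rewrite c0 addr0.
  case: ifPn => [/eqP ->|_]; last by rewrite cE.
  by rewrite [wlog1 (_ :: s)]cE cV addrA subrr add0r.
move=> g h; rewrite /dlog -!/(wlog1 _) /=.
elim: (word g) => [|a s IH] /=; first by rewrite c0 add0r.
by rewrite cR IH addrA -cE.
Qed.

Lemma dlog_gen (i j : 'I_k) : dlog j (free_gen i) = (i == j)%:Z.
Proof. by rewrite /dlog /= !xpair_eqE; case: (i == j). Qed.

Lemma Phi_conj g h : Phi (g ^ h)%g = Phi g.
Proof.
apply/rowP => j; rewrite !mxE conjgE !dlogM addrCA -dlogM.
by rewrite mulVg /dlog /= subrr addr0.
Qed.

Lemma class_lengthP g :
  [set word_length h | h in conj_class g] (class_length (conj_class g)) /\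
  forall h, conj_class g h -> (class_length (conj_class g) <= word_length h)%N.
Proof.
set A := [set _ | _ in _].
have A0 : A !=set0 by exists (word_length (g ^ 1)%g); exists (g ^ 1)%g => //; exists 1%g.
pose P n := `[< A n >].
have exP : exists n, P n by case: A0 => n An; exists n; apply/asboolP.
case: (ex_minnP exP) => n /asboolP An nmin.
have infE : class_length (conj_class g) = n.
  have inf_n : infimums A n.
    split; last by move=> p /(_ n An).
    by move=> p Ap; apply: nmin; apply/asboolP.
  rewrite /class_length /infimum -/A ifF; last first.
    by apply/negbTE/eqP => AE; move: A0; rewrite AE => -[].
  by case: xgetP => [p _ /is_subset1_infimums|/(_ n)]; [apply|].
rewrite infE; split => // h gh; apply: nmin; apply/asboolP; by exists h.
Qed.

Lemma finite_classes_le (B : set 'rV[int]_k) m : finite_set (classes_le B m).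
Proof.
pose f (t : {n : 'I_m.+1 & n.-tuple (letter k)}) : free_group k :=
  insubd (free_one k) (tval (tagged t)).
have fS : finite_set (f @` setT) by apply/finite_image/finite_finset.
apply: sub_finite_set (finite_image (@conj_class k) fS).
move=> _ [g [gm _] <-].
have [[_ [x _ <-] gx] _] := class_lengthP g.
exists (g ^ x)%g; last first.
  rewrite /conj_class; apply/seteqP; split=> _ [y _ <-].
    by exists (x * y)%g => //; rewrite conjgM.
  by exists (x^-1 * y)%g => //; rewrite -conjgM mulgA mulgV mul1g.
have le_m : (size (word (g ^ x)%g) < m.+1)%N.
  by rewrite ltnS -/(word_length _) gx.
pose t : (Ordinal le_m).-tuple (letter k) := in_tuple (word (g ^ x)%g).
exists (Tagged (fun n : 'I_m.+1 => n.-tuple (letter k)) t) => //.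
by rewrite /f /= -[LHS]/(insubd _ (val (g ^ x)%g)) valKd.
Qed.

End Facts.

Lemma finite_lattice_ball (R : realType) k (B : set 'rV[int]_k) (r : R) :
  finite_set [set b | B b /\ enorm R b <= r].
Proof.
pose N := Num.bound r.
pose f (t : {ffun 'I_k -> 'I_(N + N).+1}) : 'rV[int]_k :=
  \row_j ((t j : nat)%:Z - N%:Z).
have fS : finite_set (f @` setT) by apply/finite_image/finite_finset.
apply: sub_finite_set fS => b /= [_ br].
have bN j : (`|b 0 j|%R <= N%:Z)%R.
  have r_ge0 : 0 <= r by apply: le_trans br; apply: sqrtr_ge0.
  rewrite -(ler_int R) intr_norm -sqrtr_sqr.
  have rN : r <= N%:~R.
    by apply: ltW; apply: archi_boundP.
  apply: le_trans (le_trans br rN); apply: ler_wsqrtr.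
  rewrite (bigD1 j) //= lerDl; apply: sumr_ge0 => i _; exact: sqr_ge0.
exists [ffun j => inord (absz (b 0 j + N%:Z))] => //.
apply/rowP => j; rewrite mxE ffunE.
have := bN j; rewrite ler_norml => /andP[lo hi].
have b0 : 0 <= b 0 j + N%:Z by rewrite -lerBlDr sub0r.
rewrite inordK; last by rewrite ltnS -lez_nat gez0_abs // PoszD lerD2r.
by rewrite gez0_abs // addrK.
Qed.

(* Main.v *)
(* Conjugacy classes of length n are the rotation classes of cyclically reduced
   words of length n, so up to periodic words, which are negligible, there are
   c_n / n of them, c_n being the number of such words. With q = 2k - 1, the
   generating function of the c_n words over their image in Z^k is the trace of
   the n-th power of a twisted non-backtracking matrix, and equals
   2 q^(n/2) T_n (C / q^(1/2)) up to a bounded term, where C = sum_j cos theta_j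
   and T_n is the Chebyshev polynomial. After division by q^n this is close to
   exp (- n (k - C) / (k - 1)) near C = k, and to (-1)^n times its mirror image
   near C = - k; the average over n and n + 1 loses the second peak and is close
   to prod_j ((1 + cos theta_j) / 2)^N with N about 2 n / (k - 1), the transform
   of a product of centered binomial laws. By Plancherel on a finite torus the two
   laws on Z^k are close in L2, hence, by Cauchy-Schwarz on a ball of radius
   L n^(1/2) and a second moment bound outside, in total variation. The binomial
   product is asymptotically a function of the Euclidean norm, so Abel summation
   over balls shows that it gives B mass tending to d(B). The classes of length at
   most m are weighted sums, with weights q^n / n, of the counts for each length;
   such sums preserve the convergence of averages over consecutive indices. *)

Require Import Defs.
From mathcomp Require Import all_boot all_order all_algebra finmap.
From mathcomp Require Import boolp classical_sets functions cardinality.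
From mathcomp Require Import reals ereal topology normedtype sequences exp.
From mathcomp Require Import complex cyclic cyclotomic separable.
From mathcomp Require Import zify ring lra.
Set Implicit Arguments.
Unset Strict Implicit.
Unset Printing Implicit Defensive.
Import Order.TTheory GRing.Theory Num.Theory.
Import numFieldNormedType.Exports.
Local Open Scope classical_set_scope.
Local Open Scope ring_scope.

(** * The trace formula for closed non-backtracking words *)

(** Every letter changes the coordinate sum by one, so all words of length n have images of the same
    parity. For B the vectors of even coordinate sum, of density 1/2, a single quotient of counts
    oscillates, since the lengths near m dominate an exponentially growing total. This is the peak
    at C = - k, and it rules out any convergence for one length alone. The comparison law has to
    charge both parities, hence the lazy steps: (1 + cos theta) / 2 vanishes at theta = pi, so their
    transform has only the peak at C = k. The value of N comes from matching exponents at that peak: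
    the larger root of the Chebyshev recurrence, divided by q, has slope 1 / (k - 1) in C there,
    while a lazy step loses half of 1 - cos theta_j. The transforms then differ by O(1/n) times heat
    kernels at the two peaks. The squared L2 distance is therefore of order n^(-2) n^(-k/2), and a
    ball of volume n^(k/2) turns it into a total variation of order 1/n for fixed L. Averaging has
    to survive the division of two cumulative counts: each rescaled count obeys a recurrence with a
    factor close to 1/q, and such a contraction transmits vanishing pair sums. *)

Definition compatible k (a b : letter k) : bool := b != letter_inv a.

Definition cyc_reduced k (w : seq (letter k)) : bool := cycle (@compatible k) w.

Lemma big_tuple_cons (V : nmodType) (T : finType) n (P : pred (seq T))
    (F : seq T -> V) :
  \sum_(w : n.+1.-tuple T | P w) F w =
  \sum_a \sum_(w : n.-tuple T | P (a :: w)) F (a :: w).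
Proof.
rewrite pair_big_dep /=.
rewrite (reindex (fun p : T * n.-tuple T => cons_tuple p.1 p.2)) /=.
  by [].
exists (fun w => (thead w, [tuple of behead w])) => [[a w] _|w _] /=.
  by congr pair; apply: val_inj.
by rewrite [RHS]tuple_eta; apply: val_inj.
Qed.

Lemma big_tuple0 (V : nmodType) (T : finType) (P : pred (seq T))
    (F : seq T -> V) :
  \sum_(w : 0.-tuple T | P w) F w = if P [::] then F [::] else 0.
Proof.
rewrite (eq_bigr (fun=> F [::])) => [|w _]; last by rewrite tuple0.
rewrite (eq_bigl (fun=> P [::])) => [|w]; last by rewrite tuple0.
case: ifP => _; last by rewrite big_pred0.
by rewrite big_const card_tuple expn0 /= addr0.
Qed.

(* For x = 2 C this is 2 q^(n/2) T_n (C / q^(1/2)), T_n being the Chebyshev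
   polynomial of the first kind. *)
Fixpoint cheb_pair (F : pzRingType) (q x : F) (n : nat) : F * F :=
  if n is n'.+1 then
    let: (u, v) := cheb_pair q x n' in (v, x * v - q * u)
  else (2, x).
Definition cheb (F : pzRingType) (q x : F) n : F := (cheb_pair q x n).1.

Lemma cheb0 (F : pzRingType) (q x : F) : cheb q x 0 = 2. Proof. by []. Qed.
Lemma cheb1 (F : pzRingType) (q x : F) : cheb q x 1 = x. Proof. by []. Qed.
Lemma chebSS (F : pzRingType) (q x : F) n :
  cheb q x n.+2 = x * cheb q x n.+1 - q * cheb q x n.
Proof. by rewrite /cheb /=; case: cheb_pair. Qed.

Lemma cheb_rmorph (F F' : pzRingType) (f : {rmorphism F -> F'}) (q x : F) n :
  cheb (f q) (f x) n = f (cheb q x n).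
Proof.
suff: cheb (f q) (f x) n = f (cheb q x n) /\
      cheb (f q) (f x) n.+1 = f (cheb q x n.+1) by case.
elim: n => [|n [IH1 IH2]]; first by rewrite !cheb0 !cheb1 rmorph_nat.
by split=> //; rewrite !chebSS IH1 IH2 rmorphB !rmorphM.
Qed.

Section Trace.
Variables (F : fieldType) (k : nat) (z : 'I_k -> F).
Hypothesis z_neq0 : forall i, z i != 0.
Implicit Types a b c : letter k.

Definition letter_wt a : F := if a.2 then (z a.1)^-1 else z a.1.
Local Notation zl := letter_wt.
Local Notation S := (\sum_a zl a).
Local Notation K := ((k.*2)%:R : F).
Local Notation q := (K - 1).

Lemma letter_wt_neq0 a : zl a != 0.
Proof. by case: a => i [] /=; rewrite /letter_wt /= ?invr_eq0. Qed.

Lemma letter_wtV a : zl (letter_inv a) = (zl a)^-1.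
Proof. by case: a => i []; rewrite /letter_wt //= invrK. Qed.

Lemma sum_letter_wt : S = \sum_i (z i + (z i)^-1).
Proof.
rewrite -(pair_bigA _ (fun i s => zl (i, s))) /=.
by apply: eq_bigr => i _; rewrite big_bool /= addrC.
Qed.

Lemma card_letter : #|{: letter k}| = k.*2.
Proof. by rewrite card_prod card_ord card_bool muln2. Qed.

Lemma sum_letter1 : \sum_(a : letter k) (1 : F) = K.
Proof. by rewrite sumr_const card_letter. Qed.

(** Neither endpoint is weighted: [zl a * path_sum n a b] is the entry (a, b) of power n + 1 of the
    non-backtracking matrix, and for b = a the word closes up. *)
Definition path_sum n a b : F :=
  \sum_(w : n.-tuple (letter k) | path (@compatible k) a (rcons w b))
     \prod_(c <- w) zl c.

Lemma path_sum0 a b : path_sum 0 a b = (compatible a b)%:R.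
Proof.
rewrite /path_sum (big_tuple0 (fun w => path _ a (rcons w b))
  (fun w => \prod_(c <- w) zl c)) /= andbT big_nil.
by case: compatible.
Qed.

Lemma path_sumS n a b :
  path_sum n.+1 a b = \sum_(c | compatible a c) zl c * path_sum n c b.
Proof.
rewrite /path_sum (big_tuple_cons _ (fun w => path _ a (rcons w b))
  (fun w => \prod_(c <- w) zl c)) /=.
rewrite [RHS]big_mkcond /=; apply: eq_bigr => c _.
case: compatible => /=; last by rewrite big_pred0.
by rewrite mulr_sumr; apply: eq_bigr => w _; rewrite big_cons.
Qed.

(** The coefficients of t^2 / ((1 - t^2) (1 - S t + q t^2)): the first factor comes from the
    involution that undoes a letter, the second one is the Chebyshev recurrence. *)
Fixpoint trace_coef_pair (n : nat) : F * F :=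
  if n is n'.+1 then
    let: (u, v) := trace_coef_pair n' in (v, S * v - q * u + (~~ odd n')%:R)
  else (0, 0).
Definition trace_coef n : F := (trace_coef_pair n).1.
Local Notation g := trace_coef.

Lemma trace_coefSS n : g n.+2 = S * g n.+1 - q * g n + (~~ odd n)%:R.
Proof. by rewrite /trace_coef /=; case: trace_coef_pair. Qed.

Definition flip_pow n a b : F :=
  if odd n then - zl a * (b == letter_inv a)%:R else (b == a)%:R.

(* The matrix (zl a * [compatible a b]) is d e^T - Q with e = (1,...,1),
   d = (zl a) and Q = (zl a * [b = a^-1]), an involution exchanging d and e; so
   its powers are (-Q)^n plus a combination of the four products of d, e with
   e^T, e^T Q. *)
Lemma path_sumE n a b :
  zl a * path_sum n a b = flip_pow n.+1 a b - g n.+1 + g n / zl b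
     + g n.+2 * zl a - g n.+1 * (zl a / zl b).
Proof.
have zn0 := letter_wt_neq0.
elim: n => [|n IHn] in a *.
  rewrite path_sum0 /flip_pow /= trace_coefSS /compatible.
  have -> : g 1 = 0 by []. have -> : g 0 = 0 by [].
  by case: eqP => _ /=; ring.
pose f c := flip_pow n.+1 c b - g n.+1 + g n / zl b
     + g n.+2 * zl c - g n.+1 * (zl c / zl b).
(* Only the inverse of [a] is forbidden after [a]: the restricted sum is a full sum, which depends
   on the weights through [S] and [K] alone, minus one term. *)
have -> : path_sum n.+1 a b = \sum_c f c - f (letter_inv a).
  rewrite path_sumS [in RHS](bigD1 (letter_inv a)) //= addrAC subrr add0r.
  by apply: eq_big => c; rewrite /compatible // => _; rewrite IHn.
have sumQ : \sum_c flip_pow n.+1 c b = if odd n.+1 then - (zl b)^-1 else 1.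
  rewrite /flip_pow; case: (odd n.+1).
    rewrite (bigD1 (letter_inv b)) //= letter_invK eqxx mulr1 letter_wtV.
    rewrite big1 ?addr0 // => c cb.
    by rewrite eq_sym (inv_eq (@letter_invK k)) (negbTE cb) mulr0.
  rewrite (bigD1 b) //= eqxx big1 ?addr0 // => c cb.
  by rewrite eq_sym (negbTE cb).
have -> : \sum_c f c = (if odd n.+1 then - (zl b)^-1 else 1) - K * g n.+1
    + K * (g n / zl b) + S * g n.+2 - S * (g n.+1 / zl b).
  rewrite -sumQ -sum_letter1 !mulr_suml -!sumrB -!big_split -sumrB /=.
  by apply: eq_bigr => c _; rewrite /f; field.
rewrite /f !(trace_coefSS n.+1) (trace_coefSS n) letter_wtV /flip_pow letter_invK.
rewrite /= letter_wtV.
case: (odd n) => /=.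
  by field; rewrite !zn0.
by field; rewrite !zn0.
Qed.

(** The right-hand side is the trace without the part due to the involution; its parity term absorbs
    the inhomogeneity of [trace_coefSS], so the homogeneous Chebyshev recurrence remains. *)
Lemma trace_coef_cheb n :
  cheb q S n.+1 =
  S * (g n + g n.+2) - 2 * K * g n.+1 + 2 * (odd n)%:R.
Proof.
suff: cheb q S n.+1 = S * (g n + g n.+2) - 2 * K * g n.+1 + 2 * (odd n)%:R /\
  cheb q S n.+2 = S * (g n.+1 + g n.+3) - 2 * K * g n.+2 + 2 * (odd n.+1)%:R.
  by case.
elim: n => [|n [IH1 IH2]].
  rewrite chebSS cheb1 cheb0 !trace_coefSS /=.
  have -> : g 1 = 0 by []. have -> : g 0 = 0 by [].
  by split; ring.
split=> //; rewrite chebSS IH1 IH2.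
rewrite !(trace_coefSS n.+2) !(trace_coefSS n.+1) !(trace_coefSS n) /=.
by case: (odd n) => /=; ring.
Qed.

(** The trace of the matrix power. The term with K - 2 collects the eigenvalues 1 and -1,
    generically of multiplicity k - 1 each, off the plane of d and e. *)
Lemma cyc_reduced_sum n : (0 < n)%N ->
  \sum_(w : n.-tuple (letter k) | cyc_reduced w) \prod_(c <- w) zl c =
  cheb q S n + (K - 2) * (~~ odd n)%:R.
Proof.
case: n => // n _.
rewrite (big_tuple_cons _ (@cyc_reduced k) (fun w => \prod_(c <- w) zl c)).
have -> : \sum_a \sum_(w : n.-tuple (letter k) | cyc_reduced (a :: w))
     \prod_(c <- a :: w) zl c = \sum_a zl a * path_sum n a a.
  by apply: eq_bigr => a _; rewrite mulr_sumr; apply: eq_bigr => w _; rewrite big_cons.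
rewrite trace_coef_cheb.
transitivity (\sum_a ((odd n)%:R * 1 - 2 * g n.+1 * 1 + (g n + g n.+2) * zl a
   + g n * ((zl a)^-1 - zl a))).
  apply: eq_bigr => a _; rewrite path_sumE /flip_pow eqxx divff ?letter_wt_neq0 //.
  have -> : (a == letter_inv a) = false by case: a => i []; rewrite /letter_inv xpair_eqE /= andbF.
  by rewrite /=; case: (odd n) => /=; field; rewrite letter_wt_neq0.
have sumV : \sum_a (zl a)^-1 = S.
  rewrite (reindex_inj (can_inj (@letter_invK k))) /=.
  by apply: eq_bigr => a _; rewrite letter_wtV invrK.
transitivity ((odd n)%:R * K - 2 * g n.+1 * K + (g n + g n.+2) * S
   + g n * (\sum_a (zl a)^-1 - S)).
  by rewrite -sum_letter1 -[in RHS]sumrB !mulr_sumr -sumrB -!big_split.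
by rewrite sumV /=; case: (odd n) => /=; ring.
Qed.

End Trace.

(** * Chebyshev polynomials against the heat kernel *)

Lemma ler_of_eq (d : Order.disp_t) (T : porderType d) (x y : T) : x = y -> (x <= y)%O.
Proof. by move=> ->. Qed.

Section ChebyshevBounds.
Variable R : realType.
Implicit Types (x y v a b q : R) (n : nat).

(** A Pell identity: with V the companion sequence of the second kind, the square is D V^2 + 4 q^n,
    and D <= 0. The induction carries the mixed product as well, so it never meets the complex
    roots. *)
Lemma cheb_le_sqrt q x n : x ^+ 2 <= 4 * q -> cheb q x n ^+ 2 <= 4 * q ^+ n.
Proof.
move=> xq; pose D := x ^+ 2 - 4 * q.
suff [V [W [-> _ _]]] : exists V W : R,
  [/\ cheb q x n ^+ 2 = D * V ^+ 2 + 4 * q ^+ n,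
      cheb q x n * cheb q x n.+1 = D * (V * W) + 2 * x * q ^+ n &
      cheb q x n.+1 ^+ 2 = D * W ^+ 2 + 4 * q ^+ n.+1].
  by rewrite gerDr mulr_le0_ge0 ?sqr_ge0 // /D; lra.
elim: n => [|n [V [W [H1 H2 H3]]]].
  exists 0, 1; rewrite cheb0 cheb1 /D !expr0 expr1; split; ring.
exists W, (x * W - q * V); split=> //; rewrite chebSS.
  transitivity (x * cheb q x n.+1 ^+ 2 - q * (cheb q x n * cheb q x n.+1)); first by ring.
  by rewrite H2 H3 !(exprS q); ring.
transitivity (x ^+ 2 * cheb q x n.+1 ^+ 2
   - 2 * x * q * (cheb q x n * cheb q x n.+1) + q ^+ 2 * cheb q x n ^+ 2); first by ring.
by rewrite H1 H2 H3 !(exprS q); ring.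
Qed.

Lemma cheb_roots q x a b n : a + b = x -> a * b = q -> cheb q x n = a ^+ n + b ^+ n.
Proof.
move=> <- <-.
suff: cheb (a * b) (a + b) n = a ^+ n + b ^+ n /\
  cheb (a * b) (a + b) n.+1 = a ^+ n.+1 + b ^+ n.+1 by case.
elim: n => [|n [IH1 IH2]]; first by rewrite cheb0 cheb1 !expr0 !expr1.
by split=> //; rewrite chebSS IH1 IH2 !exprS; ring.
Qed.

Lemma cheb_oppr q x n : cheb q (- x) n = (-1) ^+ n * cheb q x n.
Proof.
suff: cheb q (- x) n = (-1) ^+ n * cheb q x n /\
      cheb q (- x) n.+1 = (-1) ^+ n.+1 * cheb q x n.+1 by case.
elim: n => [|n [IH1 IH2]]; first by rewrite !cheb0 !cheb1; split; ring.
by split=> //; rewrite !chebSS IH1 IH2 !exprS; ring.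
Qed.

(** Powers of v are absorbed by giving up half of the exponent; this is how errors of the form n y^2
    exp (- n y) become O(1/n) times a slower exponential. *)
Lemma ler_expRN2 v : 0 <= v -> v ^+ 2 * expR (- v) <= 8 * expR (- (v / 2)).
Proof.
move=> v0; have v20 : 0 <= v / 2 by lra.
have := expR_ge1Dxn 1 v20; rewrite -[(2)`!]/2%N => H.
have -> : expR (- v) = expR (- (v / 2)) * expR (- (v / 2)) by rewrite -expRD; congr expR; lra.
rewrite mulrA ler_pM2r ?expR_gt0 // expRN -ler_pdivlMr ?invr_gt0 ?expR_gt0 // invrK.
by move: H; rewrite expr_div_n; lra.
Qed.

Lemma ler_expRN1 v : 0 <= v -> v * expR (- v) <= 2 * expR (- (v / 2)).
Proof.
move=> v0; have H := expR_ge1Dx (v / 2).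
have -> : expR (- v) = expR (- (v / 2)) * expR (- (v / 2)) by rewrite -expRD; congr expR; lra.
rewrite mulrA ler_pM2r ?expR_gt0 // expRN -ler_pdivlMr ?invr_gt0 ?expR_gt0 // invrK.
by lra.
Qed.

Lemma expRN_ub y : 0 <= y -> expR (- y) <= 1 - y + y ^+ 2.
Proof.
move=> y0; have H := expR_ge1Dx y; have E0 := expR_gt0 (- y).
have E1 : expR (- y) * expR y = 1 by rewrite -expRD addNr expR0.
have : expR (- y) * (1 + y) <= 1 by rewrite -[leRHS]E1 ler_wpM2l // ltW.
by nra.
Qed.

Lemma expRN_dist y : 0 <= y -> `|1 - y - expR (- y)| <= y ^+ 2.
Proof.
move=> y0; have := expRN_ub y0; have := expR_ge1Dx (- y).
by have := sqr_ge0 y; rewrite ler_norml => H0 H1 H2; apply/andP; split; lra.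
Qed.

Lemma expRM_nat y n : expR (- (n%:R * y)) = expR (- y) ^+ n.
Proof. by rewrite -mulrN expRM_natl. Qed.

Lemma distX_le a b M n : 0 <= a <= M -> 0 <= b <= M ->
  `|a ^+ n.+1 - b ^+ n.+1| <= n.+1%:R * M ^+ n * `|a - b|.
Proof.
move=> /andP[a0 aM] /andP[b0 bM]; elim: n => [|n IH].
  by rewrite !expr1 expr0 !mul1r.
have -> : a ^+ n.+2 - b ^+ n.+2 = a * (a ^+ n.+1 - b ^+ n.+1) + (a - b) * b ^+ n.+1.
  by rewrite (exprS a n.+1) (exprS b n.+1); ring.
apply: le_trans (ler_normD _ _) _; rewrite !normrM (ger0_norm a0).
rewrite (ger0_norm (exprn_ge0 n.+1 b0)).
have M0 : 0 <= M by lra.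
apply: (@le_trans _ _ (M * (n.+1%:R * M ^+ n * `|a - b|) + `|a - b| * M ^+ n.+1)).
  apply: lerD; first by apply: ler_pM.
  by rewrite ler_wpM2l // lerXn2r // nnegrE.
by rewrite (exprS M n) -[n.+2%:R]natr1; apply: ler_of_eq; ring.
Qed.

Lemma prod_dist_le (I : finType) (f g : I -> R) :
  (forall i, 0 <= f i <= 1) -> (forall i, 0 <= g i <= 1) ->
  `|\prod_i f i - \prod_i g i| <= \sum_i `|f i - g i|.
Proof.
move=> f01 g01; suff [_] : (0 <= \prod_i f i <= 1 /\ 0 <= \prod_i g i <= 1) /\
  `|\prod_i f i - \prod_i g i| <= \sum_i `|f i - g i| by [].
elim/big_rec3: _ => [|i S b a _ [[/andP[a0 a1] /andP[b0 b1]] IH]].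
  by rewrite subrr normr0 ler01 lexx.
have /andP[f0 f1] := f01 i; have /andP[g0 g1] := g01 i.
split; first by rewrite !mulr_ge0 ?mulr_ile1.
have -> : f i * a - g i * b = (f i - g i) * a + g i * (a - b) by ring.
apply: le_trans (ler_normD _ _) _; rewrite !normrM (ger0_norm a0) (ger0_norm g0).
apply: lerD; first by rewrite ler_piMr.
by apply: le_trans IH; rewrite ler_piMl.
Qed.

Lemma ler_expRN_half v : 0 < v -> expR (- v) <= 2 / v * expR (- (v / 2)).
Proof.
move=> v0; have := ler_expRN1 (ltW v0).
by rewrite mulrAC ler_pdivlMr // mulrC.
Qed.

Lemma bernoulli x n : 0 <= x -> 1 + n%:R * x <= (1 + x) ^+ n.
Proof.
move=> x0; elim: n => [|n IH]; first by rewrite mul0r addr0 expr0.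
rewrite exprS -natr1; have n0 : 0 <= n%:R :> R by [].
have : (1 + x) * (1 + n%:R * x) <= (1 + x) * (1 + x) ^+ n by rewrite ler_wpM2l //; lra.
by nra.
Qed.

End ChebyshevBounds.

(** * The transform near its peak C = k *)

Section ChebyshevHeat.
Variables (R : realType) (k : nat).
Hypothesis k_ge2 : (2 <= k)%N.

Local Notation kk := (k%:R : R).
Definition branching : R := (k.*2)%:R - 1.
Local Notation q := branching.
Local Notation sq := (Num.sqrt q).
(** The slope at C = k of the larger root C + sqrt (C^2 - q), divided by q; that quotient equals 1
    at C = k. *)
Definition kap : R := (k%:R - 1)^-1.

Definition cheb_norm (n : nat) (C : R) : R := cheb q (2 * C) n / q ^+ n.
Local Notation u := cheb_norm.

Lemma kk_ge2 : 2 <= kk. Proof. by rewrite ler_nat. Qed.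
Lemma qE : q = 2 * kk - 1.
Proof. by rewrite /branching -mul2n natrM. Qed.
Lemma q_ge3 : 3 <= q. Proof. by have := kk_ge2; rewrite qE; lra. Qed.
Lemma q_gt0 : 0 < q. Proof. by have := q_ge3; lra. Qed.
Lemma kap_gt0 : 0 < kap. Proof. by have := kk_ge2; rewrite /kap invr_gt0; lra. Qed.
Lemma kapE : kap * (kk - 1) = 1.
Proof. by rewrite /kap mulVf //; have := kk_ge2; apply: contraTneq; lra. Qed.
Lemma kap_le1 : kap <= 1.
Proof. by have := kapE; have := kap_gt0; have := kk_ge2; nra. Qed.
Lemma kapk : kap * kk = 1 + kap. Proof. by have := kapE; lra. Qed.

Lemma sq_gt0 : 0 < sq. Proof. by rewrite sqrtr_gt0 q_gt0. Qed.
Lemma sqE : sq ^+ 2 = q. Proof. by rewrite sqr_sqrtr // ltW // q_gt0. Qed.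
Lemma sq_lt_k : sq < kk.
Proof. have k2 := kk_ge2; have k0 : 0 <= kk by lra.
rewrite -ltr_sqr ?nnegrE ?(ltW sq_gt0) // sqE qE; nra.
Qed.

(** Since 3/5 = 4/5 * 3/4 bounds 1 / sqrt q, the powers of 4/5 pay for 4 / n by Bernoulli, and 3/4
    <= exp (-1/4). The form matches that of the main error term. *)
Lemma sqV_expR n : (0 < n)%N -> sq^-1 ^+ n <= 4 / n%:R * expR (- (n%:R / 4)).
Proof.
move=> n0; have e4 : 3 / 4 <= expR (- (1 / 4)) :> R.
  by have := expR_ge1Dx (- (1 / 4) : R); lra.
have s53 : 5 / 3 <= sq by have := sqE; have := sq_gt0; have := q_ge3; nra.
have sV : sq^-1 <= 4 / 5 * expR (- (1 / 4)).
  apply: (@le_trans _ _ (5 / 3)^-1); first by rewrite lef_pV2 ?posrE ?sq_gt0 //; lra.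
  by lra.
have nE : - (n%:R / 4) = - (n%:R * (1 / 4)) :> R by lra.
rewrite nE expRM_nat; apply: (@le_trans _ _ ((4 / 5 * expR (- (1 / 4))) ^+ n)).
  by rewrite lerXn2r ?nnegrE ?invr_ge0 ?(ltW sq_gt0) // mulr_ge0 ?expR_ge0 //; lra.
rewrite exprMn ler_wpM2r ?exprn_ge0 ?expR_ge0 //.
have nR : 0 < n%:R :> R by rewrite ltr0n.
rewrite ler_pdivlMr //.
have -> : (4 / 5 : R) = (1 + 1 / 4)^-1 by field.
have B : 1 + n%:R * (1 / 4) <= (1 + 1 / 4) ^+ n :> R by apply: bernoulli; lra.
have P : 0 < (1 + 1 / 4) ^+ n :> R by apply: exprn_gt0; lra.
rewrite exprVn mulrC ler_pdivrMr //; move: B; move: (_ ^+ n) => P0; lra.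
Qed.

Lemma cheb_norm_small n C : `|C| <= sq -> `|u n C| <= 2 * sq^-1 ^+ n.
Proof.
move=> Csq; have q0 := q_gt0.
have C2 : (2 * C) ^+ 2 <= 4 * q.
  rewrite -sqE exprMn; suff : C ^+ 2 <= sq ^+ 2 by lra.
  by rewrite -[C ^+ 2]real_normK ?num_real // lerXn2r ?nnegrE ?(ltW sq_gt0).
have H : `|cheb q (2 * C) n| <= 2 * sq ^+ n.
  rewrite -ler_sqr ?nnegrE ?mulr_ge0 ?exprn_ge0 ?(ltW sq_gt0) //.
  rewrite real_normK ?num_real // exprMn -[in leRHS]exprM mulnC exprM sqE.
  by apply: le_trans (cheb_le_sqrt n C2) _; rewrite expr2; lra.
rewrite /u normrM [X in _ * X]ger0_norm ?invr_ge0 ?exprn_ge0 ?(ltW q0) //.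
rewrite ler_pdivrMr ?exprn_gt0 //; apply: le_trans H _; apply: ler_of_eq.
rewrite -mulrA -exprMn; congr (_ * _ ^+ _).
rewrite -[X in _ = _ * X]sqE expr2 mulrA mulVf ?mul1r //.
by rewrite gt_eqF // sq_gt0.
Qed.

(* Concavity of [C + sqrt (C^2 - q)]: [1 - y] is its tangent at [C = k],
   rescaled by [q]. *)
Lemma top_root_bounds C (r := (C + Num.sqrt (C ^+ 2 - q)) / q) (y := kap * (kk - C)) :
  sq <= C <= kk -> 1 - y - 4 * kk ^+ 3 * y ^+ 2 <= r <= 1 - y.
Proof.
move=> /andP[sC Ck]; have k2 := kk_ge2; have q0 := q_gt0.
have kp0 := kap_gt0; have kpE := kapE; have kpk := kapk.
have s0 := sq_gt0; have sE := sqE; have qE' := qE.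
have D0 : 0 <= C ^+ 2 - q by nra.
set D := C ^+ 2 - q in D0 r *; have rtE := sqr_sqrtr D0.
have rt0 := sqrtr_ge0 D; set rt := Num.sqrt D in rtE rt0 r *.
have y0 : 0 <= y by rewrite /y mulr_ge0 //; lra.
(* [C + w = q * (1 - y)], so [w] is the tangent of the square root [rt] at C = k, and
   [w ^+ 2 - D = q * y ^+ 2] measures exactly how far it lies above. *)
pose w := kk - 1 - kk * y.
have w0 : 0 <= w.
  suff : 0 <= (kk - 1) * w by rewrite pmulr_rge0 //; lra.
  have -> : (kk - 1) * w = kk * C - q.
    rewrite /w /y qE'; transitivity ((kk-1)^+2 - (kap * (kk - 1)) * kk * (kk - C)); first by ring.
    by rewrite kpE; ring.
  have : (kk * sq) <= kk * C by rewrite ler_wpM2l //; lra.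
  have sk := sq_lt_k; nra.
have wD : w ^+ 2 - D = q * y ^+ 2.
  have s_y : kk - C = (kk - 1) * y by rewrite /y mulrA [_ * kap]mulrC kpE mul1r.
  have CE : C = kk - (kk - 1) * y by lra.
  by rewrite /w /D CE qE'; ring.
have rtw : rt <= w.
  rewrite -ler_sqr ?nnegrE // rtE; suff : 0 <= q * y ^+ 2 by lra.
  by rewrite mulr_ge0 ?sqr_ge0 // ltW.
have CE : C = kk - (kk - 1) * y by rewrite /y mulrA [_ * kap]mulrC kpE; lra.
have qr : q * r = C + rt by rewrite /r mulrC divfK // gt_eqF.
apply/andP; split; last first.
  rewrite -(ler_pM2l q0) qr CE; move: rtw; rewrite /w qE'; lra.
(* With this constant, positivity of [w - K * y ^+ 2] and [w <= kk] force [kk * y <= 1 / 2], hence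
   [w >= 1 / 2]; then [K / 2 >= q] suffices. *)
pose K := 4 * kk ^+ 3.
have K0 : 0 < K by rewrite mulr_gt0 ?exprn_gt0 //; lra.
have low : w - K * y ^+ 2 <= rt.
  case: (lerP (w - K * y ^+ 2) 0) => [|wK]; first by lra.
  rewrite -ler_sqr ?nnegrE ?(ltW wK) // rtE -subr_ge0.
  have -> : D - (w - K * y ^+ 2) ^+ 2 = y ^+ 2 * (K * (w + (w - K * y ^+ 2)) - q).
    have -> : D = w ^+ 2 - q * y ^+ 2 by lra.
    by ring.
  apply: mulr_ge0; first exact: sqr_ge0.
  have ky0 : 0 <= kk * y by rewrite mulr_ge0.
  have wk : w <= kk by rewrite /w; lra.
  have ky : kk * y <= 1 / 2.
    rewrite -ler_sqr ?nnegrE ?mulr_ge0 //; try lra.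
    have : K * y ^+ 2 <= kk by lra.
    have -> : K * y ^+ 2 = kk * (4 * (kk * y) ^+ 2) by rewrite /K; ring.
    rewrite ger_pMr; last by lra.
    by rewrite expr_div_n; lra.
  have w12 : 1 / 2 <= w by rewrite /w; lra.
  have : K * (1 / 2) <= K * (w + (w - K * y ^+ 2)) by rewrite ler_wpM2l ?(ltW K0) //; lra.
  have : q <= K * (1 / 2).
    rewrite /K qE'; have : 4 * kk <= kk ^+ 3.
      by rewrite exprS [kk * _]mulrC ler_wpM2r // expr2; nra.
    by lra.
  by lra.
rewrite -(ler_pM2l q0) qr CE.
have : K * y ^+ 2 <= q * (K * y ^+ 2).
  rewrite ler_peMl ?mulr_ge0 ?sqr_ge0 ?(ltW K0) //; have := q_ge3; lra.
move: low; rewrite /w /K qE'; lra.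
Qed.

(** The first term serves C >= sqrt q: 8 from [ler_expRN2], the parenthesis from the tangent and
    exponential errors, and expR 2 from one missing power of exp (- y), where y <= 2. The second
    term serves C < sqrt q, where the heat kernel is itself small. *)
Definition heat_const : R :=
  8 * (4 * kk ^+ 3 + 1) * expR 2 + 2 / (kap * (kk - sq)).

Lemma heat_const_gt0 : 0 < heat_const.
Proof.
have k2 := kk_ge2; have kp := kap_gt0; have sk := sq_lt_k.
have k3 : 0 < kk ^+ 3 by apply: exprn_gt0; lra.
apply: addr_gt0; first by rewrite !mulr_gt0 ?expR_gt0 //; lra.
by rewrite divr_gt0 // mulr_gt0 //; lra.
Qed.

(** For C >= sqrt q, [u n C = r ^+ n + l ^+ n] with r l = 1 / q: the smaller root gives the last
    term, and r differs from exp (- y) by O(y^2) without exceeding it, so the powers differ by O((n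
    y)^2 exp (- n y) / n). For smaller C both quantities are bounded separately. *)
Lemma cheb_norm_heat n C (y := kap * (kk - C)) : (0 < n)%N -> 0 <= C <= kk ->
  `|u n C - expR (- (n%:R * y))| <=
  heat_const / n%:R * expR (- (n%:R * y / 2)) + 2 * sq^-1 ^+ n.
Proof.
move=> n0 /andP[C0 Ck]; have k2 := kk_ge2; have q0 := q_gt0.
have kp0 := kap_gt0; have s0 := sq_gt0; have sk := sq_lt_k.
have nR : 0 < n%:R :> R by rewrite ltr0n.
have y0 : 0 <= y by rewrite /y mulr_ge0 //; lra.
have k3 : 0 < kk ^+ 3 by apply: exprn_gt0; lra.
case: (ltrP C sq) => Cs.
  apply: le_trans (ler_normB _ _) _; rewrite addrC; apply: lerD; last first.
    by apply: cheb_norm_small; rewrite ger0_norm // ltW.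
  rewrite ger0_norm ?expR_ge0 //.
  have y1 : 0 < kap * (kk - sq) by rewrite mulr_gt0 //; lra.
  have yy1 : kap * (kk - sq) <= y by rewrite /y ler_pM2l //; lra.
  apply: le_trans (ler_expRN_half _) _; first by rewrite mulr_gt0 //; lra.
  rewrite ler_wpM2r ?expR_ge0 // invfM mulrA [_ / n%:R]mulrC -mulrA [_ / n%:R]mulrC ler_pM2l ?invr_gt0 //.
  apply: (@le_trans _ _ (2 / (kap * (kk - sq)))).
    by rewrite ler_pM2l // lef_pV2 ?posrE //; lra.
  by rewrite /heat_const lerDr !mulr_ge0 ?expR_ge0 //; lra.
have := top_root_bounds (C := C); rewrite Cs Ck => /(_ isT).
rewrite -/y; set D := C ^+ 2 - q; set r := (C + _) / q => /andP[r_lo r_hi].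
have D0 : 0 <= D by have := sqE; rewrite /D; nra.
have rt0 := sqrtr_ge0 D; have rtE := sqr_sqrtr D0.
have rtC : Num.sqrt D <= C.
  by rewrite -ler_sqr ?nnegrE // rtE /D; lra.
pose l := (C - Num.sqrt D) / q.
have r0 : 0 <= r by apply: divr_ge0; [apply: addr_ge0|apply: ltW].
have l0 : 0 <= l by apply: divr_ge0; [rewrite subr_ge0|apply: ltW].
have prodE : (C + Num.sqrt D) * (C - Num.sqrt D) = q.
  by rewrite mulrC -subr_sqr rtE /D; ring.
have uE : u n C = r ^+ n + l ^+ n.
  rewrite /u (@cheb_roots _ _ _ (C + Num.sqrt D) (C - Num.sqrt D)).
  - by rewrite mulrDl /r /l !expr_div_n.
  - by ring.
  - exact: prodE.
have rl : r * l = q^-1.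
  by rewrite /r /l mulrACA prodE; field; apply: lt0r_neq0.
have lr : l <= r by rewrite /l /r ler_pM2r ?invr_gt0 //; lra.
have ls : l <= sq^-1.
  rewrite -ler_sqr ?nnegrE ?invr_ge0 ?(ltW s0) // exprVn sqE -rl expr2.
  by rewrite ler_wpM2r.
have lln : l ^+ n <= sq^-1 ^+ n by rewrite lerXn2r ?nnegrE ?invr_ge0 ?(ltW s0).
have sn0 : 0 <= sq^-1 ^+ n by rewrite exprn_ge0 // invr_ge0 ltW.
rewrite uE addrAC; apply: le_trans (ler_normD _ _) _; apply: lerD; last first.
  by rewrite ger0_norm ?exprn_ge0 //; lra.
have e_lo := expR_ge1Dx (- y); have e_hi := expRN_ub y0; have e0 := expR_ge0 (- y).
have rE : 0 <= r <= expR (- y) by rewrite r0 /=; lra.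
have eE : 0 <= expR (- y) <= expR (- y) by rewrite e0 lexx.
case: n n0 nR {uE lln sn0} => // n _ nR.
rewrite expRM_nat.
apply: le_trans (distX_le n rE eE) _.
have dist : `|r - expR (- y)| <= (4 * kk ^+ 3 + 1) * y ^+ 2.
  by rewrite ler_norml; apply/andP; split; nra.
apply: (@le_trans _ _ (n.+1%:R * expR (- y) ^+ n * ((4 * kk ^+ 3 + 1) * y ^+ 2))).
  by rewrite ler_wpM2l // mulr_ge0 // exprn_ge0.
have eyn : expR (- y) ^+ n = expR (- (n.+1%:R * y)) * expR y.
  by rewrite -expRM_nat -expRD -natr1; congr expR; ring.
have y2 : y <= 2.
  have := kapk; have := kap_le1; have : 0 <= kap * C by rewrite mulr_ge0 // ltW.
  by rewrite /y; lra.
have v0 : 0 <= n.+1%:R * y by rewrite mulr_ge0.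
have := ler_expRN2 v0; set v := n.+1%:R * y => H.
set E := expR (- (v / 2)) in H *.
have -> : n.+1%:R * expR (- y) ^+ n * ((4 * kk ^+ 3 + 1) * y ^+ 2) =
   (4 * kk ^+ 3 + 1) * expR y / n.+1%:R * (v ^+ 2 * expR (- v)).
  by rewrite eyn /v; field; rewrite gt_eqF.
have c0 : 0 <= (4 * kk ^+ 3 + 1) * expR y / n.+1%:R.
  by rewrite !mulr_ge0 ?expR_ge0 ?invr_ge0 //; lra.
apply: (le_trans (ler_wpM2l c0 H)).
have -> : (4 * kk ^+ 3 + 1) * expR y / n.+1%:R * (8 * E) =
  (8 * (4 * kk ^+ 3 + 1) * expR y) / n.+1%:R * E by ring.
rewrite ler_wpM2r ?expR_ge0 // ler_wpM2r ?invr_ge0 //.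
rewrite /heat_const; apply: (@le_trans _ _ (8 * (4 * kk ^+ 3 + 1) * expR 2)).
  by rewrite ler_wpM2l ?ler_expR // mulr_ge0 //; lra.
by rewrite lerDl divr_ge0 // mulr_ge0 ?(ltW kp0) //; lra.
Qed.

End ChebyshevHeat.

Lemma sumr_sqr_le (R : realDomainType) (I : finType) (f : I -> R) :
  (forall i, 0 <= f i) -> \sum_i f i ^+ 2 <= (\sum_i f i) ^+ 2.
Proof.
move=> f0; suff [] : 0 <= \sum_i f i /\ \sum_i f i ^+ 2 <= (\sum_i f i) ^+ 2 by [].
elim/big_rec2: _ => [|i a b _ [b0 ab]]; first by rewrite expr0n.
split; first by rewrite addr_ge0.
have : 0 <= f i * b by rewrite mulr_ge0.
by nra.
Qed.

(** * Two consecutive lengths against the lazy walk *)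

Section LazyWalk.
Variables (R : realType) (k : nat).
Hypothesis k_ge2 : (2 <= k)%N.
Local Notation kk := (k%:R : R).
Local Notation kap := (kap R k).
Local Notation u := (@cheb_norm R k).

Lemma kkE : kk = \sum_(j < k) 1.
Proof. by rewrite sumr_const card_ord. Qed.

(** Factor by factor, 1 - (1 - t) / 2 is compared with exp (- (1 - t) / 2). The exponent N s / 2
    obtained here must agree with n kap s, which is why N is the integer part of 2 n kap later
    on. *)
Lemma prod_lazy_heat N (t : 'I_k -> R) (s := kk - \sum_j t j) :
  (0 < N)%N -> (forall j, -1 <= t j <= 1) ->
  [/\ 0 <= \prod_j ((1 + t j) / 2) ^+ N, 
      \prod_j ((1 + t j) / 2) ^+ N <= expR (- (N%:R * s / 2)) &
  `|\prod_j ((1 + t j) / 2) ^+ N - expR (- (N%:R * s / 2))| <=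
  8 * expR kk / N%:R * expR (- (N%:R * s / 4))].
Proof.
move=> N0 t1.
have sE : s = \sum_j (1 - t j) by rewrite sumrB sumr_const card_ord.
have s0 : 0 <= s by rewrite sE sumr_ge0 // => j _; have := t1 j; lra.
have sk : s <= 2 * kk.
  rewrite sE kkE mulr_sumr; apply: ler_sum => j _.
  by have := t1 j; lra.
pose f j := (1 + t j) / 2; pose g j := expR (- ((1 - t j) / 2)).
have f01 j : 0 <= f j <= 1 by rewrite /f; have := t1 j; lra.
have g01 j : 0 <= g j <= 1.
  by rewrite expR_ge0 expR_le1; have := t1 j; lra.
have fg j : f j <= g j.
  by rewrite /f; have := expR_ge1Dx (- ((1 - t j) / 2)); rewrite -/(g j); lra.
have gE : \prod_j g j = expR (- (s / 2)).
  by rewrite -expR_sum sumrN -mulr_suml sE.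
have PQ : \prod_j f j <= expR (- (s / 2)).
  by rewrite -gE; apply: ler_prod => j _; rewrite fg; case/andP: (f01 j) => ->.
have P0 : 0 <= \prod_j f j by rewrite prodr_ge0 // => j _; case/andP: (f01 j).
have NE : expR (- (N%:R * s / 2)) = expR (- (s / 2)) ^+ N.
  by rewrite -mulrA expRM_nat.
rewrite prodrXl -/f NE; split.
- exact: exprn_ge0.
- by rewrite lerXn2r ?nnegrE ?expR_ge0.
have dist : `|\prod_j f j - expR (- (s / 2))| <= (s / 2) ^+ 2.
  rewrite -gE; apply: le_trans (prod_dist_le f01 g01) _.
  apply: (@le_trans _ _ (\sum_j ((1 - t j) / 2) ^+ 2)).
    apply: ler_sum => j _; have -> : f j = 1 - (1 - t j) / 2 by rewrite /f; lra.
    by apply: expRN_dist; have := t1 j; lra.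
  rewrite sE mulr_suml; apply: sumr_sqr_le => j.
  by have := t1 j; lra.
case: N N0 {NE} => // N _.
have PI : 0 <= \prod_j f j <= expR (- (s / 2)) by rewrite P0.
have EI : 0 <= expR (- (s / 2)) <= expR (- (s / 2)) by rewrite expR_ge0 lexx.
apply: le_trans (distX_le N PI EI) _.
apply: (@le_trans _ _ (N.+1%:R * expR (- (s / 2)) ^+ N * (s / 2) ^+ 2)).
  by rewrite ler_wpM2l // mulr_ge0 // exprn_ge0 // expR_ge0.
have N0 : 0 < N.+1%:R :> R by [].
have v0 : 0 <= N.+1%:R * (s / 2) by rewrite mulr_ge0 //; lra.
have eyn : expR (- (s / 2)) ^+ N = expR (- (N.+1%:R * (s / 2))) * expR (s / 2).
  by rewrite -expRM_nat -expRD -natr1; congr expR; ring.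
have := ler_expRN2 v0; set v := N.+1%:R * (s / 2) => H.
have -> : N.+1%:R * s / 4 = v / 2 by rewrite /v; lra.
set E := expR (- (v / 2)) in H *.
have -> : N.+1%:R * expR (- (s / 2)) ^+ N * (s / 2) ^+ 2 =
   expR (s / 2) / N.+1%:R * (v ^+ 2 * expR (- v)).
  by rewrite eyn /v; field; rewrite gt_eqF.
have c0 : 0 <= expR (s / 2) / N.+1%:R by rewrite mulr_ge0 ?expR_ge0 ?invr_ge0.
apply: (le_trans (ler_wpM2l c0 H)).
have -> : expR (s / 2) / N.+1%:R * (8 * E) = 8 * expR (s / 2) / N.+1%:R * E by ring.
rewrite ler_wpM2r ?expR_ge0 // ler_wpM2r ?invr_ge0 // ler_pM2l // ler_expR; lra.
Qed.

Definition gap_const : R := heat_const R k + 10 + (8 * expR kk + 2) / kap.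

Lemma gap_const_gt0 : 0 < gap_const.
Proof.
have := heat_const_gt0 R k_ge2; have := kap_gt0 R k_ge2; have := expR_gt0 kk.
move=> h1 h2 h3; have : 0 < (8 * expR kk + 2) / kap by rewrite divr_gt0 //; lra.
by rewrite /gap_const; lra.
Qed.

Lemma expRN_distD x y : 0 <= x -> 0 <= y ->
  `|expR (- x) - expR (- (x + y))| <= y * expR (- x) :> R.
Proof.
move=> x0 y0; rewrite opprD expRD; have := expR_ge1Dx (- y).
have e1 : expR (- y) <= 1 by rewrite expR_le1; lra.
have e0 := expR_ge0 (- x) => H.
by rewrite -{1}[expR (- x)]mulr1 -mulrBr normrM !ger0_norm ?expR_ge0 //;
   [rewrite mulrC ler_wpM2r //; lra|lra].
Qed.

(** All errors are brought to one exponential: y <= 2 weakens the exp (- n / 4) of [sqV_expR] to exp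
    (- n y / 8). Replacing time n + 1 by time n costs y exp (- n y), again O(1/n). *)
Lemma cheb_norm_heat8 n C (y := kap * (kk - C)) : (0 < n)%N -> 0 <= C <= kk ->
  `|u n C - expR (- (n%:R * y))| <=
     (heat_const R k + 10) / n%:R * expR (- (n%:R * y / 8)) /\
  `|u n.+1 C - expR (- (n%:R * y))| <=
     (heat_const R k + 10) / n%:R * expR (- (n%:R * y / 8)).
Proof.
move=> n0 C01; have k2 := kk_ge2 R k_ge2; have kp := kap_gt0 R k_ge2.
have y0 : 0 <= y by rewrite /y mulr_ge0 //; lra.
have y2 : y <= 2.
  have := kapk R k_ge2; have := kap_le1 R k_ge2.
  have : 0 <= kap * C by rewrite mulr_ge0 //; lra.
  by rewrite /y; lra.
have h0 := heat_const_gt0 R k_ge2.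
have main m : (0 < m)%N -> `|u m C - expR (- (m%:R * y))| <=
     (heat_const R k + 8) / m%:R * expR (- (m%:R * y / 8)).
  move=> m0; apply: le_trans (cheb_norm_heat k_ge2 m0 C01) _.
  have mR : 0 < m%:R :> R by rewrite ltr0n.
  have my : 0 <= m%:R * y by rewrite mulr_ge0 // ltW.
  have my2 : m%:R * y <= m%:R * 2 by rewrite ler_pM2l.
  rewrite -/y (_ : (_ + 8) / _ * _ = heat_const R k / m%:R * expR (- (m%:R * y / 8)) +
    8 / m%:R * expR (- (m%:R * y / 8))); last by ring.
  apply: lerD.
    rewrite ler_wpM2l ?divr_ge0 ?(ltW h0) ?(ltW mR) // ler_expR -/y; lra.
  have := sqV_expR R k_ge2 m0.
  have : 4 / m%:R * expR (- (m%:R / 4)) <= 4 / m%:R * expR (- (m%:R * y / 8)).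
    by rewrite ler_wpM2l ?divr_ge0 // ler_expR; lra.
  lra.
have nR : 0 < n%:R :> R by rewrite ltr0n.
have ny : 0 <= n%:R * y by rewrite mulr_ge0 // ltW.
have E0 := expR_ge0 (- (n%:R * y / 8)).
have i0 : 0 < n%:R^-1 :> R by rewrite invr_gt0.
split.
  apply: le_trans (main n n0) _.
  by rewrite ler_wpM2r // ler_wpM2r ?(ltW i0) //; lra.
have H1 := main n.+1 isT.
have H2 := expRN_distD ny y0.
have H3 : y * expR (- (n%:R * y)) <= 2 / n%:R * expR (- (n%:R * y / 8)).
  have H := ler_expRN1 ny; rewrite [leRHS]mulrAC ler_pdivlMr //.
  have -> : y * expR (- (n%:R * y)) * n%:R = n%:R * y * expR (- (n%:R * y)) by ring.
  by apply: le_trans H _; rewrite ler_wpM2l // ler_expR; lra.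
have H4 : (heat_const R k + 8) / n.+1%:R * expR (- (n.+1%:R * y / 8)) <=
   (heat_const R k + 8) / n%:R * expR (- (n%:R * y / 8)).
  apply: ler_pM; rewrite ?expR_ge0 ?divr_ge0 //; first by lra.
    by rewrite ler_wpM2l ?lef_pV2 ?posrE ?ler_nat //; lra.
  by rewrite ler_expR -natr1; lra.
have nE : n%:R * y + y = n.+1%:R * y by rewrite -natr1; ring.
rewrite nE in H2.
have -> : u n.+1 C - expR (- (n%:R * y)) =
  (u n.+1 C - expR (- (n.+1%:R * y))) - (expR (- (n%:R * y)) - expR (- (n.+1%:R * y))) by ring.
apply: le_trans (ler_normB _ _) _.
rewrite (_ : heat_const R k + 10 = heat_const R k + 8 + 2); last by lra.
set E := expR (- (n%:R * y / 8)) in H3 H4 *.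
have -> : (heat_const R k + 8 + 2) / n%:R * E = (heat_const R k + 8) / n%:R * E + 2 / n%:R * E.
  by ring.
by apply: lerD; [apply: le_trans H1 H4|apply: le_trans H2 H3].
Qed.

Lemma cheb_normN n C : u n (- C) = (-1) ^+ n * u n C.
Proof. by rewrite /cheb_norm mulrN cheb_oppr mulrA. Qed.

(* The term [kk + C] is needed near [C = - kk], where [u n C] and [u n.+1 C] are
   not small but nearly opposite: this is why two consecutive lengths have to be
   averaged. *)
Lemma lazy_gap n N (t : 'I_k -> R) (C := \sum_j t j) :
  (k <= n)%N -> N%:R <= 2 * n%:R * kap < N%:R + 1 ->
  (forall j, -1 <= t j <= 1) ->
  `|2^-1 * (u n C + u n.+1 C) - \prod_j ((1 + t j) / 2) ^+ N| <=
  gap_const / n%:R *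
    (expR (- (n%:R * kap / 8 * (kk - C))) + expR (- (n%:R * kap / 8 * (kk + C)))).
Proof.
move=> kn /andP[Nle Nlt] t1; have k2 := kk_ge2 R k_ge2; have kp := kap_gt0 R k_ge2.
have kpE := kapE R k_ge2.
have n0 : (0 < n)%N by apply: leq_trans kn; apply: leq_trans k_ge2.
have nR : 0 < n%:R :> R by rewrite ltr0n.
have nk : kk <= n%:R by rewrite ler_nat.
have nkap1 : 1 <= n%:R * kap by nra.
have Nn : n%:R * kap <= N%:R by lra.
have NR : 0 < N%:R :> R by lra.
have N0 : (0 < N)%N by rewrite -(ltr0n R).
have Ck : C <= kk.
  by rewrite /C kkE; apply: ler_sum => j _; have := t1 j; lra.
have Ck' : - kk <= C.
  by rewrite /C kkE -sumrN; apply: ler_sum => j _; have := t1 j; lra.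
have [] := prod_lazy_heat N0 t1; rewrite -/C; set P := \prod_j _.
set s := kk - C; set v := N%:R * s / 2 => P0 Pv Pdist.
have s0 : 0 <= s by rewrite /s; lra.
have v0 : 0 <= v by rewrite /v divr_ge0 ?mulr_ge0 // ltW.
set A := expR (- (n%:R * kap / 8 * s)); set A' := expR (- (_ * (kk + C))).
have nks : 0 <= n%:R * kap * s by rewrite mulr_ge0 //; lra.
have nkNs : n%:R * kap * s <= N%:R * s by rewrite ler_wpM2r.
have A0 : 0 <= A := expR_ge0 _; have A'0 : 0 <= A' := expR_ge0 _.
have vA : expR (- (v / 2)) <= A by rewrite ler_expR /v; lra.
have NV : N%:R^-1 <= kap^-1 / n%:R :> R.
  by rewrite -invfM mulrC lef_pV2 ?posrE // mulr_gt0.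
have c2 : 2 / N%:R * A <= (2 / kap) / n%:R * A.
  by rewrite ler_wpM2r // -mulrA ler_pM2l.
have NVA : 2 / N%:R * expR (- (v / 2)) <= (2 / kap) / n%:R * A.
  by apply: le_trans c2; rewrite ler_wpM2l // divr_ge0 // ltW.
have nV0 : 0 < n%:R^-1 :> R by rewrite invr_gt0.
have e0 := expR_gt0 kk; have kV0 : 0 < kap^-1 by rewrite invr_gt0.
have h0 := heat_const_gt0 R k_ge2.
have gE : gap_const / n%:R * (A + A') =
  (heat_const R k + 10) / n%:R * A + (heat_const R k + 10) / n%:R * A' +
  (8 * expR kk / kap / n%:R) * A + (8 * expR kk / kap / n%:R) * A' +
  (2 / kap) / n%:R * A + (2 / kap) / n%:R * A'.
  by rewrite /gap_const; ring.
have g1 : 0 <= (heat_const R k + 10) / n%:R * A by rewrite !mulr_ge0 // ltW //; lra.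
have g1' : 0 <= (heat_const R k + 10) / n%:R * A' by rewrite !mulr_ge0 // ltW //; lra.
have g2 : 0 <= 8 * expR kk / kap / n%:R * A by rewrite !mulr_ge0 // ltW.
have g2' : 0 <= 8 * expR kk / kap / n%:R * A' by rewrite !mulr_ge0 // ltW.
have g3 : 0 <= 2 / kap / n%:R * A by rewrite !mulr_ge0 // ltW.
have g3' : 0 <= 2 / kap / n%:R * A' by rewrite !mulr_ge0 // ltW.
rewrite {}gE; case: (lerP 0 C) => C0.
  have C01 : 0 <= C <= kk by rewrite C0.
  have [] := cheb_norm_heat8 n0 C01; rewrite -/s.
  have -> : n%:R * (kap * s) / 8 = n%:R * kap / 8 * s by ring.
  rewrite -/A; set e := expR _ => H1 H2.
  have Pd : `|P - expR (- v)| <= 8 * expR kk / kap / n%:R * A.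
    apply: le_trans Pdist _.
    have -> : N%:R * s / 4 = v / 2 by rewrite /v; lra.
    rewrite ler_pM ?expR_ge0 ?divr_ge0 ?mulr_ge0 ?(ltW e0) ?(ltW NR) //.
    by rewrite -[in leRHS]mulrA ler_pM2l // mulr_gt0.
  (* Rounding 2 n kap down to N moves the exponent by at most s / 2, which is v / N. *)
  have ve : `|expR (- v) - e| <= 2 / kap / n%:R * A.
    have xy : n%:R * (kap * s) = v + (n%:R * (kap * s) - v) by ring.
    have d0 : 0 <= n%:R * (kap * s) - v.
      have : N%:R * s <= 2 * n%:R * kap * s by rewrite ler_wpM2r.
      by rewrite /v; lra.
    rewrite /e xy; apply: le_trans (expRN_distD v0 d0) _.
    have d1 : n%:R * (kap * s) - v <= s / 2.
      have : 2 * n%:R * kap * s <= (N%:R + 1) * s by rewrite ler_wpM2r // ltW.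
      by rewrite /v; lra.
    apply: (@le_trans _ _ (s / 2 * expR (- v))); first by rewrite ler_wpM2r ?expR_ge0.
    have -> : s / 2 * expR (- v) = N%:R^-1 * (v * expR (- v)).
      by rewrite /v; field; rewrite gt_eqF.
    apply: le_trans NVA.
    have -> : 2 / N%:R * expR (- (v / 2)) = N%:R^-1 * (2 * expR (- (v / 2))) by ring.
    apply: ler_wpM2l; first by rewrite invr_ge0 ltW.
    exact: ler_expRN1.
  have -> : 2^-1 * (u n C + u n.+1 C) - P = 2^-1 * (u n C - e) + 2^-1 * (u n.+1 C - e)
    - (P - expR (- v)) - (expR (- v) - e) by field.
  have B3 := ler_normD (2^-1 * (u n C - e)) (2^-1 * (u n.+1 C - e)).
  have B2 := ler_normB (2^-1 * (u n C - e) + 2^-1 * (u n.+1 C - e)) (P - expR (- v)).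
  apply: le_trans (ler_normB _ _) _.
  rewrite !(normrM 2^-1) (@ger0_norm _ 2^-1) // in B3.
  lra.
have C01 : 0 <= - C <= kk by apply/andP; split; lra.
have [] := cheb_norm_heat8 n0 C01; rewrite opprK.
have -> : n%:R * (kap * (kk + C)) / 8 = n%:R * kap / 8 * (kk + C) by ring.
rewrite -/A'; set e := expR _ => H1 H2.
(* For C < 0 one has s >= kk >= 2, hence v >= N, and the lazy product is negligible. *)
have PA : P <= 2 / kap / n%:R * A.
  apply: le_trans Pv _; rewrite -/v.
  have vN : N%:R <= v.
    have : N%:R * 2 <= N%:R * s by rewrite ler_pM2l // /s; lra.
    by rewrite /v; lra.
  apply: le_trans (ler_expRN_half _) _; first by lra.
  apply: le_trans NVA; rewrite ler_wpM2r ?expR_ge0 // ler_pM2l //.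
  by rewrite lef_pV2 ?posrE //; lra.
have uE : u n C + u n.+1 C = (-1) ^+ n * (u n (- C) - u n.+1 (- C)).
  by rewrite -[C in LHS]opprK !cheb_normN exprS; ring.
rewrite uE; apply: le_trans (ler_normB _ _) _.
rewrite !normrM normrX normrN1 expr1n mul1r (ger0_norm P0) ger0_norm //.
have -> : u n (- C) - u n.+1 (- C) = (u n (- C) - e) - (u n.+1 (- C) - e) by ring.
have := ler_normB (u n (- C) - e) (u n.+1 (- C) - e); lra.
Qed.

End LazyWalk.

(** * Conjugacy classes of the free group as necklaces *)

Section Conjugacy.
Variable k : nat.
Implicit Types (a b : letter k) (s t u v w c : seq (letter k)).
Implicit Types (g h : free_group k).

Lemma cyc_reduced_reduced w : cyc_reduced w -> reduced w.
Proof. by case: w => [|a w] //; rewrite /cyc_reduced /= rcons_path => /andP[]. Qed.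

Lemma mul_word_cat_reduced u v : reduced (u ++ v) -> mul_word u v = u ++ v.
Proof.
move=> ruv; have rv : reduced v by move: ruv => /cat_sorted2[].
by rewrite -[RHS]mul_wordw0 // mul_word_cat mul_wordw0.
Qed.

Lemma mul_word_rcons u a b : reduced (rcons u b) ->
  mul_word (rcons u b) [:: a] =
  if a == letter_inv b then u else rcons (rcons u b) a.
Proof.
move=> rub; rewrite -{1}cats1 mul_word_cat /=.
case: ifPn => ab.
  by rewrite mul_wordw0 //; move: rub; rewrite -cats1 => /cat_sorted2[].
rewrite mul_word_cat_reduced; first by rewrite -!cats1 -catA.
rewrite -[_ ++ _]/(u ++ ([:: b] ++ [:: a])) catA cats1 cats1 /reduced.
case: u rub => [|x u] rub; first by rewrite /= ab.
by rewrite /= rcons_path last_rcons ab andbT.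
Qed.

Lemma word_letter_val a : word (letter_val a) = [:: a].
Proof. by case: a => i []. Qed.

Lemma word_letter_valV a : word ((letter_val a)^-1)%g = [:: letter_inv a].
Proof. by rewrite [LHS]/(inv_word (word (letter_val a))) word_letter_val. Qed.

Lemma word_conj_letter g a :
  word (g ^ letter_val a)%g = cons_red (letter_inv a) (mul_word (word g) [:: a]).
Proof.
rewrite conjgE [LHS]/(mul_word _ (mul_word _ _)) word_letter_valV.
by rewrite word_letter_val.
Qed.

Lemma inv_word_cons a u : inv_word (a :: u) = rcons (inv_word u) (letter_inv a).
Proof. by rewrite /inv_word /= rev_cons. Qed.

Lemma conj_letter_end g a u :
  word g = a :: rcons u (letter_inv a) -> word (g ^ letter_val a)%g = u.
Proof.
move=> gE; rewrite word_conj_letter gE -rcons_cons mul_word_rcons.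
  by rewrite letter_invK eqxx /= letter_invK eqxx.
by rewrite rcons_cons -gE reduced_word.
Qed.

Lemma conj_letter_grow g a b u l : word g = b :: u -> word g = rcons l.2 l.1 ->
  b != a -> a != letter_inv l.1 ->
  word (g ^ letter_val a)%g = letter_inv a :: rcons (word g) a.
Proof.
move=> gb gl ba al; rewrite word_conj_letter gl mul_word_rcons -?gl ?reduced_word //.
by rewrite (negbTE al) gb /= letter_invK (negbTE ba).
Qed.

Definition rotation s t := exists i, t = rot i s.

Lemma rotation_refl s : rotation s s.
Proof. by exists 0%N; rewrite rot0. Qed.

Lemma rotation_bound s t : (0 < size s)%N -> rotation s t ->
  exists2 i, (i < size s)%N & t = rot i s.
Proof.
move=> s0 [i ->]; case: (ltnP i (size s)) => [ltis|/rot_oversize ->]; first by exists i.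
by exists 0%N; rewrite ?rot0.
Qed.

Lemma rotation_trans s t u : rotation s t -> rotation t u -> rotation s u.
Proof.
move=> [i ->] [j ->].
case: (ltnP i (size s)) => [ltis|/rot_oversize ->]; last by exists j.
case: (ltnP j (size s)) => [ltjs|js]; last by exists i; rewrite rot_oversize ?size_rot.
by rewrite rot_add_mod ?(ltnW ltis) ?(ltnW ltjs) //; eexists.
Qed.

Lemma rotation_sym s t : rotation s t -> rotation t s.
Proof. by move=> [i ->]; exists (size s - i)%N; rewrite -{1}[s](rotK i) /rotr size_rot. Qed.

Lemma rotation_size s t : rotation s t -> size t = size s.
Proof. by case=> i ->; rewrite size_rot. Qed.

Lemma rotation_cyc_reduced s t : rotation s t -> cyc_reduced t = cyc_reduced s.
Proof. by case=> i ->; apply: rot_cycle. Qed.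

(* Every reduced word is [u c u^-1] with [c] cyclically reduced; conjugating by
   a letter changes [u], or rotates [c] when [u] is empty. *)
Definition has_core g c :=
  cyc_reduced c /\ exists u, word g = u ++ c ++ inv_word u.

Lemma has_core_conj_letter g c a : has_core g c ->
  exists2 c', rotation c c' & has_core (g ^ letter_val a)%g c'.
Proof.
move=> [cc [[|b u] gE]]; last first.
  have {}gE : word g = b :: rcons (u ++ c ++ inv_word u) (letter_inv b).
    by rewrite gE inv_word_cons -!rcons_cat.
  exists c; first exact: rotation_refl.
  split=> //; case: (eqVneq b a) => [ba|ba].
    by exists u; apply: conj_letter_end; rewrite gE ba.
  exists [:: letter_inv a, b & u]; rewrite (conj_letter_grow gE (l := (letter_inv b, b :: u ++ c ++ inv_word u))) //=.
  - by rewrite gE !inv_word_cons letter_invK -!rcons_cat.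
  - by rewrite letter_invK eq_sym.
rewrite /= cats0 in gE.
case: c => [|x p] in cc gE *.
  exists [::]; first exact: rotation_refl.
  split=> //; exists [::]; rewrite word_conj_letter gE /=.
  by rewrite letter_invK eqxx.
have [c [l cE]] : exists c l, x :: p = rcons c l.
  by exists (belast x p), (last x p); rewrite -lastI.
rewrite cE in gE cc *.
have rg := reduced_word g; rewrite gE in rg.
case: (eqVneq l (letter_inv a)) => la.
  have rotE : rotation (rcons c l) (l :: c).
    by apply: rotation_sym; exists 1%N; rewrite rot1_cons.
  have cc' : cyc_reduced (l :: c) by rewrite (rotation_cyc_reduced rotE).
  exists (l :: c) => //; split=> //; exists [::].
  rewrite word_conj_letter gE mul_word_rcons // la letter_invK eqxx cats0 -la.
  by rewrite cons_redE //; apply: cyc_reduced_reduced.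
have al : a != letter_inv l by rewrite eq_sym (inv_eq (@letter_invK k)).
case E : (rcons c l) => [|y r]; first by case: (c) E.
case: (eqVneq y a) => [ya|ya].
  exists (rcons r y); first by exists 1%N; rewrite rot1_cons.
  split; first by rewrite -rot1_cons -E /cyc_reduced rot_cycle.
  exists [::]; rewrite word_conj_letter gE mul_word_rcons // (negbTE al) E.
  by rewrite rcons_cons /= ya letter_invK eqxx cats0.
exists (rcons c l); first by rewrite -E; apply: rotation_refl.
split=> //; exists [:: letter_inv a].
rewrite (conj_letter_grow (b := y) (u := r) (l := (l, c))) ?gE //.
by rewrite inv_word_cons letter_invK /= cats1.
Qed.

Lemma has_core_conj g h c : has_core g c ->
  exists2 c', rotation c c' & has_core (g ^ h)%g c'.
Proof.
rewrite (word_lengthP h); elim: (word h) g c => [|a s IH] g c gc.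
  by exists c; [apply: rotation_refl|rewrite big_nil conjg1].
have [c1 cc1 gc1] := has_core_conj_letter a gc.
have [c2 cc2 gc2] := IH _ _ gc1.
exists c2; first exact: rotation_trans cc2.
by rewrite big_cons conjgM.
Qed.

Lemma has_core_cyc_reduced g : cyc_reduced (word g) -> has_core g (word g).
Proof. by move=> gc; split=> //; exists [::]; rewrite cats0. Qed.

(** A nonempty outer part would make the first and last letters of [word g] mutually inverse. *)
Lemma core_of_cyc_reduced g c : cyc_reduced (word g) -> has_core g c -> c = word g.
Proof.
move=> gc [_ [[|b u] gE]]; first by rewrite gE cats0.
move: gc; rewrite gE inv_word_cons -!rcons_cat rcons_cons /cyc_reduced /=.
by rewrite rcons_path last_rcons /compatible letter_invK eqxx andbF.
Qed.

Lemma conj_classJ g h : conj_class (g ^ h)%g = conj_class g.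
Proof.
apply/seteqP; split=> _ [y _ <-].
  by exists (h * y)%g => //; rewrite conjgM.
by exists (h^-1 * y)%g => //; rewrite -conjgM mulgA mulgV mul1g.
Qed.

Lemma conj_class_id g : conj_class g g.
Proof. by exists 1%g => //; rewrite conjg1. Qed.

(** Conjugation moves the core only by rotations, and a cyclically reduced word is its own core.
    Conversely, a rotation is conjugation by the prefix that it moves to the end. *)
Lemma conj_class_cyc_reduced g h :
  cyc_reduced (word g) -> cyc_reduced (word h) ->
  conj_class g = conj_class h <-> rotation (word g) (word h).
Proof.
move=> gc hc; split=> [gh|[i hE]].
  have [x _ xE] : conj_class g h by rewrite gh; apply: conj_class_id.
  have [c' rc] := has_core_conj x (has_core_cyc_reduced gc).
  by rewrite xE => /(core_of_cyc_reduced hc) <-.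
rewrite -(conj_classJ g (\prod_(a <- take i (word g)) letter_val a)%g).
congr conj_class; rewrite {1}(word_lengthP g) (word_lengthP h) hE /rot.
rewrite -{1}(cat_take_drop i (word g)) !big_cat /=.
by rewrite conjgE -!mulgA mulKg.
Qed.

(** A shortest element works: if its last letter were inverse to its first, conjugating by the first
    letter would remove both. *)
Lemma cyc_reduced_rep g : exists2 h, conj_class h = conj_class g &
  cyc_reduced (word h) /\ word_length h = class_length (conj_class g).
Proof.
have [[h [x _ gh] hE] hmin] := class_lengthP g.
have ghC : conj_class h = conj_class g by rewrite -gh conj_classJ.
exists h => //; split=> //; apply/negPn/negP => hN.
have rh := reduced_word h.
case E : (word h) => [|b p]; first by rewrite E in hN.
rewrite E in hN rh; rewrite /cyc_reduced /= rcons_path in hN.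
have /negPn/eqP bE : ~~ (b != letter_inv (last b p)).
  by apply: contra hN => hN; rewrite -/(reduced (b :: p)) [path _ _ _]rh.
case/lastP: p => [|p l] in E rh hN bE.
  (* A one-letter word is excluded because no letter is its own inverse. *)
  by case: b bE {E rh hN} => i [] /eqP; rewrite /letter_inv xpair_eqE /= andbF.
rewrite last_rcons in bE.
have lE : l = letter_inv b by rewrite bE letter_invK.
rewrite lE in E; have := hmin (h ^ letter_val b)%g.
have mem : conj_class g (h ^ letter_val b)%g.
  by rewrite -ghC -(conj_classJ h (letter_val b)); apply: conj_class_id.
move=> /(_ mem); rewrite /word_length (conj_letter_end E).
by rewrite -hE /word_length E /= size_rcons ltnNge leqnSn.
Qed.

Lemma class_length_cyc_reduced g : cyc_reduced (word g) ->
  class_length (conj_class g) = word_length g.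
Proof.
move=> gc; have [h hg [hc hE]] := cyc_reduced_rep g.
have /rotation_size := (conj_class_cyc_reduced hc gc).1 hg.
by rewrite -hE /word_length => ->.
Qed.

Definition word_ab s : 'rV[int]_k :=
  \row_j ((count_mem (j, false) s)%:Z - (count_mem (j, true) s)%:Z).

Lemma Phi_word_ab g : Phi g = word_ab (word g). Proof. by []. Qed.

Lemma word_ab_rotation s t : rotation s t -> word_ab t = word_ab s.
Proof.
by case=> i ->; apply/rowP => j; rewrite !mxE !(permP (permEl (perm_rot i s))).
Qed.

End Conjugacy.

Lemma size_undup_map (T : eqType) (U V : eqType) (f : T -> U) (g : T -> V) s :
  {in s &, forall x y, f x = f y <-> g x = g y} ->
  size (undup (map f s)) = size (undup (map g s)).
Proof.
elim: s => //= x s IH fg.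
rewrite (_ : (f x \in _) = (g x \in map g s)).
  case: ifP => _ /=; rewrite IH // => y z ys zs; apply: fg;
    by rewrite inE ?ys ?zs orbT.
apply/mapP/mapP => -[y ys] /fg xy; exists y => //; apply: xy;
  by rewrite inE ?eqxx ?ys ?orbT.
Qed.

Lemma card_fset_set_seq (T : choiceType) (s : seq T) :
  #|` fset_set [set` s]| = size (undup s).
Proof.
rewrite (_ : fset_set _ = [fset x | x in s]%fset).
  by rewrite card_imfset //=.
apply/fsetP => x; rewrite in_fset_set; last exact: finite_seq.
by rewrite !inE /= mem_setE.
Qed.

(** The number of values depends only on the fibres. This transfers the count of classes, sets in an
    infinite group, to orbits in a finite type. *)
Lemma card_fset_set_image (T : finType) (U : choiceType) (V : finType)
    (f : T -> U) (g : T -> V) (S : {set T}) :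
  {in S &, forall x y, f x = f y <-> g x = g y} ->
  #|` fset_set (f @` [set` S])| = #|g @: S|.
Proof.
move=> fg; rewrite (_ : f @` [set` S] = [set` map f (enum S)]).
  rewrite card_fset_set_seq (@size_undup_map _ _ _ f g); last first.
    by move=> x y; rewrite !mem_enum; apply: fg.
  rewrite -(card_uniqP (undup_uniq _)); apply: eq_card => y.
  rewrite mem_undup; apply/mapP/imsetP => -[x xS ->]; exists x => //.
    by rewrite mem_enum in xS.
  by rewrite mem_enum.
apply/seteqP; split=> y /=.
  by case=> x xS <-; apply/mapP; exists x; rewrite ?mem_enum.
by case/mapP => x; rewrite mem_enum => xS ->; exists x.
Qed.

(** A word commuting with p is a prefix of p p p ..., so its length determines it; the induction
    strips one copy of p. It shows that a word fixed by a rotation is known from its first block. *)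
Lemma commuting_prefix_inj (T : eqType) (p x y : seq T) : p != [::] ->
  size x = size y -> x ++ p = p ++ x -> y ++ p = p ++ y -> x = y.
Proof.
move=> p0; move: {2}(size x) (leqnn (size x)) => m.
elim: m x y => [|m IH] x y xm xy xp yp.
  by move: xm xy; rewrite leqn0 size_eq0 => /eqP -> /esym/size0nil ->.
case: (leqP (size x) (size p)) => xlp.
  rewrite -[x](take_size_cat p erefl) xp -[y](take_size_cat p erefl) yp -xy.
  by rewrite !take_cat; case: ltngtP xlp => // ->; rewrite subnn !take0.
have split z : size z = size x -> z ++ p = p ++ z -> z = p ++ drop (size p) z.
  move=> zx zp; rewrite -{1}(cat_take_drop (size p) z); congr (_ ++ _).
  have := congr1 (take (size p)) zp.
  by rewrite take_cat zx xlp take_size_cat // => ->.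
rewrite (split x) // (split y) //; congr (_ ++ _).
have catIl (z1 z2 : seq T) : p ++ z1 = p ++ z2 -> z1 = z2.
  by move=> /(congr1 (drop (size p))); rewrite !drop_size_cat.
apply: IH.
- rewrite size_drop; move: xm p0; rewrite -size_eq0; lia.
- by rewrite !size_drop xy.
- by apply: catIl; rewrite -(split x) // catA -(split x).
- by apply: catIl; rewrite -(split y) // catA -(split y).
Qed.

(** * Counting necklaces through cyclically reduced words *)

Section Necklaces.
Variables (k : nat) (B : set 'rV[int]_k).

Definition cyc_words n : {set n.-tuple (letter k)} :=
  [set w : n.-tuple (letter k) | cyc_reduced w && `[< B (word_ab w) >]].

(** The index type is inhabited even for n = 0, so the empty word has an orbit, which is the class
    of 1. *)
Definition necklace n (w : n.-tuple (letter k)) : {set n.-tuple (letter k)} :=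
  [set t : n.-tuple (letter k) | [exists i : 'I_n.+1, tval t == rot i w]].

Lemma mem_necklace n (w t : n.-tuple (letter k)) :
  reflect (rotation w t) (t \in necklace w).
Proof.
rewrite inE; apply: (iffP existsP) => [[i /eqP tE]|[i tE]]; first by exists i.
case: (ltnP i n) => ltin; first by exists (inord i); rewrite inordK ?tE // ltnW.
by exists ord0; rewrite rot0 tE rot_oversize // size_tuple.
Qed.

Lemma necklace_eq n (w t : n.-tuple (letter k)) :
  necklace w = necklace t <-> rotation w t.
Proof.
split=> [E|wt].
  by apply/mem_necklace; rewrite E; apply/mem_necklace/rotation_refl.
apply/setP => s; apply/mem_necklace/mem_necklace => h.
  exact: rotation_trans (rotation_sym wt) h.
exact: rotation_trans wt h.
Qed.

Definition necklaces n := @necklace n @: cyc_words n.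

Definition classes_eq n : set (set (free_group k)) :=
  [set conj_class g | g in
    [set g | class_length (conj_class g) = n /\ B (Phi g)]].

(** The default value of [insubd] is never reached here: a cyclically reduced word is reduced. *)
Lemma classes_eqE n : classes_eq n =
  (fun w : n.-tuple (letter k) => conj_class (insubd (free_one k) (tval w)))
    @` [set` cyc_words n].
Proof.
apply/seteqP; split=> C /=.
  case=> g [gn gB] <-; have [h hg [hc hl]] := cyc_reduced_rep g.
  have hs : size (word h) == n by rewrite -/(word_length h) hl gn.
  exists (Tuple hs); last by rewrite -hg; congr conj_class; rewrite -[RHS](valKd (free_one k)).
  rewrite inE hc; apply/asboolP.
  have [x _ xh] : conj_class g h by rewrite -hg; apply: conj_class_id.
  by rewrite -[word_ab _]/(Phi h) -xh Phi_conj.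
case=> w; rewrite inE => /andP[wc /asboolP wB] <-.
set g := insubd _ _; have gE : word g = w.
  by rewrite -[LHS]/(val g) val_insubd cyc_reduced_reduced.
exists g => //; split; last by rewrite Phi_word_ab gE.
by rewrite class_length_cyc_reduced /word_length gE ?size_tuple.
Qed.

Lemma card_classes_eq n : #|` fset_set (classes_eq n)| = #|necklaces n|.
Proof.
rewrite classes_eqE; apply: card_fset_set_image => w t.
rewrite !inE => /andP[wc _] /andP[tc _]; rewrite necklace_eq.
have wE (u : n.-tuple (letter k)) :
    cyc_reduced u -> word (insubd (free_one k) (tval u)) = u.
  by move=> uc; rewrite -[LHS]/(val _) val_insubd cyc_reduced_reduced.
by rewrite conj_class_cyc_reduced !wE.
Qed.

Lemma PiE m : Pi B m = (\sum_(n < m.+1) #|necklaces n|)%N.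
Proof.
under eq_bigr do rewrite -card_classes_eq.
rewrite trivIset_sum_card.
- rewrite /Pi; congr (#|` fset_set _|); rewrite -bigcup_mkord.
  apply/seteqP; split=> C.
    by case=> g [gm gB] <-; exists (class_length (conj_class g)) => //; exists g.
  by case=> n /= nm [g [gn gB] <-]; exists g => //; split=> //; rewrite gn -ltnS.
- move=> n; apply: sub_finite_set (finite_classes_le B n) => C [g [gn gB] <-].
  by exists g => //; split=> //; rewrite gn.
- move=> i j _ _ [C [[g [<- _] <-] [h [<- _] ->]]] //.
Qed.

Lemma necklaces_lb n : (0 < n)%N -> (#|cyc_words n| <= n * #|necklaces n|)%N.
Proof.
move=> n0; rewrite -sum1_card (partition_big_imset (@necklace n)) /= mulnC.
rewrite -sum_nat_const; apply: leq_sum => y /imsetP[w wc ->].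
rewrite sum1dep_card.
apply: (@leq_trans #|[set rot_tuple i w | i : 'I_n]|); last first.
  by rewrite (leq_trans (leq_imset_card _ _)) // card_ord.
apply/subset_leq_card/fintype.subsetP => t; rewrite inE => /andP[_ /eqP].
move=> /necklace_eq/rotation_sym/rotation_bound.
rewrite size_tuple => /(_ n0)[i ltin tE].
by apply/imsetP; exists (Ordinal ltin) => //; apply: val_inj.
Qed.

Definition periodic_words n : {set n.-tuple (letter k)} :=
  [set w : n.-tuple (letter k) | [exists d : 'I_n, (0 < d)%N && (rot d w == w :> seq _)]].

(** An orbit without periodic words has n distinct rotations; any other orbit is charged n times to
    one of its periodic words. *)
Lemma necklaces_ub n :
  (n * #|necklaces n| <= #|cyc_words n| + n * #|periodic_words n|)%N.
Proof.
rewrite mulnC -sum_nat_const -sum1_card (partition_big_imset (@necklace n)) /=.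
pose per w := w \in periodic_words n.
apply: (@leq_trans (\sum_(y in necklaces n)
   (\sum_(w in cyc_words n | necklace w == y) 1 +
    n * \sum_(w in cyc_words n | necklace w == y) per w))).
  apply: leq_sum => y /imsetP[w wc ->].
  have [wp|wp] := boolP (w \in periodic_words n).
    rewrite [X in (_ <= _ + _ * X)%N](bigD1 w) ?wc ?eqxx //= /per wp.
    by rewrite mulnDr muln1 addnCA leq_addr.
  apply: leq_trans (leq_addr _ _); rewrite sum1dep_card.
  rewrite -{1}[n]card_ord -(@card_imset _ _ (fun i : 'I_n => rot_tuple i w)).
    apply/subset_leq_card/fintype.subsetP => _ /imsetP[i _ ->].
    have wi : rotation w (rot_tuple i w) by exists i.
    rewrite !inE (rotation_cyc_reduced wi) (word_ab_rotation wi).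
    by move: wc; rewrite inE => ->; apply/eqP/necklace_eq/rotation_sym.
  suff H (i j : 'I_n) : rot i w = rot j w -> (i < j)%N = false.
    move=> i j /(congr1 val) /= ij; apply: val_inj.
    by have := H _ _ ij; have := H _ _ (esym ij); case: ltngtP.
  move=> ij; apply: contraNF wp => ltij; rewrite inE; apply/existsP.
  have lt : (j - i < n)%N by rewrite (leq_ltn_trans (leq_subr _ _)).
  exists (Ordinal lt); rewrite /= subn_gt0 ltij; apply/eqP.
  apply: (@rot_inj i); rewrite ij -rotD; last first.
    by rewrite size_tuple subnKC ltnW.
  by rewrite subnKC // ltnW.
rewrite big_split leq_add2l -big_distrr leq_mul2l /=; apply/orP; right.
rewrite -(partition_big_imset (@necklace n) _ (fun w => nat_of_bool (per w))) /=.
rewrite -sum1_card big_mkcond /= [X in (_ <= X)%N]big_mkcond /=.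
by apply: leq_sum => w _; rewrite /per; case: ifP => //; case: ifP.
Qed.

Definition rot_fixed n d : {set n.-tuple (letter k)} :=
  [set w : n.-tuple (letter k) | rot d w == w :> seq _].

(** A fixed word is determined by its first d letters. Rotations by d and by n - d are inverse,
    hence have the same fixed words, so d <= n / 2 may be assumed. *)
Lemma card_rot_fixed n d : (0 < k)%N -> (0 < d < n)%N ->
  (#|rot_fixed n d| <= k.*2 ^ n./2)%N.
Proof.
move=> k0; wlog: d / (d <= n./2)%N => [H /andP[d0 dn]|dn2 /andP[d0 dn]].
  case: (leqP d n./2) => dn2; first by apply: H => //; rewrite d0.
  have nd : (n - d <= n./2)%N by move: dn2 dn; lia.
  apply: leq_trans (H (n - d)%N nd _); last by move: d0 dn; lia.
  apply/subset_leq_card/fintype.subsetP => w; rewrite !inE => /eqP wd.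
  by have := rotK d w; rewrite wd /rotr size_tuple => /eqP.
have inj : {in rot_fixed n d &, injective (fun w : n.-tuple (letter k) => take d w)}.
  move=> w t; rewrite !inE => /eqP wd /eqP td E; apply: val_inj => /=.
  have H (u : n.-tuple (letter k)) : rot d u = u ->
     drop d u ++ take d u = take d u ++ drop d u.
    by rewrite -/(rot d u) => ->; rewrite cat_take_drop.
  rewrite -(cat_take_drop d w) -(cat_take_drop d t) E; congr (_ ++ _).
  apply: (commuting_prefix_inj (p := take d t)).
  - by rewrite -size_eq0 size_take size_tuple dn -lt0n.
  - by rewrite !size_drop !size_tuple.
  - by rewrite -E; apply: H.
  - exact: H.
have sz (w : n.-tuple (letter k)) : size (take d w) == d.
  by rewrite size_take size_tuple dn.
pose f w : d.-tuple (letter k) := Tuple (sz w).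
apply: (@leq_trans #|{: d.-tuple (letter k)}|).
  rewrite -(@card_in_imset _ _ f (rot_fixed n d)); first exact: max_card.
  by move=> w t wA tA /(congr1 val); apply: inj.
by rewrite card_tuple card_letter leq_pexp2l // double_gt0.
Qed.

Lemma card_periodic_words n : (0 < k)%N ->
  (#|periodic_words n| <= n * k.*2 ^ n./2)%N.
Proof.
move=> k0; rewrite (_ : (n * _ = \sum_(d : 'I_n) k.*2 ^ n./2)%N); last first.
  by rewrite sum_nat_const card_ord.
apply: (@leq_trans (\sum_(d : 'I_n) if (0 < d)%N then #|rot_fixed n d| else 0%N)).
  rewrite (_ : periodic_words n =
    \big[@finset.setU _/finset.set0]_(d < n) if (0 < d)%N then rot_fixed n d else finset.set0).
    elim/big_rec2: _ => [|d A m _ le]; first by rewrite cards0.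
    rewrite (leq_trans (leq_card_setU _ _).1) // leq_add //.
    by case: ifP; rewrite ?cards0.
  apply/setP => w; rewrite inE; apply/existsP/bigcupP => [[d /andP[d0 wd]]|[d _]].
    by exists d; rewrite ?d0 ?inE.
  by case: ifP => d0; rewrite inE // => wd; exists d; rewrite d0.
apply: leq_sum => d _; case: ifP => // d0.
by apply: card_rot_fixed => //; rewrite d0 /=.
Qed.

End Necklaces.

(** * Fourier analysis on a finite box *)

Section RootsOfUnity.
Variable R : realType.
Local Notation C := R[i].

(** Characters and cosines come from a splitting of X^M - 1, which is separable in characteristic 0;
    the rest of the Fourier analysis is algebra. *)
Lemma prim_root_exists M : (0 < M)%N -> exists w : C, M.-primitive_root w.
Proof.
move=> M0; pose p : {poly C} := 'X^M - 1.
have [r Dp] := closed_field_poly_normal p.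
rewrite (monicP _) ?monicXnsubC // scale1r in Dp.
have rn1 : all M.-unity_root r by apply/allP=> z; rewrite -root_prod_XsubC -Dp.
have sz_r : (M < (size r).+1)%N by rewrite -(size_prod_XsubC r id) -Dp size_XnsubC.
have [|z _ zM] := hasP (has_prim_root M0 rn1 _ sz_r); last by exists z.
by rewrite -separable_prod_XsubC -Dp separable_Xn_sub_1 // pnatr_eq0 -lt0n.
Qed.

Variables (M : nat) (w : C).
Hypothesis wM : M.-primitive_root w.

Lemma prim_root_gt0 : (0 < M)%N. Proof. exact: prim_order_gt0 wM. Qed.

Lemma norm_root_pow i : `|w ^+ i| = 1.
Proof.
have w1 : `|w| ^+ M = 1 by rewrite -normrX (prim_expr_order wM) normr1.
have M0 := prim_root_gt0.
by move/eqP: w1; rewrite pexpr_eq1 // normrX => /eqP ->; rewrite expr1n.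
Qed.

Lemma root_pow_neq0 i : w ^+ i != 0.
Proof. by rewrite -normr_eq0 norm_root_pow oner_eq0. Qed.

Lemma conj_root_pow i : (w ^+ i)^*%C = (w ^+ i)^-1.
Proof. by rewrite invc_norm norm_root_pow expr1n invr1 mul1r. Qed.

Definition root_cos i : R := complex.Re (w ^+ i).

Lemma root_cosE i : w ^+ i + (w ^+ i)^-1 = (2 * root_cos i)%:C%C.
Proof. by rewrite -conj_root_pow addcJ rmorphM rmorph_nat. Qed.

Lemma root_cos_bound i : -1 <= root_cos i <= 1.
Proof.
rewrite -ler_norml; have := normc_ge_Re (w ^+ i).
by rewrite norm_root_pow (_ : 1 = 1%:C%C) // lecR.
Qed.

Lemma root_orthogonal (a b : 'I_M) :
  \sum_(i < M) (w ^+ i) ^+ a * ((w ^+ i)^-1) ^+ b = (M * (a == b))%:R.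
Proof.
pose z := w ^+ a / w ^+ b.
have -> : \sum_(i < M) (w ^+ i) ^+ a * ((w ^+ i)^-1) ^+ b = \sum_(i < M) z ^+ i.
  apply: eq_bigr => i _; rewrite /z exprMn !exprVn -!exprM.
  by rewrite ![(i * _)%N]mulnC.
case: (eqVneq a b) => [ab|ab]; [subst b|].
  rewrite /z divff ?root_pow_neq0 // muln1.
  by under eq_bigr do rewrite expr1n; rewrite sumr_const card_ord.
have z1 : z != 1.
  rewrite /z -[1](divff (root_pow_neq0 b)) -subr_eq0 -mulrBl mulf_eq0 invr_eq0.
  rewrite (negbTE (root_pow_neq0 b)) orbF subr_eq0 (eq_prim_root_expr wM).
  by rewrite !modn_small.
have zM : z ^+ M = 1.
  rewrite /z expr_div_n -!exprM ![(_ * M)%N]mulnC !exprM (prim_expr_order wM).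
  by rewrite !expr1n divr1.
rewrite muln0; apply/eqP; have /esym/eqP := subrX1 z M.
by rewrite zM subrr mulf_eq0 subr_eq0 (negbTE z1).
Qed.

End RootsOfUnity.

Section Plancherel.
Variables (R : realType) (k M : nat) (w : R[i]).
Hypothesis wM : M.-primitive_root w.
Local Notation box := {ffun 'I_k -> 'I_M}.

Definition character (xi x : box) : R[i] := \prod_j (w ^+ xi j) ^+ x j.
Definition fourier (h : box -> R) (xi : box) : R[i] :=
  \sum_x (h x)%:C%C * character xi x.

Lemma character_orthogonal (x y : box) :
  \sum_xi character xi x * (character xi y)^*%C = (M ^ k * (x == y))%:R.
Proof.
have conjE xi : (character xi y)^*%C = \prod_j ((w ^+ xi j)^-1) ^+ y j.
  rewrite rmorph_prod; apply: eq_bigr => j _.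
  by rewrite rmorphXn /= (conj_root_pow wM).
under eq_bigr do rewrite conjE -big_split /=.
rewrite -(bigA_distr_bigA (fun (j : 'I_k) (i : 'I_M) =>
  (w ^+ i) ^+ x j * ((w ^+ i)^-1) ^+ y j)) /=.
under eq_bigr do rewrite (root_orthogonal wM).
rewrite -natr_prod big_split /= prod_nat_const card_ord; congr (_ * _)%:R.
case: eqP => [->|/eqP xy]; first by rewrite big1 // => j _; rewrite eqxx.
have [j xyj] : exists j, x j != y j.
  apply/existsP; apply: contraNT xy; rewrite negb_exists => /forallP xy.
  by apply/eqP/ffunP => j; apply/eqP; move: (xy j); rewrite negbK.
by rewrite (bigD1 j) //= (negbTE xyj).
Qed.

Lemma plancherel (h : box -> R) :
  \sum_xi `|fourier h xi| ^+ 2 = ((M ^ k)%:R * \sum_x h x ^+ 2)%:C%C.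
Proof.
have E xi : `|fourier h xi| ^+ 2 = \sum_x \sum_y
   (h x * h y)%:C%C * (character xi x * (character xi y)^*%C).
  rewrite sqr_normc /fourier rmorph_sum /= mulr_suml; apply: eq_bigr => x _.
  rewrite mulr_sumr; apply: eq_bigr => y _.
  have -> : (((h y)%:C * character xi y)^*)%C = (h y)%:C%C * (character xi y)^*%C.
    by rewrite rmorphM; congr (_ * _); apply: conjc_real.
  by rewrite rmorphM mulrACA.
under eq_bigr do rewrite E.
rewrite exchange_big mulr_sumr rmorph_sum /=; apply: eq_bigr => x _.
rewrite exchange_big /= (bigD1 x) //= -mulr_sumr character_orthogonal eqxx muln1.
rewrite big1 => [|y yx]; last first.
  by rewrite -mulr_sumr character_orthogonal eq_sym (negbTE yx) muln0 mulr0.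
by rewrite addr0 -(rmorph_nat (real_complex R)) -rmorphM mulrC.
Qed.

Lemma plancherel_le (h g : box -> R) :
  (forall xi, `|fourier h xi| <= (g xi)%:C%C) ->
  (M ^ k)%:R * \sum_x h x ^+ 2 <= \sum_xi g xi ^+ 2.
Proof.
move=> hg; rewrite -lecR -plancherel rmorph_sum; apply: ler_sum => xi _.
by rewrite rmorphXn lerXn2r // nnegrE // (le_trans _ (hg xi)).
Qed.

End Plancherel.

(** * Heat sums over the discrete torus *)

Section CentralBinomial.
Variable R : realType.

Definition central_prob (p : nat) : R := ('C(p.*2, p))%:R / 4 ^+ p.

Lemma central_probS p :
  central_prob p.+1 = central_prob p * ((2 * p%:R + 1) / (2 * p%:R + 2)).
Proof.
rewrite /central_prob exprS.
have H : ('C(p.+1.*2, p.+1) * p.+1 = 'C(p.*2, p) * (p.*2.+1 * 2))%N.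
  have e1 := mul_bin_diag p.*2.+2 p; have e2 := mul_bin_diag p.*2.+1 p.
  have e3 : ('C(p.*2.+1, p) = 'C(p.*2.+1, p.+1))%N.
    by rewrite -bin_sub; [congr 'C(_, _); lia|lia].
  rewrite /= in e1 e2; rewrite doubleS mulnC -e1 e3.
  have -> : p.*2.+2 = (2 * p.+1)%N by lia.
  by rewrite -mulnA -e2; lia.
have p0 : 0 <= p%:R :> R by [].
have H' : ('C(p.+1.*2, p.+1))%:R * (p%:R + 1) =
    ('C(p.*2, p))%:R * ((2 * p%:R + 1) * 2) :> R.
  by rewrite natr1 -natrM H !natrM -[p.*2.+1%:R]natr1 -[in (p.*2)%:R]mul2n natrM.
have -> : ('C(p.+1.*2, p.+1))%:R =
    ('C(p.*2, p))%:R * ((2 * p%:R + 1) * 2) / (p%:R + 1) :> R.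
  by rewrite -H' mulfK //; lra.
have P4 : 4 ^+ p != 0 :> R by rewrite expf_neq0.
field; rewrite P4 /=; apply/andP; split; apply: lt0r_neq0; lra.
Qed.

(** Wallis: the left-hand side does not increase with p, since (2p + 1) (2p + 3) <= (2p + 2)^2. *)
Lemma central_prob_le p : central_prob p ^+ 2 * (2 * p%:R + 1) <= 1.
Proof.
elim: p => [|p IH]; first by rewrite /central_prob bin0 expr0 divr1 expr1n; lra.
rewrite central_probS -[p.+1%:R]natr1; have p0 : 0 <= p%:R :> R by [].
set x := p%:R in p0 IH *; set a := central_prob p in IH *.
apply: le_trans IH.
have -> : (a * ((2 * x + 1) / (2 * x + 2))) ^+ 2 * (2 * (x + 1) + 1) =
  a ^+ 2 * (2 * x + 1) * ((2 * x + 1) * (2 * x + 3) / (2 * x + 2) ^+ 2).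
  by field; apply: lt0r_neq0; lra.
rewrite ler_piMr ?mulr_ge0 ?sqr_ge0 //; first by lra.
rewrite ler_pdivrMr ?mul1r; last by apply: exprn_gt0; lra.
by rewrite expr2; nra.
Qed.

End CentralBinomial.

Section CosineSums.
Variables (R : realType) (M : nat) (w : R[i]).
Hypothesis wM : M.-primitive_root w.
Local Notation c := (root_cos w).

(** The summand is a Laurent polynomial in the root, of degrees -p to p, and orthogonality keeps its
    constant term; 2p < M excludes aliasing. The sign e treats the two peaks at once. *)
Lemma sum_cos_pow p (e : R) : (p.*2 < M)%N -> e ^+ 2 = 1 ->
  \sum_(i < M) ((1 + e * c i) / 2) ^+ p = M%:R * central_prob R p.
Proof.
move=> pM e2; apply: complexI; rewrite rmorph_sum /=.
have e0 : e%:C%C != 0.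
  have : e != 0 by apply: contra_eq_neq e2 => ->; rewrite expr0n eq_sym oner_eq0.
  by apply: contra => /eqP /complexI ->.
have e2C : e%:C%C ^+ 2 = 1 by rewrite -rmorphXn e2.
have termE (i : 'I_M) : ((((1 + e * c i) / 2) ^+ p)%:C)%C =
   (4^-1 * e%:C%C) ^+ p * \sum_(l < p.*2.+1) ('C(p.*2, l))%:R * e%:C%C ^+ l * ((w ^+ i) ^+ l * ((w ^+ i)^-1) ^+ p).
  pose z := w ^+ i; have z0 : z != 0 := root_pow_neq0 wM i.
  have -> : (((1 + e * c i) / 2) ^+ p)%:C%C = (4^-1 * e%:C%C * z^-1 * (1 + e%:C%C * z) ^+ 2) ^+ p.
    rewrite rmorphXn /=; congr (_ ^+ _).
    have -> : 4^-1 * e%:C%C * z^-1 * (1 + e%:C%C * z) ^+ 2 =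
       4^-1 * (2 * e%:C%C ^+ 2 + e%:C%C * (z^-1 + e%:C%C ^+ 2 * z)).
      by field.
    rewrite e2C !mulr1 mul1r [z^-1 + z]addrC (root_cosE wM).
    rewrite -[in RHS](rmorph_nat (real_complex R) 4) -[in RHS](rmorph_nat (real_complex R) 2).
    rewrite -fmorphV -!rmorphM -rmorphD -rmorphM; congr (_%:C)%C; lra.
  rewrite exprMn [(_ * z^-1) ^+ p]exprMn -mulrA; congr (_ * _).
  rewrite -exprM mul2n addrC exprD1n mulr_sumr; apply: eq_bigr => l _.
  by rewrite -mulr_natl exprMn; ring.
under eq_bigr do rewrite termE.
rewrite -mulr_sumr exchange_big /=.
have pM' : (p < M)%N by lia.
have inner (l : 'I_p.*2.+1) :
    \sum_(i < M) ('C(p.*2, l))%:R * e%:C%C ^+ l * ((w ^+ i) ^+ l * ((w ^+ i)^-1) ^+ p) =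
    if l == p :> nat then M%:R * ('C(p.*2, p))%:R * e%:C%C ^+ p else 0.
  have lM : (l < M)%N by apply: leq_ltn_trans pM; rewrite -ltnS.
  rewrite -mulr_sumr (root_orthogonal wM (Ordinal lM) (Ordinal pM')) -val_eqE /=.
  by case: eqP => [->|_]; rewrite ?muln1 ?muln0 ?mulr0 //; ring.
under eq_bigr do rewrite inner.
have pp : (p < p.*2.+1)%N by rewrite ltnS -addnn leq_addr.
rewrite (bigD1 (Ordinal pp)) //= eqxx big1 => [|l lp]; last first.
  by rewrite -val_eqE /= in lp; rewrite (negbTE lp).
rewrite addr0 exprMn.
transitivity (4^-1 ^+ p * (M%:R * ('C(p.*2, p))%:R) * (e%:C%C ^+ 2) ^+ p).
  by rewrite exprAC; ring.
rewrite e2C expr1n mulr1 /central_prob rmorphM fmorph_div !rmorph_nat rmorphXn rmorph_nat.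
by rewrite exprVn; ring.
Qed.

(** The discrete form of the bound O(b^(-1/2)) for the integral of exp (- b (1 - cos)): a power of
    (1 + x) / 2, whose sum is known exactly, dominates the exponential near the peak. *)
Lemma sum_cos_heat b p (e : R) : 1 <= b -> p%:R <= b < p%:R + 1 ->
  (p.*2 < M)%N -> e ^+ 2 = 1 ->
  \sum_(i < M) expR (- (b * (1 - e * c i))) <= M%:R * (5 / Num.sqrt b).
Proof.
move=> b1 /andP[pb bp] pM e2; set sb := Num.sqrt b.
have sbE : sb ^+ 2 = b by rewrite sqr_sqrtr //; lra.
have sb0 : 0 < sb by rewrite sqrtr_gt0; lra.
have sb1 : 1 <= sb by rewrite -sqrtr1 ler_sqrt //; lra.
apply: (@le_trans _ _ (\sum_(i < M) (((1 + e * c i) / 2) ^+ p + expR (- (b / 2))))).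
  apply: ler_sum => i _; have /andP[c1 c2] := root_cos_bound wM i.
  have ec : -1 <= e * c i <= 1.
    have : (e - 1) * (e + 1) = 0 by rewrite -subr_sqr_1 e2 subrr.
    by move/eqP; rewrite mulf_eq0 => /orP[] /eqP ee; [have -> : e = 1 by lra|have -> : e = -1 by lra]; lra.
  set x := e * c i in ec *; have p0 : 0 <= p%:R :> R by [].
  have f0 : 0 <= (1 + x) / 2 by lra.
  (* With a = 1 - x, the bound 1 - a + a^2 on exp (- a) stays below 1 - a / 2 exactly for 0 <= a <=
     1 / 2; farther out exp (- b / 2) suffices. *)
  case: (lerP (1 - x) (1 / 2)) => x2.
    apply: ler_wpDr; first exact: expR_ge0.
    have le1 : expR (- (1 - x)) <= (1 + x) / 2.
      have x0 : 0 <= 1 - x by lra.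
      by apply: le_trans (expRN_ub x0) _; nra.
    apply: (@le_trans _ _ (expR (- (p%:R * (1 - x))))).
      by rewrite ler_expR lerN2 ler_wpM2r //; lra.
    by rewrite expRM_nat lerXn2r ?nnegrE ?expR_ge0.
  apply: ler_wpDl; first exact: exprn_ge0.
  by rewrite ler_expR lerN2; nra.
rewrite big_split /= sum_cos_pow // sumr_const card_ord -[X in _ + X]mulr_natl -mulrDr.
rewrite ler_wpM2l //.
have cp : central_prob R p <= 1 / sb.
  have cp0 : 0 <= central_prob R p by rewrite divr_ge0 ?exprn_ge0.
  rewrite -ler_sqr ?nnegrE ?divr_ge0 ?(ltW sb0) //.
  rewrite [leRHS]expr_div_n expr1n sbE ler_pdivlMr; last by lra.
  apply: le_trans (central_prob_le R p); rewrite ler_wpM2l ?sqr_ge0 //.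
  by have p0 : 0 <= p%:R :> R by []; lra.
have b20 : 0 < b / 2 by lra.
have eb : expR (- (b / 2)) <= 4 / sb.
  have H := expR_ge1Dx (b / 2).
  rewrite expRN -[4 / sb]invrK lef_pV2 ?posrE ?invr_gt0 ?divr_gt0 ?expR_gt0 // invf_div.
  by nra.
lra.
Qed.

Lemma sum_box_heat k b p (e : R) : 1 <= b -> p%:R <= b < p%:R + 1 ->
  (p.*2 < M)%N -> e ^+ 2 = 1 ->
  \sum_(xi : {ffun 'I_k -> 'I_M}) expR (- (b * (k%:R - e * \sum_j c (xi j)))) <=
  (M ^ k)%:R * (5 / Num.sqrt b) ^+ k.
Proof.
move=> b1 bp pM e2.
have E (xi : {ffun 'I_k -> 'I_M}) : expR (- (b * (k%:R - e * \sum_j c (xi j)))) =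
    \prod_j expR (- (b * (1 - e * c (xi j)))).
  rewrite -expR_sum sumrN -mulr_sumr sumrB -mulr_sumr sumr_const card_ord.
  by congr (expR (- (b * (_ - _)))).
under eq_bigr do rewrite E.
rewrite -(bigA_distr_bigA (fun (j : 'I_k) (i : 'I_M) => expR (- (b * (1 - e * c i))))) /=.
rewrite prodr_const card_ord natrX -exprMn; apply: lerXn2r.
- by rewrite nnegrE sumr_ge0 // => i _; apply: expR_ge0.
- by rewrite nnegrE mulr_ge0 ?divr_ge0 ?sqrtr_ge0.
- exact: sum_cos_heat bp pM e2.
Qed.

End CosineSums.

(** * Fourier transforms of the two laws *)

Section Binomial.
Variable R : realType.

(** A lazy step is the sum of two fair half-steps, whence the row 2N; the index i stands for the
    position i - H. The guard is needed because truncated subtraction would give mass to positions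
    below -N. *)
Definition binpmf (N H i : nat) : R :=
  if (H <= i + N)%N then ('C(N.*2, i + N - H))%:R / 4 ^+ N else 0.

Lemma binpmf_ge0 N H i : 0 <= binpmf N H i.
Proof. by rewrite /binpmf; case: ifP => // _; rewrite divr_ge0 ?exprn_ge0. Qed.

(** The morphism [f] lets one reindexing serve both the real moments and the complex transform. *)
Lemma sum_binpmf (V : comNzRingType) (f : {rmorphism R -> V}) N H (F : nat -> V) :
  (N <= H)%N ->
  \sum_(i < H.*2.+1) f (binpmf N H i) * F i =
  \sum_(l < N.*2.+1) f (('C(N.*2, l))%:R / 4 ^+ N) * F (l + (H - N))%N.
Proof.
move=> NH; rewrite -(big_mkord xpredT (fun i => f (binpmf N H i) * F i)).
rewrite (@big_cat_nat _ _ _ (H - N)) //=; last by lia.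
rewrite big_nat big1 ?add0r; last first.
  move=> i /andP[_ iHN]; rewrite /binpmf leqNgt (_ : (i + N < H)%N); last by lia.
  by rewrite rmorph0 mul0r.
rewrite -{1}[(H - N)%N]add0n big_addn (@big_cat_nat _ _ _ N.*2.+1) //=; last by lia.
rewrite [X in _ + X]big_nat [X in _ + X]big1 ?addr0; last first.
  move=> l /andP[lN _]; rewrite /binpmf (_ : (H <= _)%N); last by lia.
  by rewrite bin_small ?mul0r ?rmorph0 ?mul0r //; lia.
rewrite big_mkord; apply: eq_bigr => l _; rewrite /binpmf (_ : (H <= _)%N); last by lia.
by congr (f ('C(_, _)%:R / _) * _); lia.
Qed.

Lemma binpmf_gen N H (z : R[i]) : (N <= H)%N -> z != 0 ->
  \sum_(i < H.*2.+1) (binpmf N H i)%:C%C * z ^+ i =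
  z ^+ H * (4^-1 * z^-1 * (1 + z) ^+ 2) ^+ N.
Proof.
move=> NH z0; rewrite (sum_binpmf (real_complex R) _ NH).
have -> : (4^-1 * z^-1 * (1 + z) ^+ 2) ^+ N = 4^-1 ^+ N * z^-1 ^+ N * (z + 1) ^+ N.*2.
  by rewrite [LHS]exprMn [in LHS]exprMn -mul2n exprM [1 + z]addrC.
rewrite -[in RHS](subnK NH) exprD exprD1n.
rewrite !mulr_sumr; apply: eq_bigr => l _.
rewrite fmorph_div rmorph_nat rmorphXn rmorph_nat exprD -mulr_natl !exprVn.
by field; rewrite !expf_neq0 // z0.
Qed.

End Binomial.

Section WordLaw.
Variables (R : realType) (k : nat).
Hypothesis k_ge2 : (2 <= k)%N.
Local Notation kk := (k%:R : R).
Local Notation q := (branching R k).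
Local Notation u := (@cheb_norm R k).

(* The box is the cube [-H, H]^k, shifted to nonnegative coordinates. *)
Definition box_pos H (x : {ffun 'I_k -> 'I_H.*2.+1}) : 'rV[int]_k :=
  \row_j ((x j : nat)%:Z - H%:Z).

(** Dividing by q^n instead of the number of words keeps the transform explicit; the total mass is
    then only close to 1. *)
Definition word_law n (b : 'rV[int]_k) : R :=
  (#|[pred w : n.-tuple (letter k) | cyc_reduced w && (word_ab w == b)]|)%:R / q ^+ n.

(** The inverse letters are moved to the left, so that only natural powers occur. *)
Lemma letter_wt_prod (F : fieldType) (z : 'I_k -> F) (s : seq (letter k)) :
  (forall i, z i != 0) ->
  (\prod_(a <- s) letter_wt z a) * \prod_j z j ^+ count_mem (j, true) s =
  \prod_j z j ^+ count_mem (j, false) s.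
Proof.
move=> z0; elim: s => [|[i e] s IH].
  by rewrite big_nil mul1r; apply: eq_bigr.
have cE e' : \prod_j z j ^+ count_mem (j, e') ((i, e) :: s) =
   (if e == e' then z i else 1) * \prod_j z j ^+ count_mem (j, e') s.
  have -> : (if e == e' then z i else 1) = \prod_j (if (j == i) && (e == e') then z j else 1).
    case: (e == e'); last by rewrite big1 // => j _; rewrite andbF.
    by rewrite (bigD1 i) //= eqxx big1 ?mulr1 // => j /negbTE ->.
  rewrite -big_split; apply: eq_bigr => j _ /=.
  by rewrite xpair_eqE [i == j]eq_sym exprD; case: (_ && _).
rewrite big_cons !cE mulrACA IH; congr (_ * _).
by case: e {cE}; rewrite /letter_wt //= ?mulr1 ?mulVf.
Qed.

Lemma count_le_size (T : eqType) (s : seq T) (a b : T) : a != b ->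
  (count_mem a s + count_mem b s <= size s)%N.
Proof.
move=> ab; rewrite -(count_predUI (pred1 a)) -[leqRHS]addn0; apply: leq_add; first exact: count_size.
rewrite leqn0 -[X in _ == X](count_pred0 s); apply/eqP/eq_count => x /=.
by case: eqP => // ->; rewrite (negbTE ab).
Qed.

Section FourierLaws.
Variables (H : nat) (om : R[i]).
Hypothesis omM : (H.*2.+1).-primitive_root om.
Local Notation box := {ffun 'I_k -> 'I_H.*2.+1}.
Local Notation c := (root_cos om).
Local Notation fourier := (fourier om).

(** The effect of shifting the cube to nonnegative coordinates. It is common to both laws and of
    modulus 1, so Plancherel does not see it. *)
Definition phase (xi : box) : R[i] := \prod_j (om ^+ xi j) ^+ H.

Lemma norm_phase xi : `|phase xi| = 1.
Proof.
rewrite normr_prod big1 // => j _.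
by rewrite normrX (norm_root_pow omM) expr1n.
Qed.

(** For n <= H every word ends inside the box, so summing over the box is summing over words, and
    the trace formula applies at roots of unity. *)
Lemma fourier_word_law n xi : (0 < n <= H)%N ->
  fourier (fun x : box => word_law n (box_pos x)) xi =
  phase xi * (u n (\sum_j c (xi j)) + (2 * kk - 2) * (~~ odd n)%:R / q ^+ n)%:C%C.
Proof.
move=> /andP[n0 nH]; have q0 := q_gt0 R k_ge2.
pose z j := om ^+ xi j; have z0 j : z j != 0 := root_pow_neq0 omM _.
have uE : u n (\sum_j c (xi j)) + (2 * kk - 2) * (~~ odd n)%:R / q ^+ n =
   (cheb q (2 * \sum_j c (xi j)) n + (2 * kk - 2) * (~~ odd n)%:R) / q ^+ n.
  by rewrite [RHS]mulrDl.
have SE : \sum_a letter_wt z a = (2 * \sum_j c (xi j))%:C%C.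
  rewrite sum_letter_wt mulr_sumr rmorph_sum; apply: eq_bigr => j _.
  exact: (root_cosE omM).
have cycE := cyc_reduced_sum z0 n0.
have kC : (k.*2)%:R = (2 * kk)%:C%C :> R[i] by rewrite rmorphM !rmorph_nat -mul2n natrM.
have q1 : (k.*2)%:R - 1 = q%:C%C :> R[i] by rewrite kC (qE R k) rmorphB rmorph1.
rewrite SE q1 cheb_rmorph kC in cycE.
rewrite uE [in RHS]rmorphM [in RHS]rmorphD [in RHS]rmorphM rmorphB !rmorph_nat.
rewrite -cycE {cycE uE SE kC q1} mulrA mulr_sumr.
pose pt (w : n.-tuple (letter k)) : box :=
  [ffun j => inord (count_mem (j, false) w + H - count_mem (j, true) w)].
have ptP (w : n.-tuple (letter k)) j :
    (pt w j + count_mem (j, true) w = count_mem (j, false) w + H)%N.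
  have ft : (j, false) != (j, true) by rewrite xpair_eqE andbF.
  have := count_le_size w ft; rewrite size_tuple => cn.
  rewrite ffunE; move: cn; move: (count_mem (j, false) w) (count_mem (j, true) w) => a b ab.
  by rewrite inordK; lia.
have ptE (w : n.-tuple (letter k)) x : (word_ab w == box_pos x) = (x == pt w).
  apply/eqP/eqP => [/rowP wx|->].
    apply/ffunP => j; apply: val_inj => /=; have := wx j; have := ptP w j.
    rewrite !mxE /=; move: (count_mem (j, false) w) (count_mem (j, true) w) => a b.
    by lia.
  apply/rowP => j; rewrite !mxE; have := ptP w j.
  by move: (count_mem (j, false) w) (count_mem (j, true) w) => a b; lia.
have chE (w : n.-tuple (letter k)) :
    character om xi (pt w) = phase xi * \prod_(a <- w) letter_wt z a.
  have P0 : \prod_j z j ^+ count_mem (j, true) w != 0.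
    by apply/prodf_neq0 => j _; rewrite expf_neq0.
  apply: (mulIf P0); rewrite -mulrA letter_wt_prod // -!big_split /=.
  by apply: eq_bigr => j _; rewrite -!exprD ptP addnC.
transitivity (\sum_(w : n.-tuple (letter k) | cyc_reduced w) (q ^+ n)^-1%:C%C * character om xi (pt w)).
  rewrite /fourier.
  have lawE x : (word_law n (box_pos x))%:C%C * character om xi x =
      \sum_(w : n.-tuple (letter k) | cyc_reduced w) if x == pt w then (q ^+ n)^-1%:C%C * character om xi (pt w) else 0.
    rewrite -big_mkcondr /= /word_law.
    transitivity (\sum_(w : n.-tuple (letter k) | cyc_reduced w && (x == pt w)) (q ^+ n)^-1%:C%C * character om xi x); last first.
      by apply: eq_bigr => w /andP[_ /eqP <-].
    rewrite sumr_const rmorphM rmorph_nat -mulrA mulr_natl; congr (_ *+ _).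
    by apply: eq_card => w; rewrite !inE ptE.
  under eq_bigr do rewrite lawE.
  rewrite exchange_big; apply: eq_bigr => w _ /=.
  by rewrite -big_mkcond big_pred1_eq.
rewrite mulr_suml; apply: eq_bigr => w _.
by rewrite chE mulrC.
Qed.

(* The coordinates are independent, each the position after [N] steps of the
   walk with step law (1/4, 1/2, 1/4) on {-1, 0, 1}; this law sees both parities. *)
Definition lazy_law N (x : box) : R := \prod_j binpmf R N H (x j).

Lemma fourier_lazy_law N xi : (N <= H)%N ->
  fourier (lazy_law N) xi =
  phase xi * (\prod_j ((1 + c (xi j)) / 2) ^+ N)%:C%C.
Proof.
move=> NH; rewrite /fourier.
have E (x : box) : (lazy_law N x)%:C%C * character om xi x =
    \prod_j ((binpmf R N H (x j))%:C%C * (om ^+ xi j) ^+ x j).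
  by rewrite /lazy_law rmorph_prod -big_split.
rewrite (eq_bigr _ (fun x _ => E x)).
rewrite -(bigA_distr_bigA (fun (j : 'I_k) (i : 'I_H.*2.+1) =>
  (binpmf R N H i)%:C%C * (om ^+ xi j) ^+ i)) /=.
rewrite /phase rmorph_prod -big_split; apply: eq_bigr => j _ /=.
have z0 : om ^+ xi j != 0 := root_pow_neq0 omM _.
rewrite binpmf_gen // rmorphXn; congr (_ * _ ^+ _).
set z := om ^+ xi j in z0 *.
have -> : 4^-1 * z^-1 * (1 + z) ^+ 2 = 4^-1 * (2 + (z + z^-1)) by field.
rewrite (root_cosE omM).
rewrite -[in LHS](rmorph_nat (real_complex R) 4) -[in LHS](rmorph_nat (real_complex R) 2).
rewrite -fmorphV -rmorphD -rmorphM; congr (_%:C)%C; lra.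
Qed.

End FourierLaws.

End WordLaw.

(** * L2 distance of the two laws *)

Section L2.
Variables (R : realType) (k : nat).
Hypothesis k_ge2 : (2 <= k)%N.
Local Notation kk := (k%:R : R).
Local Notation q := (branching R k).
Local Notation kap := (kap R k).
Local Notation u := (@cheb_norm R k).

Lemma qV_expR n : (0 < n)%N -> q^-1 ^+ n <= 4 / n%:R * expR (- (n%:R / 4)).
Proof.
move=> n0; apply: le_trans (sqV_expR R k_ge2 n0).
have s0 := sq_gt0 R k_ge2; have q0 := q_gt0 R k_ge2.
apply: lerXn2r; rewrite ?nnegrE ?invr_ge0 ?(ltW s0) ?(ltW q0) //.
rewrite lef_pV2 ?posrE //; have := sqE R k_ge2; have := q_ge3 R k_ge2.
by set s := Num.sqrt _ in s0 * => h3 sE; rewrite -sE; nra.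
Qed.

Definition l2_const : R :=
  4 * (gap_const R k + 8 * kk) ^+ 2 * (10 / Num.sqrt kap) ^+ k.

(** The pointwise gap is O(1/n) times the two heat kernels, and the mean of their squares over the
    torus is O(n^(-k/2)). *)
Lemma l2_gap n N H : (4 * k <= n)%N -> N%:R <= 2 * n%:R * kap < N%:R + 1 ->
  (n < H)%N -> (N <= H)%N ->
  \sum_(x : {ffun 'I_k -> 'I_H.*2.+1})
    (2^-1 * (word_law R n (box_pos x) + word_law R n.+1 (box_pos x)) - lazy_law R N x) ^+ 2
  <= l2_const / n%:R ^+ 2 * (Num.sqrt n%:R)^-1 ^+ k.
Proof.
move=> kn Nn nH NH; have k2 := kk_ge2 R k_ge2; have kp := kap_gt0 R k_ge2.
have n0 : (0 < n)%N by apply: leq_trans kn; rewrite muln_gt0 /= ltnW.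
have nR : 0 < n%:R :> R by rewrite ltr0n.
have [om omM] := @prim_root_exists R H.*2.+1 isT.
pose C (xi : {ffun 'I_k -> 'I_H.*2.+1}) := \sum_j root_cos om (xi j).
pose b := n%:R * kap / 4.
pose A xi := expR (- (n%:R * kap / 8 * (kk - C xi))).
pose A' xi := expR (- (n%:R * kap / 8 * (kk + C xi))).
pose G := (gap_const R k + 8 * kk) / n%:R.
have g0 := gap_const_gt0 R k_ge2.
have q0 := q_gt0 R k_ge2; have q3 := q_ge3 R k_ge2.
have kpk := kapk R k_ge2; have kp1 := kap_le1 R k_ge2.
pose e m : R := (2 * kk - 2) * (~~ odd m)%:R / q ^+ m.
(* The bounded term of the trace formula is exponentially small after division by q^m. It fits under
   the heat kernels because one of k - C, k + C is at most k and kap k <= 2. *)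
have e_bound m xi : (n <= m)%N -> 0 <= e m <= 8 * kk / n%:R * (A xi + A' xi).
  move=> nm; have qm0 : 0 < q ^+ m by apply: exprn_gt0.
  have /andP[od0 od1] : 0 <= ((~~ odd m)%:R : R) <= 1 by case: (odd m); rewrite ?lexx ?ler01.
  have c0 : 0 <= 2 * kk - 2 by lra.
  apply/andP; split.
    by rewrite /e divr_ge0 ?(ltW qm0) // mulr_ge0 //; lra.
  have le1 : e m <= (2 * kk) * q^-1 ^+ n.
    rewrite /e; apply: ler_pM; rewrite ?mulr_ge0 ?invr_ge0 ?(ltW qm0) //; try lra; try nra.
    rewrite -exprVn -(subnKC nm) exprD ler_piMr ?exprn_ge0 ?invr_ge0 ?(ltW q0) //.
    rewrite exprn_ile1 ?invr_ge0 ?(ltW q0) // invf_le1 //; lra.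
  apply: (le_trans le1).
  have := qV_expR n0; set E := expR _ => qE.
  have EA : E <= A xi + A' xi.
    have kkb : kap * kk <= 2 by lra.
    have nkk : n%:R * (kap * kk) <= n%:R * 2 by rewrite ler_pM2l.
    have nk0 : 0 < n%:R * kap by rewrite mulr_gt0.
    have A0 : 0 <= A xi := expR_ge0 _; have A'0 : 0 <= A' xi := expR_ge0 _.
    case: (lerP 0 (C xi)) => C0.
      have : 0 <= n%:R * kap * C xi by rewrite mulr_ge0 // ltW.
      by move=> h; apply: ler_wpDr => //; rewrite ler_expR; lra.
    have : n%:R * kap * C xi <= 0 by rewrite mulr_ge0_le0 // ltW.
    by move=> h; apply: ler_wpDl => //; rewrite ler_expR; lra.
  have -> : 8 * kk / n%:R * (A xi + A' xi) = 2 * kk * (4 / n%:R * (A xi + A' xi)) by ring.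
  apply: ler_wpM2l; first by lra.
  by apply: le_trans qE _; rewrite ler_wpM2l // divr_ge0.
set h := fun x : {ffun 'I_k -> 'I_H.*2.+1} =>
  2^-1 * (word_law R n (box_pos x) + word_law R n.+1 (box_pos x)) - lazy_law R N x.
have F xi : fourier om h xi = phase om xi *
   (2^-1 * ((u n (C xi) + e n) + (u n.+1 (C xi) + e n.+1)) -
    \prod_j ((1 + root_cos om (xi j)) / 2) ^+ N)%:C%C.
  transitivity ((2^-1)%:C%C * (fourier om (fun x => word_law R n (box_pos x)) xi +
      fourier om (fun x => word_law R n.+1 (box_pos x)) xi) -
      fourier om (lazy_law R N) xi).
    rewrite /fourier -big_split mulr_sumr -sumrB; apply: eq_bigr => x _ /=.
    by rewrite /h rmorphB rmorphM rmorphD; ring.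
  rewrite !(fourier_word_law k_ge2 omM) ?n0 ?(ltnW nH) // (fourier_lazy_law omM) //.
  by rewrite [in RHS]rmorphB [in RHS]rmorphM [in RHS]rmorphD /e -/(C xi); ring.
have hat_bound xi : `|fourier om h xi| <= (G * (A xi + A' xi))%:C%C.
  have t1 j : -1 <= root_cos om (xi j) <= 1 := root_cos_bound omM (xi j).
  have kn' : (k <= n)%N by apply: leq_trans kn; rewrite leq_pmull.
  have := lazy_gap k_ge2 kn' Nn t1; rewrite -/(C xi) -/(A xi) -/(A' xi).
  set P := \prod_j _ => gap.
  have /andP[en0 en] := e_bound n xi (leqnn n).
  have /andP[em0 em] := e_bound n.+1 xi (leqnSn n).
  rewrite F normrM (norm_phase omM) mul1r -/P.
  set v := 2^-1 * _ - P.
  have -> : `|v%:C%C| = `|v|%:C%C by rewrite normc_def /= expr0n addr0 sqrtr_sqr.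
  rewrite lecR.
  have -> : v = (2^-1 * (u n (C xi) + u n.+1 (C xi)) - P) + 2^-1 * (e n + e n.+1).
    by rewrite /v; ring.
  apply: le_trans (ler_normD _ _) _.
  have -> : G * (A xi + A' xi) = gap_const R k / n%:R * (A xi + A' xi) +
     8 * kk / n%:R * (A xi + A' xi) by rewrite /G; ring.
  apply: lerD gap _; rewrite ger0_norm; lra.
(* Here 4 k <= n is used: b >= kap k = 1 + kap. *)
have b1 : 1 <= b.
  have nk : 4 * kk <= n%:R by rewrite -natrM ler_nat.
  have : 4 * kk * kap <= n%:R * kap by rewrite ler_pM2r.
  by rewrite /b; lra.
have b0 : 0 <= b by lra.
have /andP[pb bp] := truncn_itv b0; set p := Num.truncn b in pb bp.
have pH : (p.*2 < H.*2.+1)%N.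
  have : (p <= n)%N.
    rewrite -(ler_nat R); apply: le_trans pb _.
    have : n%:R * kap <= n%:R * 1 by rewrite ler_pM2l.
    by rewrite /b; lra.
  by move=> pn; rewrite ltnS leq_double (leq_trans pn) // ltnW.
have pbp : p%:R <= b < p%:R + 1 by rewrite pb natr1.
have M0 : 0 < ((H.*2.+1) ^ k)%:R :> R by rewrite ltr0n expn_gt0.
rewrite -(ler_pM2l M0); apply: le_trans (plancherel_le omM hat_bound) _.
have sqA xi : (G * (A xi + A' xi)) ^+ 2 <= 2 * G ^+ 2 *
   (expR (- (b * (kk - 1 * C xi))) + expR (- (b * (kk - (-1) * C xi)))).
  have -> : expR (- (b * (kk - 1 * C xi))) = A xi ^+ 2.
    by rewrite expr2 -expRD; congr expR; rewrite /b; field.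
  have -> : expR (- (b * (kk - (-1) * C xi))) = A' xi ^+ 2.
    by rewrite expr2 -expRD; congr expR; rewrite /b; field.
  have -> : 2 * G ^+ 2 * (A xi ^+ 2 + A' xi ^+ 2) = G ^+ 2 * (2 * (A xi ^+ 2 + A' xi ^+ 2)).
    by ring.
  rewrite exprMn; apply: ler_wpM2l; first exact: sqr_ge0.
  by have := sqr_ge0 (A xi - A' xi); nra.
apply: (le_trans (ler_sum _ (fun xi _ => sqA xi))).
rewrite -mulr_sumr big_split /=.
have one2 : (1 : R) ^+ 2 = 1 by rewrite expr1n.
have mone2 : (-1 : R) ^+ 2 = 1 by rewrite sqrrN expr1n.
have S1 := sum_box_heat omM k b1 pbp pH one2.
have S2 := sum_box_heat omM k b1 pbp pH mone2.
set Mk := ((H.*2.+1) ^ k)%:R in M0 S1 S2 *.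
apply: (@le_trans _ _ (2 * G ^+ 2 * (Mk * (5 / Num.sqrt b) ^+ k + Mk * (5 / Num.sqrt b) ^+ k))).
  by apply: ler_wpM2l (lerD S1 S2); rewrite mulr_ge0 ?sqr_ge0.
have -> : 5 / Num.sqrt b = 10 / Num.sqrt kap * (Num.sqrt n%:R)^-1.
  have -> : Num.sqrt b = Num.sqrt n%:R * Num.sqrt kap / 2.
    rewrite [b](_ : _ = (Num.sqrt n%:R * Num.sqrt kap / 2) ^+ 2).
      by rewrite sqrtr_sqr ger0_norm // divr_ge0 ?mulr_ge0 ?sqrtr_ge0.
    by rewrite expr_div_n exprMn !sqr_sqrtr ?(ltW kp) ?(ltW nR) // expr2 /b; field.
  have sn0 : Num.sqrt n%:R != 0 :> R by rewrite gt_eqF // sqrtr_gt0.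
  have sk0 : Num.sqrt kap != 0 :> R by rewrite gt_eqF // sqrtr_gt0.
  by field; rewrite sn0 sk0.
rewrite [(_ * (Num.sqrt n%:R)^-1) ^+ k]exprMn /l2_const /G.
move: ((10 / _) ^+ k) ((Num.sqrt n%:R)^-1 ^+ k) => c d.
apply: ler_of_eq; field; exact: lt0r_neq0.
Qed.

End L2.

(** * Binomial asymptotics *)

Section BinomialMoments.
Variable R : realType.
Implicit Types (N H i j l m : nat).

Lemma sum_bin_step m (F : nat -> R) :
  \sum_(l < m.+2) F l * ('C(m.+1, l))%:R =
  \sum_(l < m.+1) (F l + F l.+1) * ('C(m, l))%:R.
Proof.
rewrite big_ord_recl /= bin0.
under eq_bigr do rewrite /bump /= add1n binS natrD mulrDr.
rewrite big_split /= addrA.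
under [in RHS]eq_bigr do rewrite mulrDl.
rewrite big_split /=; congr (_ + _).
by rewrite big_ord_recr /= bin_small // mulr0 addr0 [in RHS]big_ord_recl bin0.
Qed.

Lemma sum_bin m : \sum_(l < m.+1) ('C(m, l))%:R = 2 ^+ m :> R.
Proof.
elim: m => [|m IH]; first by rewrite big_ord1 bin0 expr0.
under eq_bigr do rewrite -[_%:R]mul1r.
rewrite (sum_bin_step m (fun=> 1)) -mulr_sumr IH exprS; congr (_ * _).
Qed.

Lemma sum_bin_var m :
  \sum_(l < m.+1) (2 * l%:R - m%:R) ^+ 2 * ('C(m, l))%:R = m%:R * 2 ^+ m :> R.
Proof.
elim: m => [|m IH]; first by rewrite big_ord1 !mulr0 subrr expr0n !mul0r.
rewrite (sum_bin_step m (fun l => (2 * l%:R - m.+1%:R) ^+ 2)).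
rewrite (eq_bigr (fun l : 'I_m.+1 => 2 * ((2 * l%:R - m%:R) ^+ 2 * ('C(m, l))%:R)
   + 2 * ('C(m, l))%:R)); last by move=> l _; rewrite -!natr1; ring.
rewrite big_split /= -!mulr_sumr IH sum_bin exprS -natr1; ring.
Qed.

Lemma pow4E N : 4 ^+ N = 2 ^+ N.*2 :> R.
Proof. by rewrite -mul2n exprM expr2; congr (_ ^+ _); lra. Qed.

Lemma sum_binpmf1 N H : (N <= H)%N -> \sum_(i < H.*2.+1) binpmf R N H i = 1.
Proof.
move=> NH; have := @sum_binpmf R R idfun N H (fun=> 1) NH => /= E.
under eq_bigr do rewrite -[binpmf _ _ _ _]mulr1.
rewrite E; under eq_bigr do rewrite mulr1.
by rewrite -mulr_suml sum_bin pow4E divff // expf_neq0.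
Qed.

Lemma sum_binpmf_var N H : (N <= H)%N ->
  \sum_(i < H.*2.+1) binpmf R N H i * (i%:R - H%:R) ^+ 2 = N%:R / 2.
Proof.
move=> NH; rewrite (@sum_binpmf R R idfun N H (fun i => (i%:R - H%:R) ^+ 2) NH) /=.
rewrite (eq_bigr (fun l : 'I_N.*2.+1 => (4 * 4 ^+ N)^-1 *
   ((2 * l%:R - (N.*2)%:R) ^+ 2 * ('C(N.*2, l))%:R))).
  rewrite -mulr_sumr sum_bin_var -pow4E -mul2n natrM; field.
  by rewrite expf_neq0.
move=> l _; rewrite natrD natrB // (_ : (N.*2)%:R = 2 * N%:R); last first.
  by rewrite -mul2n natrM.
field.
by rewrite expf_neq0.
Qed.

(* The truncated subtraction makes the ratio vanish for [j > N]. *)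
Definition bin_ratio N j : R := \prod_(i < j) ((N - i)%N%:R / (N + i.+1)%:R).

Lemma bin_ratioS N j :
  bin_ratio N j.+1 = bin_ratio N j * ((N - j)%N%:R / (N + j.+1)%:R).
Proof. exact: big_ord_recr. Qed.

Lemma bin_ratioE N j : ('C(N.*2, N + j))%:R = ('C(N.*2, N))%:R * bin_ratio N j :> R.
Proof.
elim: j => [|j IH]; first by rewrite addn0 /bin_ratio big_ord0 mulr1.
rewrite bin_ratioS mulrA -IH.
have := mul_bin_left N.*2 (N + j).
have -> : (N.*2 - (N + j) = N - j)%N by lia.
move/(congr1 (fun m => m%:R : R)); rewrite !natrM addnS => E.
by rewrite mulrA [_ * (N - j)%:R]mulrC -E mulrAC divff ?mul1r // pnatr_eq0.
Qed.

Lemma bin_ratio_ge0 N j : 0 <= bin_ratio N j.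
Proof. by apply: prodr_ge0 => i _; rewrite divr_ge0. Qed.

Lemma bin_ratio_le1 N j : bin_ratio N j <= 1.
Proof.
apply: prodr_ile1 => i _; rewrite divr_ge0 //= ler_pdivrMr ?ltr0n //; last by lia.
by rewrite mul1r ler_nat; lia.
Qed.

Lemma binpmf_ratio N H i :
  binpmf R N H i = central_prob R N * bin_ratio N (absz (i%:Z - H%:Z)).
Proof.
rewrite /binpmf /central_prob mulrAC -bin_ratioE; case: ifPn => [iN|iN].
  case: (leqP H i) => Hi.
    by congr (('C(_, _))%:R / _); lia.
  rewrite -bin_sub; last by lia.
  by congr (('C(_, _))%:R / _); lia.
by rewrite bin_small ?mul0r //; lia.
Qed.

(** Each factor is 1 - y + z with y = (2 i + 1) / N and z of second order; the odd numbers sum to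
    j^2, which produces the Gaussian. The 6 is 4 for y^2 plus 2 for z. *)
Lemma bin_ratio_heat N j : (0 < N)%N -> (j <= N)%N ->
  `|bin_ratio N j - expR (- (j%:R ^+ 2 / N%:R))| <= 6 * j%:R ^+ 3 / N%:R ^+ 2.
Proof.
move=> N0 jN; have NR : 0 < N%:R :> R by rewrite ltr0n.
pose g (i : 'I_j) : R := expR (- ((2 * i%:R + 1) / N%:R)).
have sum_odd m : \sum_(i < m) (2 * i%:R + 1) = m%:R ^+ 2 :> R.
  elim: m => [|m IH]; first by rewrite big_ord0 expr0n.
  by rewrite big_ord_recr /= IH -natr1; ring.
have gE : expR (- (j%:R ^+ 2 / N%:R)) = \prod_i g i.
  by rewrite -expR_sum sumrN -mulr_suml sum_odd.
rewrite gE; apply: le_trans (prod_dist_le _ _) _.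
- move=> i; rewrite divr_ge0 //= ler_pdivrMr ?ltr0n //; last by lia.
  by rewrite mul1r ler_nat; lia.
- by move=> i; rewrite expR_ge0 expR_le1 oppr_le0 divr_ge0 // addr_ge0 // mulr_ge0.
apply: (@le_trans _ _ (\sum_(i < j) 6 * j%:R ^+ 2 / N%:R ^+ 2)); last first.
  by rewrite sumr_const card_ord -mulr_natl; apply: ler_of_eq; ring.
apply: ler_sum => i _; have ij := ltn_ord i.
set y := (2 * i%:R + 1) / N%:R : R.
have iR : 0 <= i%:R :> R by [].
have ijR : i%:R + 1 <= j%:R :> R by rewrite natr1 ler_nat.
have ijN : i%:R + 1 <= N%:R :> R by rewrite natr1 ler_nat; lia.
have y0 : 0 <= y by rewrite divr_ge0 //; lra.
have -> : (N - i)%N%:R / (N + i.+1)%:R = 1 - y + (2 * i%:R + 1) * (i%:R + 1) / (N%:R * (N%:R + i%:R + 1)) :> R.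
  rewrite natrB; last by lia.
  rewrite natrD -natr1 /y; field; rewrite !lt0r_neq0 //; lra.
set z := _ / (_ * _).
have z0 : 0 <= z by rewrite divr_ge0 ?mulr_ge0 //; lra.
have zb : z <= 2 * j%:R ^+ 2 / N%:R ^+ 2.
  rewrite /z; apply: ler_pM; rewrite ?mulr_ge0 ?invr_ge0 ?mulr_ge0 //; try lra; first by nra.
  have N1 : 0 < N%:R + i%:R + 1 :> R by lra.
  by rewrite lef_pV2 ?posrE ?mulr_gt0 ?exprn_gt0 // expr2 ler_pM2l //; lra.
have yb : y ^+ 2 <= 4 * j%:R ^+ 2 / N%:R ^+ 2.
  by rewrite /y expr_div_n ler_pM2r ?invr_gt0 ?exprn_gt0 //; nra.
have := expRN_dist y0; rewrite -/(g i) => D.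
have -> : 1 - y + z - g i = (1 - y - g i) + z by ring.
apply: le_trans (ler_normD _ _) _; rewrite (ger0_norm z0).
have -> : 6 * j%:R ^+ 2 / N%:R ^+ 2 = 4 * j%:R ^+ 2 / N%:R ^+ 2 + 2 * j%:R ^+ 2 / N%:R ^+ 2 :> R.
  by ring.
by apply: lerD zb; apply: le_trans D yb.
Qed.

End BinomialMoments.

Section LazyLaw.
Variables (R : realType) (k : nat).
Local Notation kk := (k%:R : R).

(** Kept as a natural number, so that balls are indexed by [nat] and Abel summation over them is
    finite. *)
Definition nsq (b : 'rV[int]_k) : nat := (\sum_j `|b 0%R j| ^ 2)%N.

Section Box.
Variables (N H : nat).
Local Notation box := {ffun 'I_k -> 'I_H.*2.+1}.
Local Notation eta := (@lazy_law R k H N).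

Lemma lazy_law_ge0 x : 0 <= eta x.
Proof. by apply: prodr_ge0 => j _; apply: binpmf_ge0. Qed.

Lemma box_pos_le (x : box) m j : (nsq (box_pos x) <= m ^ 2)%N ->
  (absz ((x j)%:Z - H%:Z) <= m)%N.
Proof.
rewrite /nsq (bigD1 j) //= mxE => le; rewrite -leq_sqr.
by apply: leq_trans le; apply: leq_addr.
Qed.

Lemma card_box_ball r m : (r <= m ^ 2)%N ->
  (#|[pred x : box | (nsq (box_pos x) <= r)%N]| <= m.*2.+1 ^ k)%N.
Proof.
move=> rm; pose A := [pred i : 'I_H.*2.+1 | (absz (i%:Z - H%:Z) <= m)%N].
have cA : (#|A| <= m.*2.+1)%N.
  pose f (i : 'I_H.*2.+1) : 'I_m.*2.+1 := inord (i + m - H).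
  rewrite -[leqRHS]card_ord -(@card_in_image _ _ f A); first exact: max_card.
  move=> i j; rewrite !inE => im jm /(congr1 val); rewrite /= !inordK; try lia.
  by move=> E; apply: val_inj => /=; lia.
apply: (@leq_trans (#|A| ^ k)); last first.
  by case: (posnP k) => [->|k0] //; rewrite leq_exp2r.
rewrite -[X in (_ <= _ ^ X)%N](card_ord k) -card_ffun_on.
apply/subset_leq_card/fintype.subsetP => x; rewrite inE => xr.
by apply/ffun_onP => j; rewrite inE; apply: box_pos_le (leq_trans xr rm).
Qed.

Hypothesis NH : (N <= H)%N.

Lemma sum_lazy_law : \sum_x eta x = 1.
Proof.
rewrite -(bigA_distr_bigA (fun (j : 'I_k) (i : 'I_H.*2.+1) => binpmf R N H i)) /=.
by rewrite big1 // => j _; apply: sum_binpmf1.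
Qed.

Lemma nsq_box_pos (x : box) :
  (nsq (box_pos x))%:R = \sum_j ((x j)%:R - H%:R) ^+ 2 :> R.
Proof.
rewrite /nsq natr_sum; apply: eq_bigr => j _; rewrite mxE natrX.
rewrite -[(absz _)%:R]/((absz _)%:Z%:~R) abszE intr_norm real_normK ?num_real //.
by rewrite intrB.
Qed.

Lemma sum_lazy_law_nsq :
  \sum_(x : box) eta x * (nsq (box_pos x))%:R = kk * (N%:R / 2).
Proof.
under eq_bigr do rewrite nsq_box_pos mulr_sumr.
rewrite exchange_big /= (eq_bigr (fun=> N%:R / 2)).
  by rewrite sumr_const card_ord [RHS]mulr_natl.
move=> i _.
pose F (j : 'I_k) (a : 'I_H.*2.+1) : R :=
  binpmf R N H a * (if j == i then (a%:R - H%:R) ^+ 2 else 1).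
transitivity (\sum_(x : box) \prod_j F j (x j)).
  apply: eq_bigr => x _; rewrite big_split /=; congr (_ * _).
  by rewrite (bigD1 i) //= eqxx big1 ?mulr1 // => j /negbTE ->.
rewrite -bigA_distr_bigA /= (bigD1 i) //= [X in _ * X]big1 ?mulr1.
  by rewrite -(sum_binpmf_var R NH); apply: eq_bigr => a _; rewrite /F eqxx.
move=> j /negbTE ji; rewrite -[RHS](sum_binpmf1 R NH); apply: eq_bigr => a _.
by rewrite /F ji mulr1.
Qed.

Lemma lazy_law_tail r : (0 < r)%N ->
  \sum_(x : box | (r < nsq (box_pos x))%N) eta x <= kk * (N%:R / 2) / r%:R.
Proof.
move=> r0; rewrite ler_pdivlMr ?ltr0n // -sum_lazy_law_nsq mulr_suml.
rewrite [leRHS](bigID (fun x : box => (r < nsq (box_pos x))%N)) /=.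
apply: ler_wpDr; first by apply: sumr_ge0 => x _; rewrite mulr_ge0 ?lazy_law_ge0.
by apply: ler_sum => x rx; rewrite ler_wpM2l ?lazy_law_ge0 // ler_nat ltnW.
Qed.

End Box.
End LazyLaw.

(** * Density along the lazy walk *)

Lemma abel_bound (R : realType) (T : finType) (v : T -> nat) (f : T -> R)
    (e : nat -> R) r X :
  (forall n, 0 <= e n.+1 <= e n) ->
  (forall p, (p <= r)%N -> `|\sum_(x | (v x <= p)%N) f x| <= X) ->
  `|\sum_(x | (v x <= r)%N) f x * e (v x)| <= X * e 0%N.
Proof.
move=> ee sX; pose s p := \sum_(x | (v x <= p)%N) f x.
have E : \sum_(x | (v x <= r)%N) f x * e (v x) =
    s r * e r + \sum_(p < r) s p * (e p - e p.+1).
  elim: r {sX} => [|r IH].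
    rewrite big_ord0 addr0 /s mulr_suml; apply: eq_bigr => x.
    by rewrite leqn0 => /eqP ->.
  have split (F : T -> R) : \sum_(x | (v x <= r.+1)%N) F x =
      \sum_(x | (v x <= r)%N) F x + \sum_(x | v x == r.+1) F x.
    rewrite (bigID (fun x => (v x <= r)%N)) /=; congr (_ + _); apply: eq_bigl => x.
      by lia.
    by lia.
  have sS : s r.+1 = s r + \sum_(x | v x == r.+1) f x := split f.
  rewrite (split (fun x => f x * e (v x))) IH big_ord_recr /= sS.
  rewrite (eq_bigr (fun x => f x * e r.+1)); last by move=> x /eqP ->.
  by rewrite -mulr_suml; ring.
have e0 p : 0 <= e p by case: p => [|p]; [have /andP[a b] := ee 0%N; apply: le_trans a b|have /andP[] := ee p].
rewrite E; apply: le_trans (ler_normD _ _) _.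
have -> : X * e 0%N = X * e r + \sum_(p < r) X * (e p - e p.+1).
  rewrite -mulr_sumr -mulrDr; congr (_ * _).
  elim: (r) => [|m IH]; first by rewrite big_ord0 addr0.
  by rewrite IH big_ord_recr /=; ring.
apply: lerD; first by rewrite normrM (ger0_norm (e0 r)) ler_wpM2r // sX.
apply: le_trans (ler_norm_sum _ _ _) _; apply: ler_sum => p _.
have ep : 0 <= e p - e p.+1 by rewrite subr_ge0; have /andP[] := ee p.
by rewrite normrM (ger0_norm ep) ler_wpM2r // sX // ltnW.
Qed.

Section BallCounts.
Variables (R : realType) (k : nat).

Lemma nsqE (b : 'rV[int]_k) : (nsq b)%:R = \sum_j (b 0 j)%:~R ^+ 2 :> R.
Proof.
rewrite /nsq natr_sum; apply: eq_bigr => j _; rewrite natrX.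
by rewrite -[(absz _)%:R]/((absz _)%:Z%:~R) abszE intr_norm real_normK ?num_real.
Qed.

Lemma enorm_le_sqrt (b : 'rV[int]_k) p : (enorm R b <= Num.sqrt p%:R) = (nsq b <= p)%N.
Proof. by rewrite /enorm -nsqE ler_sqrt // ler_nat. Qed.

Lemma box_pos_inj H : injective (@box_pos k H).
Proof.
move=> x y /rowP xy; apply/ffunP => j; apply: val_inj => /=.
by have := xy j; rewrite !mxE; lia.
Qed.

Lemma lattice_count_box H p (B : set 'rV[int]_k) : (p <= H ^ 2)%N ->
  lattice_count B (Num.sqrt p%:R : R) =
  #|[pred x : {ffun 'I_k -> 'I_H.*2.+1} | (nsq (box_pos x) <= p)%N & `[< B (box_pos x) >]]|.
Proof.
move=> pH; pose S : {set {ffun 'I_k -> 'I_H.*2.+1}} :=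
  finset (fun x => (nsq (box_pos x) <= p)%N && `[< B (box_pos x) >]).
transitivity #|S|; last by apply: eq_card => x; rewrite !inE.
rewrite -(card_imset _ (@inj_id _)) -(card_fset_set_image (f := @box_pos k H)); last first.
  by move=> x y _ _; split=> [/box_pos_inj|->].
rewrite /lattice_count; congr (#|` fset_set _|).
apply/seteqP; split=> b /=.
  move=> [Bb]; rewrite enorm_le_sqrt => bp.
  have bH j : (absz (b 0%R j) <= H)%N.
    rewrite -leq_sqr; apply: leq_trans pH; apply: leq_trans bp.
    by rewrite /nsq (bigD1 j) //= leq_addr.
  pose x : {ffun 'I_k -> 'I_H.*2.+1} := [ffun j => inord (absz (b 0 j + H%:Z))].
  have xb : box_pos x = b.
    apply/rowP => j; rewrite !mxE ffunE; have := bH j; move: (b 0 j) => a aH.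
    by rewrite inordK; lia.
  by exists x => //; rewrite inE xb bp; apply/asboolP.
by case=> x; rewrite inE => /andP[xp /asboolP xB] <-; rewrite enorm_le_sqrt.
Qed.

(** The threshold [p0] is independent of the box, which will have to grow with the word length. *)
Lemma density_eventually (B : set 'rV[int]_k) (d e : R) : has_density B d -> 0 < e ->
  exists p0 : nat, forall p H, (p0 <= p <= H ^ 2)%N ->
  `|\sum_(x : {ffun 'I_k -> 'I_H.*2.+1} | (nsq (box_pos x) <= p)%N)
     ((`[< B (box_pos x) >])%:R - d)| <=
  e * (#|[pred x : {ffun 'I_k -> 'I_H.*2.+1} | (nsq (box_pos x) <= p)%N]|)%:R.
Proof.
move=> /cvgrPdist_le Bd e0; have [M [_ HM]] := Bd e e0.
pose M0 := Num.max M 0.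
have M00 : 0 <= M0 by rewrite le_max lexx orbT.
exists (Num.truncn (M0 ^+ 2)).+1 => p H /andP[p0p pH].
have pM : M < Num.sqrt p%:R.
  have MM0 : M <= M0 by rewrite le_max lexx.
  apply: le_lt_trans MM0 _; rewrite -ltr_sqr ?nnegrE ?sqrtr_ge0 // sqr_sqrtr //.
  have /andP[_ h] := truncn_itv (sqr_ge0 M0).
  by apply: lt_le_trans h _; rewrite ler_nat.
have := HM _ pM; rewrite /= !(lattice_count_box _ pH).
set a := #|_|; set b := #|_|; set c := #|_|.
have -> : b = c by apply: eq_card => x; rewrite !inE asboolT // andbT.
have c0 : (0 < c)%N.
  apply/card_gt0P; exists [ffun=> inord H]; rewrite inE /nsq big1 // => j _.
  by rewrite mxE ffunE inordK ?subrr //; lia.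
have cR : 0 < c%:R :> R by rewrite ltr0n.
have -> : \sum_(x : {ffun 'I_k -> 'I_H.*2.+1} | (nsq (box_pos x) <= p)%N)
     ((`[< B (box_pos x) >])%:R - d) = a%:R - d * c%:R.
  rewrite sumrB sumr_const -[d *+ _]mulr_natr; congr (_ - d * _).
  rewrite -natr_sum; congr (_%:R); rewrite /a -sum1_card big_mkcond [RHS]big_mkcond /=.
  by apply: eq_bigr => x _; rewrite inE; case: leq; case: asbool.
have -> : a%:R - d * c%:R = - (d - a%:R / c%:R) * c%:R by field; apply: lt0r_neq0.
by rewrite normrM normrN (ger0_norm (ltW cR)) ler_pM2r.
Qed.

End BallCounts.

Section LazyDensity.
Variables (R : realType) (k : nat).
Hypothesis k_gt0 : (0 < k)%N.
Local Notation kk := (k%:R : R).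

Lemma sqrt_nat_ge1 N : (0 < N)%N -> 1 <= Num.sqrt (N%:R : R).
Proof. by move=> N0; rewrite -[leLHS]sqrtr1 ler_wsqrtr // ler1n. Qed.

Lemma nat_sqrt_bounds N : (0 < N)%N ->
  exists s, (N <= s ^ 2)%N /\ s%:R <= 2 * Num.sqrt N%:R :> R.
Proof.
move=> N0; have s0 := sqrtr_ge0 (N%:R : R).
have /andP[h1 h2] := truncn_itv s0; exists (Num.truncn (Num.sqrt (N%:R : R))).+1; split.
  rewrite -(ler_nat R) natrX -[leLHS](@sqr_sqrtr R) //.
  by rewrite lerXn2r ?nnegrE // ltW.
have s1 := sqrt_nat_ge1 N0.
by rewrite -natr1; lra.
Qed.

Lemma card_box_ball_sqrt H L N : (0 < L)%N -> (0 < N)%N ->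
  (#|[pred x : {ffun 'I_k -> 'I_H.*2.+1} | (nsq (box_pos x) <= L ^ 2 * N)%N]|)%:R <=
  (6 * L%:R * Num.sqrt N%:R) ^+ k :> R.
Proof.
move=> L0 N0; have [s [Ns s2]] := nat_sqrt_bounds N0.
have le : (L ^ 2 * N <= (L * s) ^ 2)%N by rewrite expnMn leq_mul2l Ns orbT.
have := @card_box_ball k H _ _ le; rewrite -(ler_nat R) => h; apply: le_trans h _.
have L1 : 1 <= L%:R :> R by rewrite ler1n.
have s1 := sqrt_nat_ge1 N0.
rewrite natrX; apply: lerXn2r; rewrite ?nnegrE ?mulr_ge0 ?sqrtr_ge0 //.
rewrite -natr1 -mul2n !natrM; set t := Num.sqrt _ in s2 s1 *.
have : L%:R * s%:R <= L%:R * (2 * t) by rewrite ler_wpM2l.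
have : 1 <= L%:R * t by rewrite mulr_ege1.
by lra.
Qed.

Lemma central_prob_sqrt N : (0 < N)%N ->
  0 <= central_prob R N <= (Num.sqrt N%:R)^-1.
Proof.
move=> N0; have NR : 0 < N%:R :> R by rewrite ltr0n.
have c0 : 0 <= central_prob R N by rewrite divr_ge0 ?exprn_ge0.
rewrite c0 /= -ler_sqr ?nnegrE ?invr_ge0 ?sqrtr_ge0 // exprVn sqr_sqrtr ?(ltW NR) //.
rewrite -[leRHS]mul1r ler_pdivlMr //.
have := central_prob_le R N; have := sqr_ge0 (central_prob R N); nra.
Qed.

Section Bound.
Variables (H N L : nat).
Hypotheses (N_gt0 : (0 < N)%N) (L_gt0 : (0 < L)%N) (LN : (L ^ 2 <= N)%N) (NH : (N <= H)%N).
Local Notation box := {ffun 'I_k -> 'I_H.*2.+1}.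
Local Notation r := (L ^ 2 * N)%N.
Local Notation P := (central_prob R N).
Local Notation sN := (Num.sqrt (N%:R : R)).

Lemma r_le_sqr : (r <= N ^ 2)%N.
Proof. by rewrite -[(N ^ 2)%N]/(N * N)%N leq_mul2r LN orbT. Qed.

(** A relative error: 6 comes from [bin_ratio_heat], and 8 from bounding a coordinate by 2 L sqrt N,
    the 2 allowing for an integer square root. [LN] keeps the coordinates in the range of that
    lemma. *)
Lemma lazy_law_heat (x : box) : (nsq (box_pos x) <= r)%N ->
  `|lazy_law R N x - P ^+ k * expR (- ((nsq (box_pos x))%:R / N%:R))| <=
  P ^+ k * (48 * kk * L%:R ^+ 3 / sN).
Proof.
move=> xr; have NR : 0 < N%:R :> R by rewrite ltr0n.
have /andP[P0 PN] := central_prob_sqrt N_gt0.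
pose dj j := absz ((x j)%:Z - H%:Z).
have lawE : lazy_law R N x = P ^+ k * \prod_j bin_ratio R N (dj j).
  rewrite /lazy_law; under eq_bigr do rewrite binpmf_ratio.
  by rewrite big_split /= prodr_const card_ord.
have expE : expR (- ((nsq (box_pos x))%:R / N%:R)) =
    \prod_j expR (- ((dj j)%:R ^+ 2 / N%:R)) :> R.
  have nE : (nsq (box_pos x))%:R = \sum_j (dj j)%:R ^+ 2 :> R.
    by rewrite /nsq natr_sum; apply: eq_bigr => j _; rewrite mxE natrX.
  by rewrite nE -expR_sum sumrN -mulr_suml.
rewrite lawE expE -mulrBr normrM (ger0_norm (exprn_ge0 k P0)).
apply: ler_wpM2l; first exact: exprn_ge0.
apply: le_trans (prod_dist_le _ _) _.
- by move=> j; rewrite bin_ratio_ge0 bin_ratio_le1.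
- by move=> j; rewrite expR_ge0 expR_le1 oppr_le0 divr_ge0 ?sqr_ge0.
apply: (@le_trans _ _ (\sum_(j < k) 48 * L%:R ^+ 3 / sN)); last first.
  by rewrite sumr_const card_ord -mulr_natl; apply: ler_of_eq; ring.
apply: ler_sum => j _.
have jN : (dj j <= N)%N := box_pos_le j (leq_trans xr r_le_sqr).
apply: le_trans (bin_ratio_heat R N_gt0 jN) _.
have [s [Ns s2]] := nat_sqrt_bounds N_gt0.
have le : (r <= (L * s) ^ 2)%N by rewrite expnMn leq_mul2l Ns orbT.
have js : (dj j <= L * s)%N := box_pos_le j (leq_trans xr le).
have sN0 : 0 < sN by rewrite sqrtr_gt0.
have dle : (dj j)%:R <= L%:R * (2 * sN).
  apply: (@le_trans _ _ ((L * s)%N%:R)); first by rewrite ler_nat.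
  by rewrite natrM ler_wpM2l.
have d3 : (dj j)%:R ^+ 3 <= (L%:R * (2 * sN)) ^+ 3.
  by rewrite lerXn2r ?nnegrE ?mulr_ge0 // ltW.
have sNE : sN ^+ 2 = N%:R by rewrite sqr_sqrtr // ltW.
have -> : N%:R ^+ 2 = sN ^+ 4 by rewrite -[X in X ^+ 2 = _]sNE -exprM.
have -> : 48 * L%:R ^+ 3 / sN = 6 * (L%:R * (2 * sN)) ^+ 3 / sN ^+ 4.
  by field; apply: lt0r_neq0.
by rewrite ler_pM2r ?invr_gt0 ?exprn_gt0 // ler_pM2l.
Qed.

Variables (B : set 'rV[int]_k) (d e : R) (p0 : nat).
Hypothesis e_gt0 : 0 < e.
Local Notation f := (fun x : box => (`[< B (box_pos x) >])%:R - d).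
Hypothesis dens : forall p, (p0 <= p <= H ^ 2)%N ->
  `|\sum_(x : box | (nsq (box_pos x) <= p)%N) f x| <=
  e * (#|[pred x : box | (nsq (box_pos x) <= p)%N]|)%:R.
Local Notation Dd := (1 + `|d|).

Lemma density_gap_le (x : box) : `|f x| <= Dd.
Proof.
apply: le_trans (ler_normB _ _) _; rewrite lerD2r.
by case: asbool; rewrite ?normr1 ?normr0 ?ler01 ?lexx.
Qed.

(** Below [p0] the density says nothing, but those balls have bounded size, which is negligible
    against N^(k/2). *)
Lemma partial_sum_le p : (p <= r)%N ->
  `|\sum_(x : box | (nsq (box_pos x) <= p)%N) f x| <=
  e * (6 * L%:R * sN) ^+ k + Dd * (p0.*2.+1 ^ k)%N%:R.
Proof.
move=> pr; have D0 : 0 <= Dd by apply: addr_ge0.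
have ball m : (m <= r)%N -> (#|[pred x : box | (nsq (box_pos x) <= m)%N]|)%:R <=
    (6 * L%:R * sN) ^+ k :> R.
  move=> mr; apply: le_trans (card_box_ball_sqrt H L_gt0 N_gt0).
  rewrite ler_nat; apply/subset_leq_card/fintype.subsetP => x; rewrite !inE => h.
  exact: leq_trans h mr.
case: (leqP p0 p) => pp.
  apply: ler_wpDr; first by rewrite mulr_ge0.
  apply: le_trans (dens _) _; last by rewrite ler_pM2l // ball.
  rewrite pp (leq_trans pr) // (leq_trans r_le_sqr) // leq_sqr //.
apply: ler_wpDl; first by rewrite mulr_ge0 ?(ltW e_gt0) // exprn_ge0 // !mulr_ge0 // sqrtr_ge0.
apply: le_trans (ler_norm_sum _ _ _) _.
apply: (@le_trans _ _ (\sum_(x : box | (nsq (box_pos x) <= p)%N) Dd)).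
  by apply: ler_sum => x _; apply: density_gap_le.
rewrite sumr_const -[_ *+ _]mulr_natr ler_wpM2l // ler_nat.
have p0s : (p <= p0 ^ 2)%N.
  by apply: leq_trans (ltnW pp) _; rewrite -{1}[p0]expn1; case: (p0) pp => // m _; rewrite leq_pexp2l.
apply: leq_trans (@card_box_ball k H _ _ p0s).
by apply/subset_leq_card/fintype.subsetP => x; rewrite !inE.
Qed.

(** Abel summation against the radial Gaussian, the error of that Gaussian, and the tail. The weight
    P^k of a point times the volume of the ball is at most (6 L)^k, so e can be chosen after L and
    before N. *)
Lemma lazy_density_bound :
  `|\sum_(x : box) (`[< B (box_pos x) >])%:R * lazy_law R N x - d| <=
  e * (6 * L%:R) ^+ k
  + Dd * ((p0.*2.+1 ^ k)%N%:R + 48 * kk * L%:R ^+ 3 * (6 * L%:R) ^+ k) / sN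
  + Dd * kk / L%:R ^+ 2.
Proof.
have NR : 0 < N%:R :> R by rewrite ltr0n.
have sN0 : 0 < sN by rewrite sqrtr_gt0.
have L0 : 0 < L%:R :> R by rewrite ltr0n.
have D0 : 0 <= Dd by apply: addr_ge0.
have /andP[P0 PN] := central_prob_sqrt N_gt0.
have s1 := sqrt_nat_ge1 N_gt0.
have -> : \sum_(x : box) (`[< B (box_pos x) >])%:R * lazy_law R N x - d =
   \sum_(x : box) f x * lazy_law R N x.
  rewrite -[in LHS](mulr1 d) -(sum_lazy_law R k NH) mulr_sumr -sumrB.
  by apply: eq_bigr => x _; rewrite mulrBl.
rewrite (bigID (fun x : box => (nsq (box_pos x) <= r)%N)) /=.
apply: le_trans (ler_normD _ _) _; apply: lerD; last first.
  apply: le_trans (ler_norm_sum _ _ _) _.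
  apply: (@le_trans _ _ (\sum_(x : box | (r < nsq (box_pos x))%N) Dd * lazy_law R N x)).
    rewrite [leRHS](eq_bigl (fun x : box => ~~ (nsq (box_pos x) <= r)%N)); last by move=> x; rewrite ltnNge.
    apply: ler_sum => x _; rewrite normrM (ger0_norm (lazy_law_ge0 _ _ _)).
    by rewrite ler_wpM2r ?lazy_law_ge0 // density_gap_le.
  rewrite -mulr_sumr -mulrA ler_wpM2l //.
  have r0 : (0 < r)%N by rewrite muln_gt0 expn_gt0 L_gt0.
  apply: le_trans (lazy_law_tail R k NH r0) _.
  have -> : kk * (N%:R / 2) / (L ^ 2 * N)%N%:R = kk / L%:R ^+ 2 / 2.
    by rewrite natrM natrX; field; rewrite !lt0r_neq0.
  have : 0 <= kk / L%:R ^+ 2 by rewrite divr_ge0 // exprn_ge0 // ltW.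
  by lra.
pose E (n : nat) : R := expR (- (n%:R / N%:R)).
have -> : \sum_(x : box | (nsq (box_pos x) <= r)%N) f x * lazy_law R N x =
  P ^+ k * \sum_(x : box | (nsq (box_pos x) <= r)%N) f x * E (nsq (box_pos x)) +
  \sum_(x : box | (nsq (box_pos x) <= r)%N)
     f x * (lazy_law R N x - P ^+ k * E (nsq (box_pos x))).
  rewrite mulr_sumr -big_split; apply: eq_bigr => x _ /=; ring.
have Pk0 : 0 <= P ^+ k by apply: exprn_ge0.
have Pk1 : P ^+ k <= sN^-1 ^+ k by rewrite lerXn2r ?nnegrE ?invr_ge0 ?(ltW sN0).
have Pk2 : P ^+ k <= sN^-1.
  have i0 : 0 <= sN^-1 by rewrite invr_ge0 ltW.
  have i1 : sN^-1 <= 1 by rewrite invf_le1.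
  apply: le_trans Pk1 _; rewrite -[leRHS]expr1.
  exact: ler_wiXn2l.
have Pball : P ^+ k * (6 * L%:R * sN) ^+ k <= (6 * L%:R) ^+ k.
  rewrite -exprMn; apply: lerXn2r; rewrite ?nnegrE ?mulr_ge0 ?(ltW sN0) //.
  have : P * sN <= 1 by rewrite -ler_pdivlMr // div1r.
  have : 0 <= 6 * L%:R :> R by rewrite mulr_ge0.
  by nra.
apply: le_trans (ler_normD _ _) _.
have T1 : `|P ^+ k * \sum_(x : box | (nsq (box_pos x) <= r)%N) f x * E (nsq (box_pos x))| <=
   e * (6 * L%:R) ^+ k + Dd * (p0.*2.+1 ^ k)%N%:R / sN.
  rewrite normrM (ger0_norm Pk0).
  have Em n : 0 <= E n.+1 <= E n.
    by rewrite expR_ge0 ler_expR lerN2 ler_pM2r ?invr_gt0 // ler_nat leqnSn.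
  have := abel_bound Em partial_sum_le; rewrite {2}/E mul0r oppr0 expR0 mulr1 => A.
  apply: le_trans (ler_wpM2l Pk0 A) _.
  rewrite mulrDr; apply: lerD.
    by rewrite mulrCA ler_pM2l.
  by rewrite mulrC ler_wpM2l // mulr_ge0.
have T2 : `|\sum_(x : box | (nsq (box_pos x) <= r)%N)
     f x * (lazy_law R N x - P ^+ k * E (nsq (box_pos x)))| <=
   Dd * (48 * kk * L%:R ^+ 3 * (6 * L%:R) ^+ k) / sN.
  apply: le_trans (ler_norm_sum _ _ _) _.
  set c := 48 * kk * L%:R ^+ 3.
  have c0 : 0 <= c by rewrite !mulr_ge0 ?exprn_ge0 // ltW.
  apply: (@le_trans _ _ (\sum_(x : box | (nsq (box_pos x) <= r)%N) Dd * (P ^+ k * (c / sN)))).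
    by apply: ler_sum => x xr; rewrite normrM ler_pM // ?density_gap_le // lazy_law_heat.
  rewrite sumr_const -[_ *+ _]mulr_natr.
  apply: (@le_trans _ _ (Dd * (P ^+ k * (c / sN)) * (6 * L%:R * sN) ^+ k)).
    apply: ler_wpM2l; last exact: card_box_ball_sqrt.
    by rewrite !mulr_ge0 // invr_ge0 ltW.
  have -> : Dd * (P ^+ k * (c / sN)) * (6 * L%:R * sN) ^+ k =
     Dd * (c * (P ^+ k * (6 * L%:R * sN) ^+ k)) / sN by ring.
  rewrite ler_pM2r ?invr_gt0 // ler_wpM2l // ler_wpM2l //.
have -> : Dd * ((p0.*2.+1 ^ k)%N%:R + 48 * kk * L%:R ^+ 3 * (6 * L%:R) ^+ k) / sN =
  Dd * (p0.*2.+1 ^ k)%N%:R / sN + Dd * (48 * kk * L%:R ^+ 3 * (6 * L%:R) ^+ k) / sN by ring.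
by rewrite addrA; apply: lerD T1 T2.
Qed.

End Bound.
End LazyDensity.

(** * Density along closed words *)

Section WordDensity.
Variables (R : realType) (k : nat).
Hypothesis k_ge2 : (2 <= k)%N.
Local Notation kk := (k%:R : R).
Local Notation q := (branching R k).
Local Notation kap := (kap R k).
Implicit Types (B : set 'rV[int]_k) (n N H L : nat).

Definition word_mass B n : R := (#|cyc_words B n|)%:R / q ^+ n.

Lemma word_mass_ge0 B n : 0 <= word_mass B n.
Proof. by rewrite divr_ge0 // exprn_ge0 // ltW // q_gt0. Qed.

Lemma word_ab_box n H (w : n.-tuple (letter k)) : (n <= H)%N ->
  exists x : {ffun 'I_k -> 'I_H.*2.+1}, word_ab w = box_pos x.
Proof.
move=> nH; exists [ffun j => inord (count_mem (j, false) w + H - count_mem (j, true) w)].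
apply/rowP => j; rewrite !mxE ffunE.
have ft : (j, false) != (j, true) by rewrite xpair_eqE andbF.
have := count_le_size w ft; rewrite size_tuple.
move: (count_mem (j, false) w) (count_mem (j, true) w) => a b ab.
by rewrite inordK; lia.
Qed.

Lemma word_mass_box B n H : (n <= H)%N ->
  \sum_(x : {ffun 'I_k -> 'I_H.*2.+1}) (`[< B (box_pos x) >])%:R * word_law R n (box_pos x) =
  word_mass B n.
Proof.
move=> nH; rewrite /word_mass /word_law.
under eq_bigr do rewrite mulrA -natrM.
rewrite -mulr_suml -natr_sum; congr (_%:R / _).
transitivity (\sum_(x : {ffun 'I_k -> 'I_H.*2.+1}) \sum_(w : n.-tuple (letter k) | cyc_reduced w)
   (`[< B (box_pos x) >] && (word_ab w == box_pos x) : nat))%N.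
  apply: eq_bigr => x _; rewrite -sum1_card big_distrr /= big_mkcondr /=.
  by apply: eq_bigr => w _; case: eqP => _; rewrite ?andbT ?andbF ?muln1.
rewrite exchange_big /= -sum1_card big_mkcond [RHS]big_mkcond; apply: eq_bigr => w _.
rewrite inE; case: cyc_reduced => //=; have [x wx] := word_ab_box w nH.
rewrite (bigD1 x) //= wx eqxx andbT big1 ?addn0 => [|y yx]; first by case: asbool.
by rewrite (inj_eq (@box_pos_inj k H)) eq_sym (negbTE yx) andbF.
Qed.

(** At trivial weights the roots are q and 1: there are exactly q^n + 1 cyclically reduced words,
    plus 2 k - 2 for even n. *)
Lemma word_mass_total n : (0 < n)%N ->
  `|word_mass [set: 'rV[int]_k] n - 1| <= 8 * kk / n%:R.
Proof.
move=> n0; have q0 := q_gt0 R k_ge2; have k2 := kk_ge2 R k_ge2.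
have z0 (i : 'I_k) : (fun=> 1 : R) i != 0 by apply: oner_neq0.
have wt1 (a : letter k) : letter_wt (fun=> 1 : R) a = 1.
  by rewrite /letter_wt; case: a.2; rewrite ?invr1.
have := cyc_reduced_sum z0 n0.
rewrite (eq_bigr (fun=> 1)); last by move=> w _; rewrite big1.
rewrite (eq_bigr (fun=> 1) (fun a _ => wt1 a)) sum_letter1 -/q.
rewrite (@cheb_roots _ _ _ q 1); [|by rewrite /branching subrK|by rewrite mulr1].
rewrite sumr_const expr1n => cE {z0 wt1}.
have -> : word_mass [set: 'rV[int]_k] n - 1 = (1 + ((k.*2)%:R - 2) * (~~ odd n)%:R) / q ^+ n.
  rewrite /word_mass (_ : (#|_|)%:R = q ^+ n + 1 + ((k.*2)%:R - 2) * (~~ odd n)%:R).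
    by field; rewrite expf_neq0 // gt_eqF.
  rewrite -cE; congr (_%:R); apply: eq_card => w.
  by rewrite !inE asboolT ?andbT.
have kE : (k.*2)%:R = 2 * kk by rewrite -mul2n natrM.
have /andP[od0 od1] : 0 <= ((~~ odd n)%:R : R) <= 1 by case: (odd n); rewrite ?lexx ?ler01.
have k0 : 0 <= 2 * kk - 2 by lra.
rewrite kE ger0_norm; last first.
  by rewrite divr_ge0 ?exprn_ge0 ?(ltW q0) // addr_ge0 // mulr_ge0.
have e1 : expR (- (n%:R / 4)) <= 1 :> R by rewrite expR_le1 oppr_le0 divr_ge0.
have nR : 0 < n%:R^-1 :> R by rewrite invr_gt0 ltr0n.
have qn := qV_expR R k_ge2 n0.
have qn' : q^-1 ^+ n <= 4 / n%:R.
  by apply: le_trans qn _; rewrite ler_piMr // mulr_ge0 // ltW.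
apply: (@le_trans _ _ (2 * kk * (4 / n%:R))); last by apply: ler_of_eq; ring.
rewrite -exprVn; apply: ler_pM => //; first by rewrite addr_ge0 // mulr_ge0.
  by rewrite exprn_ge0 // invr_ge0 ltW.
have : (2 * kk - 2) * (~~ odd n)%:R <= (2 * kk - 2) * 1 by rewrite ler_wpM2l.
by lra.
Qed.

Section TotalVariation.
Variables (n N H L : nat).
Hypotheses (kn : (4 * k <= n)%N) (Nn : N%:R <= 2 * n%:R * kap < N%:R + 1).
Hypotheses (nH : (n < H)%N) (NH : (N <= H)%N) (L0 : (0 < L)%N).
Local Notation box := {ffun 'I_k -> 'I_H.*2.+1}.
Local Notation r := (L ^ 2 * n)%N.
Local Notation mu := (fun x : box => 2^-1 * (word_law R n (box_pos x) + word_law R n.+1 (box_pos x))).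
Local Notation eta := (fun x : box => lazy_law R N x).
Local Notation U := (fun x : box => (nsq (box_pos x) <= r)%N).

Let n0 : (0 < n)%N.
Proof. by apply: leq_trans kn; rewrite muln_gt0 /= ltnW. Qed.

Lemma ball_variation :
  \sum_(x : box | U x) `|mu x - eta x| <= ((6 * L%:R) ^+ k + l2_const R k) / n%:R / 2.
Proof.
have nR : 0 < n%:R :> R by rewrite ltr0n.
set s := Num.sqrt (n%:R : R); have s0 : 0 < s by rewrite sqrtr_gt0.
pose lam := (n%:R * s ^+ k)^-1.
have lam0 : 0 < lam by rewrite invr_gt0 mulr_gt0 // exprn_gt0.
(* AM-GM with weight [lam], balancing the volume of the ball against the L2
   distance. *)
apply: (@le_trans _ _ (\sum_(x : box | U x) (lam + (mu x - eta x) ^+ 2 / lam) / 2)).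
  apply: ler_sum => x _; rewrite ler_pdivlMr // -real_normK ?num_real //.
  set a := `|_|; have a0 : 0 <= a := normr_ge0 _.
  have : 0 <= (lam - a) ^+ 2 / lam by rewrite divr_ge0 ?sqr_ge0 // ltW.
  have -> : (lam - a) ^+ 2 / lam = lam - 2 * a + a ^+ 2 / lam by field; apply: lt0r_neq0.
  by lra.
rewrite -mulr_suml ler_pM2r ?invr_gt0 // big_split /= sumr_const -mulr_suml.
rewrite [leRHS]mulrDl; apply: lerD.
  rewrite -[lam *+ _]mulr_natl.
  have := card_box_ball_sqrt R k H L0 n0; rewrite -/s => h.
  apply: (@le_trans _ _ ((6 * L%:R * s) ^+ k * lam)); first by rewrite ler_pM2r.
  rewrite [(_ * s) ^+ k]exprMn /lam; apply: ler_of_eq; field.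
  by rewrite !lt0r_neq0 // exprn_gt0.
rewrite ler_pdivrMr //.
apply: (@le_trans _ _ (l2_const R k / n%:R ^+ 2 * s^-1 ^+ k)).
  have l2 := l2_gap k_ge2 kn Nn nH NH; apply: le_trans _ l2.
  rewrite [leRHS](bigID U) /=; apply: ler_wpDr => //.
  by apply: sumr_ge0 => x _; apply: sqr_ge0.
rewrite /lam exprVn; apply: ler_of_eq; field.
by rewrite !lt0r_neq0 // exprn_gt0.
Qed.

(** Only the lazy law needs a tail estimate: the mass of [mu] outside the ball is its total minus
    its mass inside, and both are comparable with those of [eta]. *)
Lemma tv_bound B :
  `|2^-1 * (word_mass B n + word_mass B n.+1) -
    \sum_(x : box) (`[< B (box_pos x) >])%:R * lazy_law R N x| <=
  ((6 * L%:R) ^+ k + l2_const R k + 8 * kk) / n%:R + 4 / L%:R ^+ 2.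
Proof.
have nR : 0 < n%:R :> R by rewrite ltr0n.
have k2 := kk_ge2 R k_ge2.
pose h x := mu x - eta x.
have massE A : 2^-1 * (word_mass A n + word_mass A n.+1) =
    \sum_(x : box) (`[< A (box_pos x) >])%:R * mu x.
  rewrite -(word_mass_box A (ltnW nH)) -(word_mass_box A nH) -big_split mulr_sumr.
  by apply: eq_bigr => x _ /=; ring.
have -> : 2^-1 * (word_mass B n + word_mass B n.+1) -
    \sum_(x : box) (`[< B (box_pos x) >])%:R * lazy_law R N x =
    \sum_(x : box) (`[< B (box_pos x) >])%:R * h x.
  by rewrite massE -sumrB; apply: eq_bigr => x _; rewrite mulrBr.
have Sabs : `|\sum_(x : box) (`[< B (box_pos x) >])%:R * h x| <= \sum_(x : box) `|h x|.
  apply: le_trans (ler_norm_sum _ _ _) _; apply: ler_sum => x _.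
  by rewrite normrM; case: asbool; rewrite ?normr1 ?normr0 ?mul1r ?mul0r ?normr_ge0.
apply: (le_trans Sabs); rewrite (bigID U) /=.
have mu0 x : 0 <= mu x.
  have w0 m : 0 <= word_law R m (box_pos x).
    by rewrite divr_ge0 ?exprn_ge0 // ltW // q_gt0.
  by rewrite mulr_ge0 ?addr_ge0.
have eta0 x : 0 <= eta x := lazy_law_ge0 R N x.
have total : \sum_(x : box) mu x - 1 <= 8 * kk / n%:R.
  have -> : \sum_(x : box) mu x = 2^-1 * (word_mass setT n + word_mass setT n.+1).
    by rewrite massE; apply: eq_bigr => x _; rewrite asboolT // mul1r.
  have h1 := le_trans (ler_norm _) (word_mass_total n0).
  have h2 := le_trans (ler_norm _) (word_mass_total (isT : 0 < n.+1)%N).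
  have h3 : 8 * kk / n.+1%:R <= 8 * kk / n%:R.
    by rewrite ler_wpM2l ?mulr_ge0 // lef_pV2 ?posrE ?ler_nat.
  move: (le_trans h2 h3) h1; move: (word_mass _ n) (word_mass _ n.+1) (8 * kk / n%:R) => a b c.
  by lra.
have out : \sum_(x : box | ~~ U x) `|h x| <=
    \sum_(x : box | ~~ U x) mu x + \sum_(x : box | ~~ U x) eta x.
  rewrite -big_split; apply: ler_sum => x _.
  apply: le_trans (ler_normB _ _) _.
  by rewrite (ger0_norm (mu0 x)) (ger0_norm (eta0 x)).
have muS : \sum_(x : box) mu x = \sum_(x : box | U x) mu x + \sum_(x : box | ~~ U x) mu x.
  exact: bigID.
have etaS : 1 = \sum_(x : box | U x) eta x + \sum_(x : box | ~~ U x) eta x.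
  by rewrite -(sum_lazy_law R k NH); apply: bigID.
have inU : \sum_(x : box | U x) eta x - \sum_(x : box | U x) mu x <= \sum_(x : box | U x) `|h x|.
  rewrite -sumrB; apply: ler_sum => x _; rewrite /h distrC; apply: ler_norm.
have bv := ball_variation.
have tail : \sum_(x : box | ~~ U x) eta x <= 2 / L%:R ^+ 2.
  have r0 : (0 < r)%N by rewrite muln_gt0 expn_gt0 L0.
  have LR : 0 < L%:R :> R by rewrite ltr0n.
  rewrite (eq_bigl (fun x : box => (r < nsq (box_pos x))%N)); last by move=> x; rewrite ltnNge.
  apply: le_trans (lazy_law_tail R k NH r0) _.
  have -> : kk * (N%:R / 2) / (L ^ 2 * n)%N%:R = (kk * N%:R / (2 * n%:R)) / L%:R ^+ 2.
    by rewrite natrM natrX; field; rewrite !lt0r_neq0.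
  rewrite ler_pM2r ?invr_gt0 ?exprn_gt0 // ler_pdivrMr ?mulr_gt0 //.
  have /andP[N1 _] := Nn; have kp := kapk R k_ge2; have kp1 := kap_le1 R k_ge2.
  have : kk * N%:R <= kk * (2 * n%:R * kap) by rewrite ler_wpM2l.
  have : (kap * kk) * n%:R <= 2 * n%:R by rewrite ler_pM2r //; lra.
  by lra.
rewrite -/h in bv.
have -> : ((6 * L%:R) ^+ k + l2_const R k + 8 * kk) / n%:R + 4 / L%:R ^+ 2 =
   2 * (((6 * L%:R) ^+ k + l2_const R k) / n%:R / 2) + 8 * kk / n%:R + 2 * (2 / L%:R ^+ 2).
  by field; rewrite !lt0r_neq0 // ltr0n.
have bv' : \sum_(x : box | U x) `|h x| <= ((6 * L%:R) ^+ k + l2_const R k) / n%:R / 2 := bv.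
move: (\sum_(x | U x) `|h x|) (\sum_(x | ~~ U x) `|h x|) bv' out inU => X Y.
move: (_ / n%:R / 2) (8 * kk / n%:R) (2 / L%:R ^+ 2) total tail => b1 b2 b3.
rewrite muS; lra.
Qed.

End TotalVariation.

(** Four errors of at most del / 4. The choices are nested: L makes the tails small, e beats the
    volume factor (6 L)^k, [p0] depends on e, and n comes last. *)
Lemma word_density B (d del : R) : has_density B d -> 0 < del ->
  exists n0, forall n, (n0 <= n)%N ->
  `|2^-1 * (word_mass B n + word_mass B n.+1) - d| <= del.
Proof.
move=> Bd del0; have k2 := kk_ge2 R k_ge2; have kp := kap_gt0 R k_ge2.
have k0 : (0 < k)%N by apply: ltnW.
pose D := 1 + `|d|; have D0 : 0 <= D by apply: addr_ge0.
pose up (x : R) := (Num.truncn x).+1.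
have upP (x : R) m : (up x <= m)%N -> x <= m%:R.
  move=> xm; apply: le_trans (ltW (truncnS_gt x)) _.
  by rewrite ler_nat.
pose L := up ((4 + D * kk) * 4 / del).
have L1 : 1 <= L%:R :> R by rewrite ler1n.
have LR : (4 + D * kk) / L%:R ^+ 2 <= del / 4.
  have := upP _ L (leqnn _); rewrite -/L ler_pdivrMr // => h.
  have L2 : 0 < L%:R ^+ 2 :> R by apply: exprn_gt0; lra.
  rewrite ler_pdivrMr //.
  have : del * L%:R <= del * L%:R ^+ 2.
    by rewrite ler_pM2l // expr2; nra.
  by lra.
have c0 : 0 < (6 * L%:R) ^+ k :> R by apply: exprn_gt0; lra.
pose e := del / 4 / (6 * L%:R) ^+ k.
have e0 : 0 < e by rewrite !divr_gt0.
have [p0 dens] := density_eventually Bd e0.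
pose c1 := D * ((p0.*2.+1 ^ k)%N%:R + 48 * kk * L%:R ^+ 3 * (6 * L%:R) ^+ k).
pose c2 := (6 * L%:R) ^+ k + l2_const R k + 8 * kk.
have c1_0 : 0 <= c1.
  by rewrite mulr_ge0 // addr_ge0 // !mulr_ge0 ?exprn_ge0 // ltW.
pose N0 : R := (c1 * 4 / del) ^+ 2 + (L ^ 2)%N%:R + 1.
pose n1 := (up (N0 / kap) + up (c2 * 4 / del) + 4 * k)%N.
exists n1 => n n1n.
have n0 : (0 < n)%N by apply: leq_trans n1n; rewrite /n1 addnC addn_gt0 muln_gt0 k0.
have nR : 0 < n%:R :> R by rewrite ltr0n.
have nN0 : N0 <= n%:R * kap.
  by rewrite -ler_pdivrMr //; apply: upP; apply: leq_trans n1n; rewrite /n1 -addnA leq_addr.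
have nc2 : c2 / n%:R <= del / 4.
  have : c2 * 4 / del <= n%:R.
    by apply: upP; apply: leq_trans n1n; rewrite /n1 addnAC leq_addl.
  by rewrite !ler_pdivrMr // => h; lra.
have kn : (4 * k <= n)%N by apply: leq_trans n1n; rewrite leq_addl.
have t0 : 0 <= 2 * n%:R * kap by rewrite !mulr_ge0 // ltW.
have /andP[N1 N2] := truncn_itv t0; set N := Num.truncn _ in N1 N2.
have Nn : N%:R <= 2 * n%:R * kap < N%:R + 1 by rewrite N1 natr1.
have N0_0 : (c1 * 4 / del) ^+ 2 + (L ^ 2)%N%:R <= N%:R.
  have h : N%:R + 1 = N.+1%:R :> R by rewrite natr1.
  have : 0 <= (c1 * 4 / del) ^+ 2 by apply: sqr_ge0.
  have : 0 <= (L ^ 2)%N%:R :> R by [].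
  by rewrite /N0 in nN0; lra.
have LN : (L ^ 2 <= N)%N.
  by rewrite -(ler_nat R); apply: le_trans N0_0; rewrite lerDr sqr_ge0.
have Npos : (0 < N)%N by apply: leq_trans LN; rewrite expn_gt0.
have NR : 0 < N%:R :> R by rewrite ltr0n.
have cN : c1 / Num.sqrt N%:R <= del / 4.
  have sN0 : 0 < Num.sqrt (N%:R : R) by rewrite sqrtr_gt0.
  have : c1 * 4 / del <= Num.sqrt N%:R.
    rewrite -ler_sqr ?nnegrE ?sqrtr_ge0 //; last by rewrite divr_ge0 ?mulr_ge0 // ltW.
    rewrite sqr_sqrtr ?(ltW NR) //; apply: le_trans N0_0; rewrite lerDl //.
  by rewrite !ler_pdivrMr // => h; lra.
have nH : (n < (2 * n).+1)%N by rewrite ltnS leq_pmull.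
have NH : (N <= (2 * n).+1)%N.
  apply: leqW; rewrite -(ler_nat R) natrM; apply: le_trans N1 _.
  by rewrite ler_piMr ?mulr_ge0 // kap_le1.
have L0 : (0 < L)%N by [].
have tv := tv_bound kn Nn nH NH L0 B.
have ld := lazy_density_bound k0 Npos L0 LN NH e0 (fun p => dens p _).
set s := \sum_(x : {ffun _}) _ in tv.
have ld' : `|s - d| <= e * (6 * L%:R) ^+ k + c1 / Num.sqrt N%:R + D * kk / L%:R ^+ 2 := ld.
have eE : e * (6 * L%:R) ^+ k = del / 4 by rewrite /e divfK // gt_eqF.
have Lsum : 4 / L%:R ^+ 2 + D * kk / L%:R ^+ 2 <= del / 4 by rewrite -mulrDl.
rewrite -/c2 in tv.
have -> : 2^-1 * (word_mass B n + word_mass B n.+1) - d =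
  (2^-1 * (word_mass B n + word_mass B n.+1) - s) + (s - d) by ring.
apply: le_trans (ler_normD _ _) _.
rewrite eE in ld'.
by lra.
Qed.

End WordDensity.

(** * From lengths n to lengths at most m *)

Section Vanishing.
Variable R : realType.
Implicit Types (u v w a rho : nat -> R).

Definition vanishing u := forall e : R, 0 < e -> exists n0, forall n, (n0 <= n)%N -> `|u n| <= e.

Lemma vanishing_le u v c : vanishing v -> (forall n, `|u n| <= c * `|v n|) -> vanishing u.
Proof.
move=> v0 uv e e0; have c1 : 0 < `|c| + 1 by rewrite ltr_pwDr.
have [n0 H] := v0 _ (divr_gt0 e0 c1); exists n0 => n /H vn.
apply: le_trans (uv n) _.
apply: (@le_trans _ _ ((`|c| + 1) * `|v n|)).
  by rewrite ler_wpM2r //; have := ler_norm c; lra.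
by rewrite mulrC -ler_pdivlMr.
Qed.

Lemma vanishingD u v : vanishing u -> vanishing v -> vanishing (fun n => u n + v n).
Proof.
move=> u0 v0 e e0; have e2 : 0 < e / 2 by rewrite divr_gt0.
have [n1 H1] := u0 _ e2; have [n2 H2] := v0 _ e2; exists (maxn n1 n2) => n.
rewrite geq_max => /andP[/H1 h1 /H2 h2]; apply: le_trans (ler_normD _ _) _; lra.
Qed.

Lemma vanishingMr u v M : vanishing u -> (forall n, `|v n| <= M) ->
  vanishing (fun n => u n * v n).
Proof.
move=> u0 vM; apply: (vanishing_le (c := M) u0) => n.
by rewrite normrM mulrC ler_wpM2r.
Qed.

Lemma vanishingS u : vanishing u -> vanishing (fun n => u n.+1).
Proof. by move=> u0 e /u0[n0 H]; exists n0 => n nn; apply: H; apply: leqW. Qed.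

Lemma vanishing_invn : vanishing (fun n => n%:R^-1).
Proof.
move=> e e0; exists (Num.truncn e^-1).+1 => n nn.
have n0 : 0 < n%:R :> R by rewrite ltr0n (leq_trans _ nn).
rewrite ger0_norm ?invr_ge0 ?(ltW n0) // -[leRHS]invrK lef_pV2 ?posrE ?invr_gt0 //.
by apply: le_trans (ltW (truncnS_gt _)) _; rewrite ler_nat.
Qed.

Lemma vanishing_bounded u : vanishing u -> exists M, forall n, `|u n| <= M.
Proof.
move=> /(_ 1 ltr01)[n0 H]; exists (\sum_(i < n0) `|u i| + 1) => n.
case: (ltnP n n0) => nn; last first.
  by apply: le_trans (H n nn) _; rewrite lerDr sumr_ge0.
rewrite (bigD1 (Ordinal nn)) //= -addrA lerDl addr_ge0 // sumr_ge0 //.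
Qed.

Variables (a rho z : nat -> R) (th : R).
Hypotheses (th_ge0 : 0 <= th) (th_lt1 : th < 1) (rho_th : forall n, `|rho n| <= th).
Hypothesis zE : forall n, z n.+1 = a n + rho n * z n.

Lemma recurrence_step n : `|z n.+1| <= `|a n| + th * `|z n|.
Proof.
rewrite zE; apply: le_trans (ler_normD _ _) _; rewrite lerD2l normrM.
by rewrite ler_wpM2r.
Qed.

Lemma recurrence_bounded M : (forall n, `|a n| <= M) -> exists M', forall n, `|z n| <= M'.
Proof.
move=> aM; have M0 : 0 <= M := le_trans (normr_ge0 _) (aM 0%N).
have c0 : 0 < 1 - th by rewrite subr_gt0.
exists (`|z 0%N| + M / (1 - th)); elim=> [|n IH].
  by rewrite lerDl divr_ge0 // ltW.
apply: le_trans (recurrence_step n) _.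
have h : th * `|z n| <= th * (`|z 0%N| + M / (1 - th)) by rewrite ler_wpM2l.
have Mc : M / (1 - th) = M + th * (M / (1 - th)) by field; apply: lt0r_neq0.
have h2 : th * `|z 0%N| <= `|z 0%N| by rewrite ler_piMl // ltW.
have h3 := aM n; have h4 : `|a n| + th * `|z n| <= M + (`|z 0%N| + th * (M / (1 - th))).
  by rewrite mulrDr in h; lra.
by rewrite [M / _ in leRHS]Mc; lra.
Qed.

(** The contraction forgets the initial value geometrically, and eventually the forcing term alone
    decides. *)
Lemma recurrence_vanishing : vanishing a -> vanishing z.
Proof.
move=> a0 e e0; have c0 : 0 < 1 - th by rewrite subr_gt0.
have e2 : 0 < e / 2 * (1 - th) by rewrite mulr_gt0 // divr_gt0.
have [n0 H] := a0 _ e2.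
have step j : `|z (n0 + j)%N| <= e / 2 + th ^+ j * `|z n0|.
  elim: j => [|j IH]; first by rewrite addn0 expr0 mul1r lerDr; lra.
  rewrite addnS; apply: le_trans (recurrence_step _) _.
  have h := H (n0 + j)%N (leq_addr _ _).
  have : th * `|z (n0 + j)%N| <= th * (e / 2 + th ^+ j * `|z n0|) by rewrite ler_wpM2l.
  by rewrite exprS; lra.
(* Chosen so that th = 1 / (1 + x): Bernoulli then gives th^j <= 1 / (x j). The case th = 0 is split
   off because of the division. *)
pose x := (1 - th) / th.
have [m Hm] : exists m, forall j, (m <= j)%N -> th ^+ j * `|z n0| <= e / 2.
  have [th0|th0] := eqVneq th 0.
    by exists 1%N => -[//|j] _; rewrite th0 expr0n mul0r; lra.
  have thp : 0 < th by rewrite lt_neqAle eq_sym th0.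
  have x0 : 0 < x by rewrite divr_gt0.
  have c1 : 0 <= `|z n0| / x by rewrite divr_ge0 // ltW.
  have V : vanishing (fun j => `|z n0| / x * j%:R^-1).
    apply: (vanishing_le (c := `|z n0| / x) vanishing_invn) => j.
    by rewrite normrM (ger0_norm c1).
  have e20 : 0 < e / 2 by rewrite divr_gt0.
  have [m Hm] := V _ e20.
  exists m.+1 => j mj; have j0 : 0 < j%:R :> R by rewrite ltr0n (leq_trans _ mj).
  have := Hm j (ltnW mj); rewrite normrM (ger0_norm c1) ger0_norm ?invr_ge0 ?ler0n // => h.
  apply: le_trans h.
  have xE : 1 + x = th^-1 by rewrite /x; field.
  have thE : th = (1 + x)^-1 by rewrite xE invrK.
  rewrite -mulrA -invfM mulrC; apply: ler_wpM2l => //.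
  have xj : 0 < x * j%:R by rewrite mulr_gt0.
  have x1 : 0 < 1 + x by rewrite addr_gt0.
  rewrite [X in X ^+ j]thE exprVn lef_pV2 ?posrE ?exprn_gt0 //.
  have := bernoulli j (ltW x0); rewrite [x * _]mulrC; lra.
exists (n0 + m)%N => n nn.
have := step (n - n0)%N; rewrite subnKC; last by apply: leq_trans nn; apply: leq_addr.
have := Hm (n - n0)%N; rewrite leq_subRL ?nn; last by apply: leq_trans nn; apply: leq_addr.
by move=> /(_ isT); lra.
Qed.

End Vanishing.

(** * Averages of ratios of cumulative counts *)

Section RatioAverage.
Variables (R : realType) (q d Mb : R) (P T K J : nat -> R).
Hypothesis q_ge3 : 3 <= q.
Hypothesis PS : forall m, P m.+1 = P m + K m.+1.
Hypothesis TS : forall m, T m.+1 = T m + J m.+1.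
Hypothesis T_gt0 : forall m, 0 < T m.
Let b n := n%:R * K n / q ^+ n.
Let t n := n%:R * J n / q ^+ n.
Hypothesis b_avg : vanishing (fun n => 2^-1 * (b n + b n.+1) - d).
Hypothesis t_lim : vanishing (fun n => t n - 1).
Hypothesis b_bound : forall n, `|b n| <= Mb.

(** Rescaled by q^n / n, the size of one term, the cumulative sums obey first-order recurrences
    whose factor [rho] tends to 1/q. [y] carries the deviation of P from d T, and [g], carrying T,
    tends to the geometric sum q / (q - 1). *)
Let y m := m.+1%:R / q ^+ m.+1 * (P m.+1 - d * T m.+1).
Let g m := m.+1%:R / q ^+ m.+1 * T m.+1.
Let f m := b m - d * t m.
Let rho m : R := m.+2%:R / (m.+1%:R * q).
Let s m : R := rho m - q^-1.

Let q_gt0 : 0 < q. Proof. exact: lt_le_trans (ltr0n R 3) q_ge3. Qed.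
Let q_neq0 : q != 0. Proof. exact: lt0r_neq0. Qed.

Let yS m : y m.+1 = f m.+2 + rho m * y m.
Proof.
rewrite /y /f /b /t /rho (PS m.+1) (TS m.+1) !exprS.
have qm : q ^+ m != 0 by rewrite expf_neq0.
have m1 : m.+1%:R != 0 :> R by rewrite pnatr_eq0.
by move: (m.+1%:R) (m.+2%:R) m1 => x1 x2 m1; field; rewrite qm q_neq0.
Qed.

Let gS m : g m.+1 = t m.+2 + rho m * g m.
Proof.
rewrite /g /t /rho (TS m.+1) !exprS.
have qm : q ^+ m != 0 by rewrite expf_neq0.
have m1 : m.+1%:R != 0 :> R by rewrite pnatr_eq0.
by move: (m.+1%:R) (m.+2%:R) m1 => x1 x2 m1; field; rewrite qm q_neq0.
Qed.

Let sE m : s m = q^-1 * m.+1%:R^-1.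
Proof.
have m1 : m.+1%:R != 0 :> R by rewrite pnatr_eq0.
rewrite /s /rho -[m.+2%:R]natr1; move: (m.+1%:R) m1 => x m1.
by field; rewrite q_neq0 m1.
Qed.

Let s_van : vanishing s.
Proof.
apply: (vanishing_le (c := q^-1) (vanishingS (@vanishing_invn R))) => m.
by rewrite sE normrM (@ger0_norm _ q^-1) // invr_ge0 ltW.
Qed.

Let rho_le m : `|rho m| <= 2 / 3.
Proof.
have m0 : 0 < m.+1%:R :> R by rewrite ltr0n.
rewrite ger0_norm ?divr_ge0 ?mulr_ge0 ?(ltW q_gt0) // ler_pdivrMr ?mulr_gt0 //.
have m1 : 1 <= m.+1%:R :> R by rewrite ler1n.
rewrite -[m.+2%:R]natr1; set x := m.+1%:R in m0 m1 *.
have : x * 3 <= x * q by rewrite ler_pM2l.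
lra.
Qed.

Let th0 : 0 <= 2 / 3 :> R. Proof. by lra. Qed.
Let th1 : 2 / 3 < 1 :> R. Proof. by lra. Qed.

Let f_bound : exists M, forall m, `|f m| <= M.
Proof.
have [M HM] := vanishing_bounded t_lim.
exists (Mb + `|d| * (M + 1)) => m; apply: le_trans (ler_normB _ _) _.
apply: lerD (b_bound m) _; rewrite normrM ler_wpM2l //.
have -> : t m = (t m - 1) + 1 by rewrite subrK.
by apply: le_trans (ler_normD _ _) _; rewrite normr1 lerD2r.
Qed.

Let f_avg : vanishing (fun m => f m + f m.+1).
Proof.
have V1 : vanishing (fun m => 2 * (2^-1 * (b m + b m.+1) - d)).
  by apply: (vanishing_le (c := 2) b_avg) => m; rewrite normrM ger0_norm.
have V2 : vanishing (fun m => - d * ((t m - 1) + (t m.+1 - 1))).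
  apply: (vanishing_le (c := `|d|) (vanishingD t_lim (vanishingS t_lim))) => m.
  by rewrite normrM normrN.
move=> e /(vanishingD V1 V2)[n0 H]; exists n0 => m /H.
by congr (`|_| <= _); rewrite /f; field.
Qed.

Let y_bound : exists M, forall m, `|y m| <= M.
Proof.
have [M HM] := f_bound.
exact: (recurrence_bounded th0 th1 rho_le yS (fun m => HM m.+2)).
Qed.

(** [y] may oscillate with [f], but sums of neighbours obey the same recurrence with a forcing term
    that vanishes: pair sums of [f], plus the bounded [y] times a vanishing variation of [rho]. *)
Let y_avg : vanishing (fun m => y m + y m.+1).
Proof.
pose a m := (f m.+2 + f m.+3) + (s m.+1 - s m) * y m.+1.
have zS m : y m.+1 + y m.+2 = a m + rho m * (y m + y m.+1).
  rewrite (yS m.+1) [in LHS](yS m) /a (_ : s m.+1 - s m = rho m.+1 - rho m); last first.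
    by rewrite /s; ring.
  by rewrite [in RHS](yS m); ring.
apply: (recurrence_vanishing th0 th1 rho_le zS).
have [M HM] := y_bound.
apply: vanishingD (vanishingS (vanishingS f_avg)) _.
apply: (vanishingMr _ (fun m => HM m.+1)).
apply: vanishingD (vanishingS s_van) _.
by apply: (vanishing_le (c := 1) s_van) => m; rewrite normrN mul1r.
Qed.

Let G := q / (q - 1).
Let w m := g m - G.

Let w_van : vanishing w.
Proof.
have q1 : q - 1 != 0 by apply: lt0r_neq0; have := q_ge3; lra.
have wS m : w m.+1 = ((t m.+2 - 1) + s m * G) + rho m * w m.
  rewrite /w gS (_ : rho m = s m + q^-1); last by rewrite /s subrK.
  have GE : 1 - G + q^-1 * G = 0 by rewrite /G; field; rewrite q1 q_neq0.
  have : t m.+2 + (s m + q^-1) * g m - G =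
    t m.+2 - 1 + s m * G + (s m + q^-1) * (g m - G) + (1 - G + q^-1 * G) by ring.
  by rewrite GE addr0.
apply: (recurrence_vanishing th0 th1 rho_le wS).
apply: vanishingD (vanishingS (vanishingS t_lim)) _.
exact: (vanishingMr s_van (fun=> lexx `|G|)).
Qed.

Lemma ratio_average :
  vanishing (fun m => 2^-1 * (P m / T m + P m.+1 / T m.+1) - d).
Proof.
move=> e e0; have [Y HY] := y_bound.
have Y0 : 0 <= Y := le_trans (normr_ge0 _) (HY 0%N).
have G1 : 1 <= G by rewrite /G ler_pdivlMr; have := q_ge3; lra.
have e2 : 0 < e / 2 by rewrite divr_gt0.
have c0 : 0 < e / (8 * (Y + 1)) by rewrite divr_gt0 // mulr_gt0 //; lra.
have [n1 H1] := y_avg e2; have [n2 H2] := w_van c0.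
have h12 : 0 < 1 / 2 :> R by lra.
have [n3 H3] := w_van h12.
exists (maxn n1 (maxn n2 n3)).+1 => -[//|m]; rewrite ltnS !geq_max => /and3P[m1 m2 m3].
have gP n : (n3 <= n)%N -> 1 / 2 <= g n.
  by move=> /H3; rewrite /w ler_norml => /andP[h _]; lra.
have gm := gP m m3; have gm1 := gP m.+1 (leqW m3).
have ratioE n : P n.+1 / T n.+1 = d + y n / g n.
  have n0 : n.+1%:R / q ^+ n.+1 != 0 :> R.
    by rewrite mulf_neq0 ?pnatr_eq0 // invr_neq0 // expf_neq0.
  rewrite /y /g -mulf_div divff // mul1r; field; apply: lt0r_neq0; exact: T_gt0.
(* Putting both quotients over [g m] exposes the cancelling sum of [y]; the correction is small
   because [g m] and [g m.+1] have the same limit. *)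
have -> : 2^-1 * (P m.+1 / T m.+1 + P m.+2 / T m.+2) - d =
  2^-1 * ((y m + y m.+1) / g m + y m.+1 * (w m - w m.+1) / (g m * g m.+1)).
  rewrite !ratioE /w; field; apply/andP; split; apply: lt0r_neq0; lra.
have gi : 0 <= (g m)^-1 <= 2.
  apply/andP; split; first by rewrite invr_ge0; lra.
  by rewrite -[leRHS]invrK lef_pV2 ?posrE; lra.
have gi1 : 0 <= (g m * g m.+1)^-1 <= 4.
  have : 1 / 4 <= g m * g m.+1 by nra.
  move=> h; apply/andP; split; first by rewrite invr_ge0; lra.
  by rewrite -[leRHS]invrK lef_pV2 ?posrE; lra.
have A1 : `|(y m + y m.+1) / g m| <= e.
  move: gi => /andP[gi0 gi2]; rewrite normrM (ger0_norm gi0).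
  have := ler_pM (normr_ge0 _) gi0 (H1 m m1) gi2; lra.
have A2 : `|y m.+1 * (w m - w m.+1) / (g m * g m.+1)| <= e.
  move: gi1 => /andP[gi0 gi2]; rewrite normrM (ger0_norm gi0) normrM.
  have B1 : `|w m - w m.+1| <= 2 * (e / (8 * (Y + 1))).
    apply: le_trans (ler_normB _ _) _.
    by have := H2 m m2; have := H2 m.+1 (leqW m2); lra.
  have B2 := ler_pM (normr_ge0 _) (normr_ge0 _) (HY m.+1) B1.
  have B3 : Y * (2 * (e / (8 * (Y + 1)))) <= e / 4.
    have -> : Y * (2 * (e / (8 * (Y + 1)))) = (e / 4) * (Y / (Y + 1)).
      by field; apply: lt0r_neq0; lra.
    rewrite ler_piMr //; first by lra.
    by rewrite ler_pdivrMr; lra.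
  have B4 := ler_pM (mulr_ge0 (normr_ge0 _) (normr_ge0 _)) gi0 (le_trans B2 B3) gi2.
  by apply: le_trans B4 _; lra.
rewrite normrM ger0_norm //.
have := ler_normD ((y m + y m.+1) / g m) (y m.+1 * (w m - w m.+1) / (g m * g m.+1)).
by lra.
Qed.

End RatioAverage.

(** * From words to conjugacy classes *)

Section NecklaceDensity.
Variables (R : realType) (k : nat).
Hypothesis k_ge2 : (2 <= k)%N.
Local Notation q := (branching R k).

Definition necklace_mass (B : set 'rV[int]_k) n : R :=
  n%:R * (#|necklaces B n|)%:R / q ^+ n.

(* The crude count of words with a period is enough because 2k < (2k-1)^2. *)
Lemma periodic_mass n : (0 < n)%N ->
  n%:R * (#|@periodic_words k n|)%:R / q ^+ n <= 162 / n%:R :> R.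
Proof.
move=> n0; have k2 := kk_ge2 R k_ge2; have q0 := q_gt0 R k_ge2.
have k0 : (0 < k)%N by apply: ltnW.
have nR : 0 < n%:R :> R by rewrite ltr0n.
(* The ratio 2/3 to q is tuned so that c^2 >= 2 k holds for all k >= 2, with equality at k = 2. *)
pose c : R := 2 * q / 3.
have c1 : 1 <= c by rewrite /c; have := q_ge3 R k_ge2; lra.
have kc : (k.*2)%:R <= c ^+ 2.
  rewrite -mul2n natrM /c qE //; nra.
have pc : (k.*2 ^ n./2)%N%:R <= c ^+ n.
  rewrite natrX; apply: (@le_trans _ _ ((c ^+ 2) ^+ n./2)).
    by rewrite lerXn2r ?nnegrE ?sqr_ge0.
  rewrite -exprM mul2n; apply: ler_weXn2l => //.
  by rewrite -[leqRHS]odd_double_half leq_addl.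
have le1 : (#|@periodic_words k n|)%:R <= n%:R * c ^+ n.
  apply: (@le_trans _ _ ((n * k.*2 ^ n./2)%N%:R)); first by rewrite ler_nat card_periodic_words.
  by rewrite natrM ler_pM2l.
have e3 : 2 / 3 <= expR (- (1 / 3)) :> R by have := expR_ge1Dx (- (1 / 3) : R); lra.
have cq : c ^+ n / q ^+ n <= expR (- (n%:R / 3)).
  have -> : n%:R / 3 = n%:R * (1 / 3) :> R by lra.
  rewrite expRM_nat -expr_div_n; have -> : c / q = 2 / 3.
    by rewrite /c; field; apply: lt0r_neq0.
  by rewrite lerXn2r ?nnegrE ?expR_ge0 //; lra.
have n3 : 0 <= n%:R / 3 :> R by rewrite divr_ge0.
have := expR_ge1Dxn 2 n3; rewrite -[(3)`!]/6%N => ex.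
have E0 := expR_gt0 (n%:R / 3 : R).
(* 162 = 6 * 3^3 comes from the cubic term of the exponential series; the cube leaves 1 / n after
   the factor n^2. *)
have en : expR (- (n%:R / 3)) <= 162 / n%:R ^+ 3 :> R.
  rewrite expRN -[leRHS]invrK lef_pV2 ?posrE ?invr_gt0 ?divr_gt0 ?exprn_gt0 //.
  rewrite invf_div; move: ex; rewrite expr_div_n; lra.
apply: (@le_trans _ _ (n%:R * (n%:R * c ^+ n) / q ^+ n)).
  by rewrite ler_pM2r ?invr_gt0 ?exprn_gt0 // ler_pM2l.
have -> : n%:R * (n%:R * c ^+ n) / q ^+ n = n%:R ^+ 2 * (c ^+ n / q ^+ n) by ring.
apply: (@le_trans _ _ (n%:R ^+ 2 * (162 / n%:R ^+ 3))).
  by rewrite ler_pM2l ?exprn_gt0 // (le_trans cq).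
by apply: ler_of_eq; field; apply: lt0r_neq0.
Qed.

Lemma necklace_mass_gap (B : set 'rV[int]_k) : vanishing (fun n => necklace_mass B n - word_mass R B n).
Proof.
move=> e e0.
have V : vanishing (fun n : nat => 162 * n%:R^-1 : R).
  by apply: (vanishing_le (c := 162) (@vanishing_invn R)) => n; rewrite normrM ger0_norm.
have [n0 H] := V e e0; exists n0.+1 => n nn.
have npos : (0 < n)%N by apply: leq_trans nn.
have q0 := q_gt0 R k_ge2; have qn : 0 < q ^+ n by apply: exprn_gt0.
have lb : word_mass R B n <= necklace_mass B n.
  by rewrite ler_pM2r ?invr_gt0 // -natrM ler_nat necklaces_lb.
have ub : necklace_mass B n <= word_mass R B n + 162 / n%:R.
  apply: (@le_trans _ _ (word_mass R B n + n%:R * (#|@periodic_words k n|)%:R / q ^+ n)).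
    by rewrite -mulrDl ler_pM2r ?invr_gt0 // -!natrM -natrD ler_nat necklaces_ub.
  by rewrite lerD2l periodic_mass.
have := H n (ltnW nn); rewrite ger0_norm ?mulr_ge0 ?invr_ge0 //.
by rewrite ger0_norm ?subr_ge0 //; lra.
Qed.

Lemma word_mass_le (B : set 'rV[int]_k) n : word_mass R B n <= word_mass R [set: 'rV[int]_k] n.
Proof.
rewrite ler_pM2r ?invr_gt0 ?exprn_gt0 ?q_gt0 // ler_nat.
apply/subset_leq_card/fintype.subsetP => w; rewrite !inE => /andP[-> _] /=.
exact/asboolP.
Qed.

Lemma word_mass_lim : vanishing (fun n => word_mass R [set: 'rV[int]_k] n - 1).
Proof.
move=> e e0.
have V : vanishing (fun n : nat => 8 * k%:R * n%:R^-1 : R).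
  apply: (vanishing_le (c := 8 * k%:R) (@vanishing_invn R)) => n.
  by rewrite normrM (@ger0_norm _ (8 * k%:R)) ?mulr_ge0.
have [n0 H] := V e e0; exists n0.+1 => n nn.
have npos : (0 < n)%N by apply: leq_trans nn.
apply: le_trans (word_mass_total R k_ge2 npos) _.
by have := H n (ltnW nn); rewrite ger0_norm ?mulr_ge0 ?invr_ge0.
Qed.

Lemma Pi_density (B : set 'rV[int]_k) (d : R) : has_density B d ->
  vanishing (fun m => 2^-1 * ((Pi B m)%:R / (Pi [set: 'rV[int]_k] m)%:R +
    (Pi B m.+1)%:R / (Pi [set: 'rV[int]_k] m.+1)%:R) - d).
Proof.
move=> Bd.
have PS (A : set 'rV[int]_k) m : (Pi A m.+1)%:R = (Pi A m)%:R + (#|necklaces A m.+1|)%:R :> R.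
  by rewrite !PiE big_ord_recr natrD.
have T0 m : 0 < (Pi [set: 'rV[int]_k] m)%:R :> R.
  (* The class of the identity, of length 0, makes the total positive for every m. *)
  rewrite ltr0n PiE big_ord_recl addn_gt0 card_gt0; apply/orP; left.
  apply/set0Pn; exists (necklace [tuple]); apply: imset_f.
  by rewrite inE /=; apply/asboolP.
have gap A := necklace_mass_gap A.
have [M1 HM1] := vanishing_bounded (gap B).
have [M2 HM2] := vanishing_bounded word_mass_lim.
have bound n : `|necklace_mass B n| <= M1 + (M2 + 1).
  have -> : necklace_mass B n =
    (necklace_mass B n - word_mass R B n) + word_mass R B n by rewrite subrK.
  apply: le_trans (ler_normD _ _) _; apply: lerD (HM1 n) _.
  rewrite (ger0_norm (word_mass_ge0 R k_ge2 B n)); apply: le_trans (word_mass_le B n) _.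
  by have := le_trans (ler_norm _) (HM2 n); rewrite lerBlDr.
pose pi (A : set 'rV[int]_k) m : R := (Pi A m)%:R; pose nu (A : set 'rV[int]_k) n : R := (#|necklaces A n|)%:R.
apply: (@ratio_average R q d (M1 + (M2 + 1)) (pi B) (pi setT) (nu B) (nu setT)
  (q_ge3 R k_ge2) (PS B) (PS [set: 'rV[int]_k]) T0 _ _ bound).
- have Va : vanishing (fun n => 2^-1 * (word_mass R B n + word_mass R B n.+1) - d).
    by move=> e e0; apply: word_density.
  have Vg := vanishingD (gap B) (vanishingS (gap B)).
  have Vh : vanishing (fun n => 2^-1 * ((necklace_mass B n - word_mass R B n) +
     (necklace_mass B n.+1 - word_mass R B n.+1))).
    by apply: (vanishing_le (c := 2^-1) Vg) => n; rewrite normrM ger0_norm.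
  move=> e /(vanishingD Va Vh)[n0 H]; exists n0 => n /H.
  by congr (`|_| <= _); rewrite -!/(necklace_mass _ _); ring.
- move=> e /(vanishingD (gap [set: 'rV[int]_k]) word_mass_lim)[n0 H]; exists n0 => n /H.
  by congr (`|_| <= _); rewrite -!/(necklace_mass _ _); ring.
Qed.

End NecklaceDensity.

Unset Implicit Arguments.

Theorem theorem1p6 (R : realType) (k : nat) (k_ge2 : (2 <= k)%N)
    (B : set 'rV[int]_k) (dB : R) (B_density : has_density B dB) :
  (2^-1 * ((Pi B m)%:R / (Pi [set: 'rV[int]_k] m)%:R +
           (Pi B m.+1)%:R / (Pi [set: 'rV[int]_k] m.+1)%:R) : R)
    @[m --> \oo] --> dB.
Proof.
apply/cvgrPdist_le => e e0; have [n0 H] := Pi_density k_ge2 B_density e0.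
by exists n0 => // m /= /H; rewrite distrC.
Qed.
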